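(* Let $\Delta$ be a shellable $(d-1)$-dimensional simplicial complex and let $k$ be an infinite field. Then the barycentric subdivision $\mathrm{sd}(\Delta)$ is almost strong Lefschetz over $k$. That is, there exist a maximal linear system of parameters $\Theta$ of $k[\mathrm{sd}(\Delta)]$ and a linear form $\omega$ such that multiplication $$\omega^{d-1-2i}:(k[\mathrm{sd}(\Delta)]/\Theta)_i\to (k[\mathrm{sd}(\Delta)]/\Theta)_{d-1-i}$$ is injective for all $0\le i\le \lfloor (d-2)/2\rfloor$.
   Context: For a simplicial complex $\Gamma$ on vertex set $[n]$ and a field $k$, $k[\Gamma]=A/I_\Gamma$ is the Stanley–Reisner (face) ring, where $A=k[x_1,\dots,x_n]$ is graded by degree and $I_\Gamma$ is generated by the monomials whose support is not a face of $\Gamma$. An l.s.o.p. is a homogeneous system of parameters consisting of degree-one elements; a maximal l.s.o.p. $\Theta$ has $\dim\Gamma+1$ elements. For an integer $s$, a degree-one element $\omega\in A_1$ is an $s$-Lefschetz element for $k[\Gamma]/\Theta$ if multiplication $\omega^{s-2i}:(k[\Gamma]/\Theta)_i\to(k[\Gamma]/\Theta)_{s-i}$ is injective for all $0\le i\le\lfloor (s-1)/2\rfloor$. $\Gamma$ is $s$-Lefschetz over $k$ if there exists a pair $(\Theta,\omega)$ with $\Theta$ a maximal l.s.o.p. of $k[\Gamma]$ and $\omega$ an $s$-Lefschetz element for $k[\Gamma]/\Theta$; $\Gamma$ is almost strong Lefschetz over $k$ if it is $(\dim\Gamma)$-Lefschetz over $k$. The barycentric subdivision $\mathrm{sd}(\Delta)$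 is the simplicial complex whose vertices are the nonempty faces of $\Delta$ and whose faces are the chains $F_0\subsetneq F_1\subsetneq\dots\subsetneq F_r$ of nonempty faces; it has the same dimension $d-1$ as $\Delta$. A pure simplicial complex is shellable if it is a simplex or its facets admit an ordering $F_1,\dots,F_m$ such that for each $2\le i\le m$, $\langle F_i\rangle\cap\langle F_1,\dots,F_{i-1}\rangle$ is generated by a nonempty set of maximal proper faces of $F_i$ (here $\langle G_1,\dots,G_t\rangle$ denotes the complex of all subsets of the $G_j$). *)

(* Defs.v *)
From HB Require Import structures.
From mathcomp Require Import all_boot all_order all_algebra.
Set Implicit Arguments. Unset Strict Implicit. Unset Printing Implicit Defensive.
Import GRing.Theory.
Local Open Scope ring_scope.

Definition simplicial_complex (V : finType) (D : {set {set V}}) : Prop :=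
  set0 \in D /\ forall F G : {set V}, F \in D -> G \subset F -> G \in D.

(** [dim_is D d] : D has dimension d-1, i.e. the maximal face cardinality is d. *)
Definition dim_is (V : finType) (D : {set {set V}}) (d : nat) : Prop :=
  (exists2 F, F \in D & #|F| = d) /\ (forall F, F \in D -> (#|F| <= d)%N).

Definition facet (V : finType) (D : {set {set V}}) (F : {set V}) : Prop :=
  F \in D /\ forall G, G \in D -> F \subset G -> G = F.

Definition pure (V : finType) (D : {set {set V}}) : Prop :=
  forall F G, facet D F -> facet D G -> #|F| = #|G|.

Definition shellable (V : finType) (D : {set {set V}}) : Prop :=
  pure D /\
  ((exists F : {set V}, D = powerset F) \/
   exists s : seq {set V},
     [/\ uniq s, (forall F, F \in s <-> facet D F) &
      forall i, (0 < i < size s)%N ->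
        exists S : {set {set V}},
          [/\ S != set0,
              (forall A, A \in S -> A \subset nth set0 s i /\ #|A|.+1 = #|nth set0 s i|) &
              (forall G : {set V},
                  (G \subset nth set0 s i /\
                   exists2 j, (j < i)%N & G \subset nth set0 s j)
                  <-> exists2 A, A \in S & G \subset A)]]).

Definition sd_vert (V : finType) (D : {set {set V}}) : finType :=
  {F : {set V} | (F \in D) && (F != set0)}.

Definition sd (V : finType) (D : {set {set V}}) : {set {set sd_vert D}} :=
  [set C : {set sd_vert D} |
     [forall a in C, forall b in C, (val a \subset val b) || (val b \subset val a)]].

(** * Polynomials over k in variables indexed by W, as coefficient functions on
      monomials (exponent vectors). Only finitely supported / homogeneous
      ones are used below. *)
Definition mon (W : finType) := {ffun W -> nat}.
Definition deg (W : finType) (m : mon W) : nat := (\sum_(w : W) m w)%N.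
Definition msupp (W : finType) (m : mon W) : {set W} := [set w | (0 < m w)%N].
Definition poly_fn (k : fieldType) (W : finType) := mon W -> k.

Definition homog (k : fieldType) (W : finType) (f : poly_fn k W) (i : nat) : Prop :=
  forall m, f m != 0 -> deg m = i.

(** m / x_w (only used when x_w divides m) *)
Definition mdecr (W : finType) (m : mon W) (w : W) : mon W :=
  [ffun u => (m u - (u == w))%N].

(** multiplication by the linear form sum_w l w * x_w *)
Definition mulLin (k : fieldType) (W : finType) (l : W -> k) (f : poly_fn k W)
  : poly_fn k W :=
  fun m => \sum_(w | (0 < m w)%N) l w * f (mdecr m w).

(** f (homogeneous of degree i) lies in the degree-i part of I_G + (Theta):
    f = h + sum_j theta_j g_j with h a combination of degree-i monomials whose
    support is not a face, and g_j homogeneous of degree i-1 (zero if i = 0). *)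
Definition inJ (k : fieldType) (W : finType) (G : {set {set W}}) (d : nat)
  (Th : 'I_d -> W -> k) (i : nat) (f : poly_fn k W) : Prop :=
  exists (h : poly_fn k W) (g : 'I_d -> poly_fn k W),
    [/\ (forall m, h m != 0 -> deg m = i /\ msupp m \notin G),
        (forall j m, g j m != 0 -> (deg m).+1 = i) &
        (forall m, f m = h m + \sum_(j < d) mulLin (Th j) (g j) m)].

(** Theta (d linear forms, d = dim G + 1) is an l.s.o.p. of k[G]:
    k[G]/(Theta) is finite dimensional, i.e. vanishes in all large degrees. *)
Definition lsop (k : fieldType) (W : finType) (G : {set {set W}}) (d : nat)
  (Th : 'I_d -> W -> k) : Prop :=
  exists N : nat, forall i, (N <= i)%N ->
    forall f : poly_fn k W, homog f i -> inJ G Th i f.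

(** omega is an s-Lefschetz element for k[G]/Theta :
    omega^(s-2i) : (k[G]/Theta)_i -> (k[G]/Theta)_(s-i) injective for
    0 <= i <= floor((s-1)/2), i.e. 2i < s. *)
Definition lefschetz_elt (k : fieldType) (W : finType) (G : {set {set W}}) (d : nat)
  (Th : 'I_d -> W -> k) (om : W -> k) (s : nat) : Prop :=
  forall i, (2 * i < s)%N ->
    forall f : poly_fn k W, homog f i ->
      inJ G Th (s - i) (iter (s - 2 * i) (mulLin om) f) -> inJ G Th i f.

(** G is s-Lefschetz over k (maximal l.s.o.p. has dim G + 1 = d elements). *)
Definition s_lefschetz (k : fieldType) (W : finType) (G : {set {set W}}) (s : nat) : Prop :=
  exists d, dim_is G d /\
    exists (Th : 'I_d -> W -> k) (om : W -> k), lsop G Th /\ lefschetz_elt G Th om s.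

Definition almost_strong_lefschetz (k : fieldType) (W : finType) (G : {set {set W}}) : Prop :=
  exists d, dim_is G d /\ s_lefschetz k G d.-1.

Definition infinite_field (k : fieldType) : Prop :=
  ~ exists s : seq k, forall x : k, x \in s.

(* Main.v *)
(** The proof works with parameters in general position, "general position"
    being an openness property along lines of the parameter space: the
    conditions "the linear forms are a regular sequence in low degrees and
    multiplication by a power of the last form is injective" amount to rank
    equalities, which persist for all but finitely many points of a line, so
    over an infinite field two such nonempty conditions are satisfied at once.

    If the edge [ab] satisfies the link condition, letting the position of
    [b] tend to that of [a] degenerates the face ring of [G] to that of a
    complex built from the contraction of [ab] and from a double cone over the
    link of [ab], so the Lefschetz property of these two complexes passes to
    [G]; this is valid in every characteristic.  Undoing one stellar
    subdivision after the other in this way reduces the subdivision of a simplex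
    to cones over joins of boundaries of simplices, and these to the boundary of a
    single simplex.

    Finally, if [F] is the last facet of a shelling, the subdivision of the complex
    is glued from that of the preceding facets and that of [F] along the
    subdivision of a shellable ball or sphere of one dimension less; the
    connecting map of the gluing sequence shifts degrees by one, which is why
    the injectivity range [d - 1] (and not [d]) is preserved. *)

Require Import Defs.
From HB Require Import structures.
From Stdlib Require Import Classical FunctionalExtensionality.
From mathcomp Require Import all_boot all_order all_algebra.
From mathcomp Require Import perm mpoly ring zify.
Set Implicit Arguments. Unset Strict Implicit. Unset Printing Implicit Defensive.
Import GRing.Theory.
Local Open Scope ring_scope.

(** * Graded ideals and regular sequences *)

(** The obstacle is the characteristic. Special systems of two factors do not combine to one for
    their join: for the 4-cycle they give k[x,y]/(x^2,y^2), where in characteristic 2 every linear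
    form has square 0. So joins need moving parameters, and an explicit system is written down only
    for the boundary of one simplex: all variables become equal and the quotient is k[t]/(t^(d+1)).

    Edge contractions fit because the range is symmetric: the link of the edge has two parameters
    less, its classes enter one degree higher through multiplication by a variable, and (s + 2) - 2m
    = s - 2(m - 1).

    A cone adds a parameter and keeps the range. A subdivided simplex is a cone over a sphere, hence
    its range d - 1 for d parameters.

    The exact sequences of face rings are used after division by parameters. They remain exact
    because the first Koszul homology vanishes ([regular_comb_lift]); for this reason regularity is
    carried along with the Lefschetz property. *)

Section GradedIdeals.
Variables (k : fieldType) (n : nat).
Notation A := {mpoly k[n]}.
Implicit Types (f q : A) (Z : A -> Prop) (th : nat -> A).

Definition mfilter (P : pred 'X_{1..n}) f : A :=
  \sum_(m <- msupp f | P m) f@_m *: 'X_[m].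

Lemma mcoeff_mfilter P f m : (mfilter P f)@_m = if P m then f@_m else 0.
Proof.
rewrite /mfilter raddf_sum /= big_mkcond /=.
case: (boolP (m \in msupp f)) => [mf|mf].
  rewrite (bigD1_seq m) ?msupp_uniq //= big1 => [|i im].
    by rewrite addr0; case: ifP => // _; rewrite mcoeffZ mcoeffX eqxx mulr1.
  by case: ifP => // _; rewrite mcoeffZ mcoeffX (negPf im) mulr0.
rewrite (memN_msupp_eq0 mf) if_same big_seq big1 // => i mi.
case: ifP => // _; rewrite mcoeffZ mcoeffX; case: eqP => [im|_]; last by rewrite mulr0.
by rewrite im (negPf mf) in mi.
Qed.

Lemma mcoeff_pihomog d f m : (pihomog mdeg d f)@_m = if mdeg m == d then f@_m else 0.
Proof. exact: mcoeff_mfilter. Qed.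

Lemma pihomog_mul d e q (g : A) : q \is d.-homog ->
  pihomog mdeg (d + e) (q * g) = q * pihomog mdeg e g.
Proof.
move=> hq; rewrite {1}[g]mpolyE mulr_sumr linear_sum /= pihomogE mulr_sumr.
rewrite [RHS]big_mkcond /=; apply: eq_bigr => m _.
have hm : q * (g@_m *: 'X_[m]) \is (d + mdeg m).-homog.
  by apply: dhomogM => //; apply: rpredZ; rewrite dhomogX.
case: eqP => [<-|/eqP me]; first by rewrite pihomog_dE.
by rewrite (@pihomog_ne0 _ _ _ (d + mdeg m)) // eqn_add2l.
Qed.

Lemma pihomog_mul_lt d e q (g : A) : q \is d.-homog -> (e < d)%N ->
  pihomog mdeg e (q * g) = 0.
Proof.
move=> hq ed; rewrite [g]mpolyE mulr_sumr linear_sum /= big1 // => m _.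
rewrite (@pihomog_ne0 _ _ _ (d + mdeg m)) //; last first.
  by apply: dhomogM => //; apply: rpredZ; rewrite dhomogX.
by apply: contraTneq ed => <-; rewrite -leqNgt leq_addr.
Qed.

(** Ideals are predicates without generators, so that the preimage of an ideal under a substitution
    and the fibres of a family are ideals in the same sense. *)
Record gideal Z : Prop := GIdeal {
  gideal0 : Z 0;
  gidealD : forall f g, Z f -> Z g -> Z (f + g);
  gidealM : forall f g, Z g -> Z (f * g);
  gideal_pi : forall d f, Z f -> Z (pihomog mdeg d f) }.

Lemma gidealN Z f : gideal Z -> Z f -> Z (- f).
Proof. by move=> gZ Zf; rewrite -mulN1r; apply: gidealM. Qed.

Lemma gidealB Z f g : gideal Z -> Z f -> Z g -> Z (f - g).
Proof. by move=> gZ Zf Zg; apply: gidealD => //; apply: gidealN. Qed.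

Lemma gideal_sum Z (I : Type) (r : seq I) (P : pred I) F : gideal Z ->
  (forall i, P i -> Z (F i)) -> Z (\sum_(i <- r | P i) F i).
Proof.
by move=> gZ hF; elim/big_rec: _ => [|i x Pi Zx]; [exact: gideal0|apply: gidealD; auto].
Qed.

Definition comb th (i : nat) (g : nat -> A) : A := \sum_(j < i) th j * g j.

(** The ideal generated by [Z] and the first [i] parameters. Coefficients are indexed by all of
    [nat], so that [i] can vary without casts. *)
Definition inPar Z th i f := exists g : nat -> A, Z (f - comb th i g).

Definition injAt Z th i (psi : A) e :=
  forall f, f \is e.-homog -> inPar Z th i (psi * f) -> inPar Z th i f.

Definition regular Z th N d :=
  forall i e, (i < d)%N -> (e <= N)%N -> injAt Z th i (th i) e.

Definition lefschetz Z th om d s :=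
  forall m, (2 * m < s)%N -> injAt Z th d (om ^+ (s - 2 * m)) m.

Definition vanish Z th d D :=
  forall f, f \is D.-homog -> inPar Z th d f.

Lemma combS th i g : comb th i.+1 g = comb th i g + th i * g i.
Proof. by rewrite /comb big_ord_recr. Qed.

Lemma comb0 th g : comb th 0 g = 0.
Proof. by rewrite /comb big_ord0. Qed.

Lemma eq_comb th i g h : (forall j, (j < i)%N -> g j = h j) -> comb th i g = comb th i h.
Proof. by move=> E; apply: eq_bigr => j _; rewrite E. Qed.

Lemma combD th i g h : comb th i (fun j => g j + h j) = comb th i g + comb th i h.
Proof. by rewrite -big_split; apply: eq_bigr => j _; rewrite mulrDr. Qed.

Lemma combB th i g h : comb th i (fun j => g j - h j) = comb th i g - comb th i h.
Proof. by rewrite -sumrB; apply: eq_bigr => j _; rewrite mulrBr. Qed.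

Lemma combM th i q g : comb th i (fun j => q * g j) = q * comb th i g.
Proof. by rewrite mulr_sumr; apply: eq_bigr => j _; rewrite mulrCA. Qed.

Lemma comb_gideal Z th i g : gideal Z -> (forall j, (j < i)%N -> Z (g j)) -> Z (comb th i g).
Proof. by move=> gZ hg; apply: gideal_sum => // j _; apply: gidealM => //; apply: hg. Qed.

Lemma inPar_gideal Z th i : gideal Z -> (forall j, th j \is 1.-homog) -> gideal (inPar Z th i).
Proof.
move=> gZ th1; split.
- by exists (fun=> 0); rewrite /comb big1 ?subr0 => [|j _]; [exact: gideal0 gZ|rewrite mulr0].
- move=> f g [a Za] [b Zb]; exists (fun j => a j + b j); rewrite combD.
  have -> : f + g - (comb th i a + comb th i b) = (f - comb th i a) + (g - comb th i b) by ring.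
  exact: gidealD.
- move=> f g [a Za]; exists (fun j => f * a j).
  by rewrite combM -mulrBr; apply: gidealM.
move=> d f [a /(gideal_pi gZ d)]; rewrite linearB /=; case: d => [|d].
  move=> Za; exists (fun=> 0).
  rewrite (_ : comb _ _ _ = pihomog mdeg 0 (comb th i a)) // /comb linear_sum /=.
  by apply: eq_bigr => j _; rewrite mulr0 (@pihomog_mul_lt 1).
move=> Za; exists (fun j => pihomog mdeg d (a j)).
rewrite (_ : comb _ _ _ = pihomog mdeg d.+1 (comb th i a)) // /comb linear_sum /=.
by apply: eq_bigr => j _; rewrite -(pihomog_mul d _ (th1 j)).
Qed.

Lemma inPar_ideal Z th i f : gideal Z -> Z f -> inPar Z th i f.
Proof.
move=> gZ Zf; exists (fun=> 0).
by rewrite /comb big1 ?subr0 // => j _; rewrite mulr0.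
Qed.

Lemma inPar_comb Z th i g : gideal Z -> inPar Z th i (comb th i g).
Proof. by move=> gZ; exists g; rewrite subrr; apply: gideal0. Qed.

Lemma sub_inPar Z Z' th i f : (forall g, Z g -> Z' g) -> inPar Z th i f -> inPar Z' th i f.
Proof. by move=> s [g Zg]; exists g; apply: s. Qed.

Lemma inPar_sub Z th i f g : gideal Z -> (forall j, th j \is 1.-homog) ->
  inPar Z th i (f - g) -> inPar Z th i g -> inPar Z th i f.
Proof.
move=> gZ th1 hfg hg; rewrite -[f](subrK g).
exact: gidealD (inPar_gideal i gZ th1) _ _ hfg hg.
Qed.

Lemma inPar_homogS Z th i e f : gideal Z -> (forall j, th j \is 1.-homog) ->
  f \is e.+1.-homog -> inPar Z th i f ->
  exists2 g, (forall j, g j \is e.-homog) & Z (f - comb th i g).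
Proof.
move=> gZ th1 hf [g /(gideal_pi gZ e.+1)]; rewrite linearB /= pihomog_dE // => Zg.
exists (fun j => pihomog mdeg e (g j)) => [j|]; first exact: pihomogP.
rewrite (_ : comb _ _ _ = pihomog mdeg e.+1 (comb th i g)) // /comb linear_sum /=.
by apply: eq_bigr => j _; rewrite -(pihomog_mul e _ (th1 j)).
Qed.

Lemma inPar_homog0 Z th i f : gideal Z -> (forall j, th j \is 1.-homog) ->
  f \is 0.-homog -> inPar Z th i f -> Z f.
Proof.
move=> gZ th1 hf [g /(gideal_pi gZ 0%N)].
rewrite pihomogB (pihomog_dE hf) (_ : pihomog mdeg 0 (comb th i g) = 0) ?subr0 //.
by rewrite linear_sum /= big1 // => j _; rewrite (@pihomog_mul_lt 1).
Qed.

Lemma comb_homog th i e g : (forall j, th j \is 1.-homog) ->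
  (forall j, (j < i)%N -> g j \is e.-homog) -> comb th i g \is e.+1.-homog.
Proof.
move=> th1 hg; apply: rpred_sum => j _; rewrite -add1n.
by apply: dhomogM => //; apply: hg.
Qed.

(* Vanishing of the first Koszul homology of a regular sequence, with
   coefficients in the quotient by [Z]. *)
Lemma regular_comb_lift Z th N i e g : gideal Z -> (forall j, th j \is 1.-homog) ->
  regular Z th N i -> (e <= N)%N -> (forall j, g j \is e.-homog) -> Z (comb th i g) ->
  exists g', [/\ forall j, g' j \is e.-homog, forall j, Z (g' j) & comb th i g' = comb th i g].
Proof.
move=> gZ th1; elim: i g => [|i IH] g rg eN hg Zg.
  exists (fun=> 0); split=> [j|j|]; [exact: rpred0|exact: gideal0 gZ|by rewrite !comb0].
have hgi : inPar Z th i (g i).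
  apply: (rg i e) => //; exists (fun j => - g j).
  rewrite (_ : _ - _ = comb th i.+1 g) // combS addrC; congr (_ + _).
  by rewrite /comb -sumrN; apply: eq_bigr => j _; rewrite mulrN opprK.
(* In degree 0 the entry [g i] lies in [Z] itself and [p] is 0; to include this case, homogeneity is
   asked of the products [th i * p j] only. *)
have [p [hp hpc Zp]] : exists p, [/\ forall j, th i * p j \is e.-homog,
    comb th i p \is e.-homog & Z (g i - comb th i p)].
  case: e {IH rg} eN hg hgi => [|e] eN hg hgi.
    exists (fun=> 0).
    have -> : comb th i (fun=> 0) = 0 by rewrite /comb big1 // => j _; rewrite mulr0.
    split=> [j||]; rewrite ?mulr0 ?rpred0 ?subr0 //.
    exact: inPar_homog0 (hg i) hgi.
  have [p hp Zp] := inPar_homogS gZ th1 (hg i) hgi.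
  exists p; split => [j||] //; first by rewrite -add1n; apply: dhomogM.
  exact: comb_homog.
(* The part [th i * comb th i p] of the last term is moved into the earlier coefficients, which
   leaves a relation of length [i]. *)
have [||||g' [hg' Zg' Eg']] := IH (fun j => g j + th i * p j).
- by move=> i' e' lti; apply: rg; apply: ltnW.
- by [].
- by move=> j; apply: rpredD.
- have := gidealB gZ Zg (gidealM gZ (th i) Zp); rewrite combS combD combM.
  by congr Z; ring.
exists (fun j => if j == i then g i - comb th i p else g' j); split.
- by move=> j; case: ifP => // _; apply: rpredB.
- by move=> j; case: ifP.
rewrite !combS eqxx (@eq_comb _ _ _ g') => [|j /ltn_eqF -> //].
by rewrite Eg' combD combM; ring.
Qed.

End GradedIdeals.

(** * Face rings *)

Section StanleyReisner.
Variables (k : fieldType) (n : nat).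
Notation A := {mpoly k[n]}.
Implicit Types (f q : A) (Z : A -> Prop) (th : nat -> A) (G : {set 'I_n} -> bool).

Lemma inPar_decomp Z th i e f : gideal Z -> (forall j, th j \is 1.-homog) ->
  f \is e.-homog -> inPar Z th i f ->
  exists f1 g, [/\ f1 \is e.-homog, Z f1, f = f1 + comb th i g &
    forall j, g j \is e.-1.-homog].
Proof.
move=> gZ th1; case: e => [|e] hf If.
  exists f, (fun=> 0); split => //; first exact: inPar_homog0 hf If.
    by rewrite /comb big1 ?addr0 // => j _; rewrite mulr0.
  by move=> j; apply: rpred0.
have [g hg Zg] := inPar_homogS gZ th1 hf If.
exists (f - comb th i g), g; split=> //; last by rewrite subrK.
by apply: rpredB => //; apply: comb_homog.
Qed.

Lemma mfilter_homog P f e : f \is e.-homog -> mfilter P f \is e.-homog.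
Proof.
move/dhomogP=> hf; rewrite /mfilter big_seq_cond; apply: rpred_sum => m /andP[mf _].
by apply: rpredZ; rewrite dhomogX hf.
Qed.

Definition vsupp (m : 'X_{1..n}) : {set 'I_n} := [set i | (0 < m i)%N].

Lemma vsuppD m1 m2 : vsupp (m1 + m2) = vsupp m1 :|: vsupp m2.
Proof. by apply/setP=> i; rewrite !inE mnmDE addn_gt0. Qed.

Lemma vsuppU z : vsupp U_(z)%MM = [set z].
Proof. by apply/setP=> i; rewrite !inE mnm1E lt0b eq_sym. Qed.

Lemma vsupp0 : vsupp 0%MM = set0.
Proof. by apply/setP=> i; rewrite !inE mnm0E. Qed.

Definition down G := forall M N : {set 'I_n}, M \subset N -> G N -> G M.

(** The Stanley-Reisner ideal, read off coefficients. [G] may fail even at the empty set: the star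
    of a non-vertex is then a legitimate complex, with the unit ideal. *)
Definition SR G f := forall m, G (vsupp m) -> f@_m = 0.

Lemma SR_gideal G : down G -> gideal (SR G).
Proof.
move=> dG; split.
- by move=> m _; rewrite mcoeff0.
- by move=> f g Zf Zg m Gm; rewrite mcoeffD Zf // Zg // addr0.
- move=> f g Zg m Gm; rewrite mcoeffM big1 // => [[m1 m2]] /= /eqP Em.
  rewrite Zg ?mulr0 //; apply: dG Gm.
  by move/(congr1 vsupp): Em; rewrite vsuppD => ->; rewrite subsetUr.
by move=> d f Zf m Gm; rewrite mcoeff_pihomog Zf // if_same.
Qed.

Lemma sub_SR G G' f : (forall N, G' N -> G N) -> SR G f -> SR G' f.
Proof. by move=> s Zf m /s; apply: Zf. Qed.

Lemma mcoeffXM z f m : ('X_z * f)@_m = if (0 < m z)%N then f@_(m - U_(z)) else 0.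
Proof.
case: ifPn => [mz|mz].
  have {1}-> : m = (U_(z) + (m - U_(z)))%MM.
    by apply/mnmP=> i; rewrite mnmDE mnmBE mnm1E; case: eqP => [<-|_] /=; lia.
  by rewrite mulrC mcoeffMX.
rewrite mcoeffM big1 // => [[m1 m2]] /= /eqP Em.
rewrite mcoeffX; case: eqP => [Um1|]; last by rewrite mul0r.
by move/(congr1 (fun m : 'X_{1..n} => m z)): Em mz; rewrite mnmDE -Um1 mnm1E eqxx => ->.
Qed.

Lemma homogXU z : 'X_z \is [in k[n], 1.-homog].
Proof. by rewrite dhomogX /= mdeg1. Qed.

Definition vquot z f : A :=
  \sum_(m <- msupp f | (0 < m z)%N) f@_m *: 'X_[m - U_(z)].

Lemma vquotE z f : f = 'X_z * vquot z f + mfilter (fun m => m z == 0%N) f.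
Proof.
rewrite /vquot /mfilter {1}[f]mpolyE (bigID (fun m : 'X_{1..n} => (0 < m z)%N)) /=; congr (_ + _).
  rewrite mulr_sumr; apply: eq_bigr => m mz; rewrite -scalerAr -mpolyXD; congr (_ *: 'X_[_]).
  by apply/mnmP=> i; rewrite mnmDE mnmBE mnm1E; case: eqP => [<-|_] /=; lia.
by apply: eq_bigl => m; rewrite lt0n negbK.
Qed.

Lemma vquot_homog z f e : f \is e.+1.-homog -> vquot z f \is e.-homog.
Proof.
move/dhomogP=> hf; rewrite /vquot big_seq_cond; apply: rpred_sum => m /andP[mf mz].
apply: rpredZ; rewrite dhomogX -eqSS -(hf _ mf); apply/eqP.
rewrite -addn1 -(mdeg1 z) -mdegD; congr mdeg.
by apply/mnmP=> i; rewrite mnmDE mnmBE mnm1E; case: eqP => [<-|_] /=; lia.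
Qed.

(** * Deletion and star of a vertex *)

Section VertexDecomposition.
Variables (G Gd Gs : {set 'I_n} -> bool) (z : 'I_n).
Hypotheses (dG : down G) (hd : forall N, Gd N = (z \notin N) && G N)
  (hs : forall N, Gs N = G (z |: N)).

Lemma down_del : down Gd.
Proof.
move=> M N MN; rewrite !hd => /andP[zN GN].
by rewrite (contra (subsetP MN z)) //=; apply: dG GN.
Qed.

Lemma down_star : down Gs.
Proof. by move=> M N MN; rewrite !hs; apply: dG; rewrite setUS. Qed.

Lemma SR_del f : SR G f -> SR Gd f.
Proof. by apply: sub_SR => N; rewrite hd => /andP[]. Qed.

Lemma SR_del_var f : SR Gd ('X_z * f).
Proof. by move=> m; rewrite hd inE -leqNgt leqn0 mcoeffXM => /andP[/eqP->]. Qed.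

(** With [SR_del] and [SR_del_var]: the ideal of the deletion is [SR G] plus the ideal of ['X_z].
    Together with [SR_star] this is the exactness of 0 -> k[star](-1) -> k[G] -> k[deletion] ->
    0. *)
Lemma SR_del_rem f : SR Gd f -> SR G (f - 'X_z * vquot z f).
Proof.
move=> Zf m Gm; rewrite {1}[f](vquotE z) [X in X - _]addrC addrK mcoeff_mfilter.
by case: eqP => // mz; apply: Zf; rewrite hd Gm inE mz.
Qed.

Lemma SR_star f : SR G ('X_z * f) <-> SR Gs f.
Proof.
split=> Zf m; rewrite ?hs => Gm.
  have -> : f@_m = ('X_z * f)@_(m + U_(z)).
    rewrite mcoeffXM mnmDE mnm1E eqxx addn1 /=; congr mcoeff.
    by apply/mnmP=> i; rewrite mnmBE mnmDE addnK.
  by apply: Zf; rewrite vsuppD vsuppU setUC.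
rewrite mcoeffXM; case: ifP => // mz; apply: Zf; rewrite hs.
suff -> : z |: vsupp (m - U_(z)) = vsupp m by [].
apply/setP=> i; rewrite !inE mnmBE mnm1E [i == z]eq_sym.
by case: eqP => [<-|_]; rewrite ?mz ?subn0.
Qed.

(** The sequence of deletion and star stays exact modulo the first [i] parameters because these are
    regular on the deletion; the kernel in degree [e] is then controlled by the deletion in degree
    [e] and the star in degree [e - 1]. The bound on [dl + e] keeps the relation lifted in the
    proof, with coefficients of degree [dl + e - 1], within the regular range. *)
Lemma vertex_injAt th N i psi dl e :
  (forall j, th j \is 1.-homog) -> psi \is dl.-homog -> (dl + e <= N.+1)%N ->
  regular (SR Gd) th N i -> injAt (SR Gd) th i psi e ->
  (forall e', e = e'.+1 -> injAt (SR Gs) th i psi e') -> injAt (SR G) th i psi e.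
Proof.
move=> th1 hpsi leN rd injd injs f hf If.
have gG := SR_gideal dG; have gd := SR_gideal down_del.
have gI := inPar_gideal i gG th1.
have [|f1 [g [hf1 Zf1 Ef _]]] := inPar_decomp gd th1 hf (_ : inPar (SR Gd) th i f).
  by apply: injd => //; apply: sub_inPar If => q; apply: SR_del.
suff If1 : inPar (SR G) th i f1.
  by rewrite Ef; apply: gidealD => //; apply: inPar_comb.
have {}If : inPar (SR G) th i (psi * f1).
  rewrite (_ : psi * f1 = psi * f - comb th i (fun j => psi * g j)).
    by apply: gidealB => //; apply: inPar_comb.
  by rewrite Ef combM; ring.
case: e leN hf hf1 injd injs => [|e] leN hf hf1 injd injs.
  apply: inPar_ideal => // m Gm; case: (boolP (z \in vsupp m)) => zm.
    apply: (dhomog_nemf_coeff hf1); apply: contraTneq zm => /eqP.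
    by rewrite mdeg_eq0 => /eqP->; rewrite vsupp0 inE.
  by apply: Zf1; rewrite hd zm.
pose u := vquot z f1; have hu : u \is e.-homog by apply: vquot_homog.
have Zr := SR_del_rem Zf1.
suff Iu : inPar (SR G) th i ('X_z * u).
  by rewrite -[f1](subrK ('X_z * u)); apply: gidealD => //; apply: inPar_ideal.
have {}If : inPar (SR G) th i (psi * ('X_z * u)).
  rewrite (_ : _ * _ = psi * f1 - psi * (f1 - 'X_z * u)); last by ring.
  by apply: gidealB => //; apply: inPar_ideal => //; apply: (gidealM gG).
have hXu : 'X_z * u \is e.+1.-homog.
  by rewrite -add1n; apply: dhomogM => //; apply: homogXU.
have [f2 [g2 [_ Zf2 Ef2 hg2]]] := inPar_decomp gG th1 (dhomogM hpsi hXu) If.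
(* As ['X_z] vanishes on the deletion, [g2] is a syzygy there. Its replacement has entries in the
   ideal of the deletion, which modulo [SR G] are multiples of ['X_z], so that ['X_z] can be
   cancelled. *)
have [||g' [hg' Zg' Eg']] := regular_comb_lift gd th1 rd _ hg2 _.
- by lia.
- rewrite (_ : comb _ _ _ = 'X_z * (psi * u) - f2).
    by apply: (gidealB gd); [apply: SR_del_var|apply: SR_del].
  by rewrite mulrCA Ef2 addrAC subrr add0r.
have : inPar (SR Gs) th i (psi * u).
  exists (fun j => vquot z (g' j)); apply/SR_star.
  rewrite mulrBr -combM.
  have -> : 'X_z * (psi * u) = f2 + comb th i g' by rewrite mulrCA Ef2 Eg'.
  rewrite -addrA -combB; apply: (gidealD gG) => //; apply: (comb_gideal _ gG) => j _.
  exact: SR_del_rem.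
move/(injs e erefl _ hu) => [w /SR_star]; rewrite mulrBr -combM => Zw.
by exists (fun j => 'X_z * w j).
Qed.

Lemma vertex_vanish th i D : (forall j, th j \is 1.-homog) ->
  vanish (SR Gd) th i D.+1 -> vanish (SR Gs) th i D -> vanish (SR G) th i D.+1.
Proof.
move=> th1 Vd Vs f hf; have gG := SR_gideal dG; have gI := inPar_gideal i gG th1.
have [f1 [g [hf1 Zf1 Ef _]]] := inPar_decomp (SR_gideal down_del) th1 hf (Vd _ hf).
rewrite Ef; apply: gidealD => //; last exact: inPar_comb.
rewrite -[f1](subrK ('X_z * vquot z f1)); apply: gidealD => //.
  by apply: inPar_ideal => //; apply: SR_del_rem.
have [w /SR_star] := Vs _ (vquot_homog z hf1); rewrite mulrBr -combM => Zw.
by exists (fun j => 'X_z * w j).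
Qed.

End VertexDecomposition.

(** * Cones, with the apex variable as the last parameter *)

Section Cone.
Variables (G G' : {set 'I_n} -> bool) (z : 'I_n) (th : nat -> A) (d : nat).
Hypotheses (dG' : down G') (hz : forall N, G' N -> z \notin N)
  (hG : forall N, G N = G' (N :\ z)) (th1 : forall j, th j \is 1.-homog) (thd : th d = 'X_z).

Lemma down_cone : down G.
Proof. by move=> M N MN; rewrite !hG; apply: dG'; rewrite setSD. Qed.

Let del N : G' N = (z \notin N) && G N.
Proof.
rewrite hG; case: (boolP (z \in N)) => zN /=; last first.
  by congr G'; apply/setP => i; rewrite !inE; case: eqP => // ->; rewrite (negPf zN).
by apply: contraTF zN; apply: hz.
Qed.

Let star N : G N = G (z |: N).
Proof.
by rewrite !hG; congr G'; apply/setP => i; rewrite !inE; case: eqP.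
Qed.

Lemma cone_inPar f : inPar (SR G) th d.+1 f <-> inPar (SR G') th d f.
Proof.
have gG' := SR_gideal dG'; have gG := SR_gideal down_cone.
split=> [[g Zg]|[g Zg]].
  exists g; have := SR_del_var del (g d) => Zx.
  have := gidealD gG' (SR_del del Zg) Zx.
  by congr (SR _ _); rewrite combS thd; ring.
exists (fun j => if j == d then vquot z (f - comb th d g) else g j).
rewrite combS eqxx thd (@eq_comb _ _ _ _ _ g) => [|j /ltn_eqF -> //].
by rewrite opprD addrA; apply: SR_del_rem del _ Zg.
Qed.

(** For the last parameter, a syzygy over the base is lifted and ['X_z] cancelled. For the others,
    the deletion of [z] is the base and its star is the cone itself, so [vertex_injAt] applies by
    induction on the degree. *)
Lemma cone_regular N : regular (SR G') th N d -> regular (SR G) th N d.+1.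
Proof.
have gG' := SR_gideal dG'; have gG := SR_gideal down_cone.
move=> rg i e; rewrite ltnS leq_eqVlt => /orP[/eqP->|id] eN.
  move=> f hf If; rewrite thd in If.
  have [|f2 [g [_ Zf2 Ef2 hg]]] := inPar_decomp gG th1 (e := e.+1) _ If.
    by rewrite -add1n; apply: dhomogM => //; apply: homogXU.
  have [|g' [hg' Zg' Eg']] := regular_comb_lift gG' th1 rg eN hg _.
    rewrite (_ : comb _ _ _ = 'X_z * f - f2).
      by apply: (gidealB gG'); [apply: SR_del_var del _|apply: SR_del del _ _].
    by rewrite Ef2 addrAC subrr add0r.
  exists (fun j => vquot z (g' j)); apply/(SR_star star).
  rewrite mulrBr -combM Ef2 -Eg' -addrA -combB; apply: (gidealD gG) => //.
  apply: (comb_gideal _ gG) => j _; exact: SR_del_rem del _ _.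
elim: e eN => [|e IH] eN.
  apply: (@vertex_injAt G G' G z down_cone del star th N i (th i) 1) => //; try by lia.
    by move=> i' e' i'i; apply: rg; apply: ltn_trans id.
  exact: rg.
apply: (@vertex_injAt G G' G z down_cone del star th N i (th i) 1) => //; try by lia.
- by move=> i' e' i'i; apply: rg; apply: ltn_trans id.
- exact: rg.
by move=> e' [<-]; apply: IH; apply: ltnW.
Qed.

Lemma cone_lefschetz om s : lefschetz (SR G') th om d s -> lefschetz (SR G) th om d.+1 s.
Proof. by move=> L m ms f hf /cone_inPar If; apply/cone_inPar; apply: L hf If. Qed.

Lemma cone_vanish D : vanish (SR G') th d D -> vanish (SR G) th d.+1 D.
Proof. by move=> V f hf; apply/cone_inPar; apply: V hf. Qed.

End Cone.

(** * Gluing two ideals: the Mayer-Vietoris sequence *)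

Section Union.
Variables (Z1 Z2 ZI Z : A -> Prop) (sp : A -> A) (th : nat -> A) (N : nat).
Hypotheses (gZ1 : gideal Z1) (gZ2 : gideal Z2) (gZI : gideal ZI) (gZ : gideal Z)
  (ZE : forall f, Z f <-> Z1 f /\ Z2 f)
  (spP : forall f, ZI f -> Z1 (sp f) /\ Z2 (f - sp f))
  (sp_homog : forall e f, f \is e.-homog -> sp f \is e.-homog)
  (Z1I : forall f, Z1 f -> ZI f) (Z2I : forall f, Z2 f -> ZI f)
  (th1 : forall j, th j \is 1.-homog).

(** The sequence 0 -> A/Z -> A/Z1 + A/Z2 -> A/ZI -> 0 stays exact on the left modulo parameters
    regular on A/ZI: coefficients in [ZI] are split by [sp], and their parts in [Z1] serve for both
    pieces at once. *)
Lemma union_inPar i e f : regular ZI th N i -> (e <= N.+1)%N -> f \is e.-homog ->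
  Z1 f -> inPar Z2 th i f -> inPar Z th i f.
Proof.
move=> rI eN hf Z1f If.
have [f2 [h [hf2 Z2f2 Ef hh]]] := inPar_decomp gZ2 th1 hf If.
have [||h' [hh' ZIh' Eh']] := regular_comb_lift gZI th1 rI _ hh _; first by lia.
  rewrite (_ : comb _ _ _ = f - f2); last by rewrite Ef; ring.
  by apply: gidealB => //; [apply: Z1I|apply: Z2I].
exists (fun j => sp (h' j)); apply/ZE; split.
  by apply: gidealB => //; apply: comb_gideal => // j _; case: (spP (ZIh' j)).
rewrite Ef -Eh' -addrA -combB; apply: gidealD => //.
by apply: comb_gideal => // j _; case: (spP (ZIh' j)).
Qed.

Lemma union_injAt i e psi dl : psi \is dl.-homog ->
  injAt Z1 th i psi e ->
  (forall f, f \is e.-homog -> Z1 f -> inPar Z th i (psi * f) -> inPar Z th i f) ->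
  injAt Z th i psi e.
Proof.
move=> hpsi inj1 H f hf If; have gI := inPar_gideal i gZ th1.
have [|f1 [g [hf1 Zf1 Ef _]]] := inPar_decomp gZ1 th1 hf (_ : inPar Z1 th i f).
  by apply: inj1 => //; apply: sub_inPar If => q /ZE[].
suff If1 : inPar Z th i f1.
  by rewrite Ef; apply: gidealD => //; apply: inPar_comb.
apply: H => //; rewrite (_ : psi * f1 = psi * f - comb th i (fun j => psi * g j)).
  by apply: gidealB => //; apply: inPar_comb.
by rewrite Ef combM; ring.
Qed.

Lemma union_regular d : regular Z1 th N d.+1 -> regular Z2 th N d.+1 -> regular ZI th N d ->
  regular Z th N d.+1.
Proof.
move=> r1 r2 rI i e id eN; apply: (union_injAt (th1 i)); first exact: r1.
move=> f hf Z1f If; apply: (union_inPar (e := e)) => //; last 1 first.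
- by apply: (r2 i e) => //; apply: sub_inPar If => q /ZE[].
- by move=> i' e' i'i; apply: rI; lia.
by lia.
Qed.

(** With one parameter more than the [d] assumed regular on A/ZI, the class of [h d] there is the
    obstruction. This is the connecting map; it lowers the degree by one. *)
Lemma union_inPar_last d e f h q : regular ZI th N d -> (e <= N)%N ->
  f \is e.+1.-homog -> Z1 f -> Z2 q -> f = q + comb th d.+1 h -> h d \is e.-homog ->
  inPar ZI th d (h d) -> inPar Z th d.+1 f.
Proof.
move=> rI eN hf Z1f Z2q Ef hh Ih.
have [z [p [hz ZIz Eh hp]]] := inPar_decomp gZI th1 hh Ih.
have [Z1a Z2a] := spP ZIz; set a := sp z in Z1a Z2a.
have ha : a \is e.-homog by apply: sp_homog.
have [||||w Zw] := union_inPar (e := e.+1) (f := f - th d * a) rI _ _ _ _.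
- by [].
- by apply: rpredB => //; rewrite -add1n; apply: dhomogM.
- by apply: gidealB => //; apply: gidealM.
- exists (fun j => h j + th d * p j); rewrite combD combM.
  rewrite (_ : _ - _ = q + th d * (z - a)).
    by apply: gidealD => //; apply: gidealM.
  by rewrite Ef combS Eh; ring.
exists (fun j => if j == d then a else w j).
rewrite combS eqxx (@eq_comb _ _ _ _ _ w) => [|j /ltn_eqF -> //].
by move: Zw; congr Z; ring.
Qed.

(** Let [f] be a kernel element of degree m + 1. Two expressions of [psi * f], compared on the
    second piece where [th d] can be cancelled, show that [psi] annihilates the obstruction [h d],
    of degree m. Its exponent s - 2(m + 1) is one below the exponent s - 1 - 2m in the hypothesis on
    [ZI], so one more factor [om] completes the argument. *)
Lemma union_lefschetz d om s : om \is 1.-homog -> (s <= N)%N ->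
  regular Z1 th N d.+1 -> regular Z2 th N d.+1 -> regular ZI th N d ->
  lefschetz Z1 th om d.+1 s -> lefschetz Z2 th om d.+1 s -> lefschetz ZI th om d s.-1 ->
  lefschetz Z th om d.+1 s.
Proof.
move=> om1 sN r1 r2 rI L1 L2 LI m ms.
set dl := (s - 2 * m)%N; set psi := om ^+ _.
have hpsi : psi \is dl.-homog by rewrite -[dl]mul1n; apply: dhomogMn.
apply: (union_injAt hpsi); first exact: L1.
move=> f hf Z1f If.
have I2f : inPar Z2 th d.+1 f.
  by apply: (L2 m ms f hf); apply: sub_inPar If => q /ZE[].
have [q2 [h [hq2 Z2q2 Ef hh]]] := inPar_decomp gZ2 th1 hf I2f.
case: m => [|m] in ms dl psi hpsi hf hq2 hh If *.
  apply: inPar_ideal => //; apply/ZE; split => //.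
  exact: inPar_homog0 gZ2 th1 hf I2f.
have [q [g [hq Zq Eg hg]]] := inPar_decomp gZ th1 (dhomogM hpsi hf) If.
have [Z1q Z2q] := (ZE q).1 Zq.
have [||g' [hg' Z1g' Eg']] := regular_comb_lift gZ1 th1 r1 _ hg _; first by rewrite /dl; lia.
  rewrite (_ : comb _ _ _ = psi * f - q); last by rewrite Eg; ring.
  by apply: gidealB => //; apply: gidealM.
apply: (union_inPar_last rI (e := m) _ hf Z1f Z2q2 Ef (hh d)); first by lia.
have gI := inPar_gideal d gZI th1.
apply: (LI m); [by lia|exact: hh|].
have -> : (s.-1 - 2 * m = dl.+1)%N by rewrite /dl; lia.
rewrite exprS -mulrA; apply: gidealM => //.
apply: (inPar_sub (g := g' d)) => //; last by apply: inPar_ideal => //; apply: Z1I.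
apply: (sub_inPar Z2I).
apply: (r2 d (dl + m)%N) => //; first by rewrite /dl; lia.
  apply: rpredB; first exact: dhomogM.
  by have := hg' d; rewrite addnS.
exists (fun j => - (psi * h j - g' j)).
rewrite (_ : _ - _ = q - psi * q2); first by apply: gidealB => //; apply: gidealM.
have : comb th d.+1 (fun j => psi * h j - g' j) = q - psi * q2.
  rewrite combB combM Eg'.
  have -> : comb th d.+1 g = psi * f - q by rewrite Eg; ring.
  by rewrite Ef; ring.
rewrite combS => <-; rewrite addrC; congr (_ + _).
by rewrite /comb -sumrN; apply: eq_bigr => j _; rewrite mulrN opprK.
Qed.

Lemma union_vanish d D : (D <= N)%N -> regular ZI th N d ->
  vanish Z1 th d.+1 D.+1 -> vanish Z2 th d.+1 D.+1 -> vanish ZI th d D ->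
  vanish Z th d.+1 D.+1.
Proof.
move=> DN rI V1 V2 VI f hf; have gI := inPar_gideal d.+1 gZ th1.
have [f1 [g [hf1 Zf1 Ef _]]] := inPar_decomp gZ1 th1 hf (V1 _ hf).
rewrite Ef; apply: gidealD => //; last exact: inPar_comb.
have [q2 [h [hq2 Z2q2 Ef1 hh]]] := inPar_decomp gZ2 th1 hf1 (V2 _ hf1).
exact: (union_inPar_last rI (e := D) _ hf1 Zf1 Z2q2 Ef1 (hh d) (VI _ (hh d))).
Qed.

End Union.
End StanleyReisner.

(** * Semicontinuity of ranks *)

Section RankLemmas.
Variable k : fieldType.

(* Equality holds iff [P] induces an injection from the row space of [C] modulo
   [R0] to the full space modulo [R]. *)
Lemma rank_quotient (p q c r0 r1 : nat) (P : 'M[k]_(p, q)) (R : 'M[k]_(r1, q))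
    (C : 'M[k]_(p, c)) (R0 : 'M[k]_(r0, c)) :
  (R0 <= C)%MS -> (forall u : 'rV_p, (u *m C <= R0)%MS -> (u *m P <= R)%MS) ->
  (\rank (col_mx R P) + \rank R0 <= \rank R + \rank C)%N /\
  (\rank (col_mx R P) + \rank R0 = \rank R + \rank C <->
   forall u : 'rV_p, (u *m P <= R)%MS -> (u *m C <= R0)%MS)%N.
Proof.
move=> R0C sub.
have rk p' q' r' (P' : 'M[k]_(p', q')) (R' : 'M[k]_(r', q')) :
    (\rank (col_mx R' P') = \rank R' + \rank (P' *m cokermx R'))%N.
  rewrite -(mxrank_mul_ker (col_mx R' P') (cokermx R')) addnC; congr (_ + _)%N.
    have ER : (kermx (cokermx R') :=: R')%MS.
      apply/eqmxP/andP; split; apply/rV_subP => u.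
        by move/sub_kermxP/eqP; rewrite submxE.
      by rewrite submxE => /eqP H; apply/sub_kermxP.
    rewrite (cap_eqmx (eqmx_refl _) ER).
    suff /eqmxP-> : (col_mx R' P' :&: R' == R')%MS by [].
    by rewrite capmxSr sub_capmx submx_refl andbT -addsmxE addsmxSl.
  by rewrite mul_col_mx mulmx_coker -addsmxE adds0mx.
pose K1 := kermx (P *m cokermx R); pose K0 := kermx (C *m cokermx R0).
have K1P (u : 'rV_p) : (u <= K1)%MS = (u *m P <= R)%MS.
  by rewrite sub_kermx mulmxA submxE.
have K0P (u : 'rV_p) : (u <= K0)%MS = (u *m C <= R0)%MS.
  by rewrite sub_kermx mulmxA submxE.
have K01 : (K0 <= K1)%MS by apply/rV_subP => u; rewrite K0P K1P => /sub.
have rC : \rank C = (\rank R0 + \rank (C *m cokermx R0))%N.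
  by rewrite -rk -addsmxE; have /addsmx_idPr-> := R0C.
have rK1 : (\rank K1 + \rank (P *m cokermx R) = p)%N.
  by rewrite mxrank_ker subnK // rank_leq_row.
have rK0 : (\rank K0 + \rank (C *m cokermx R0) = p)%N.
  by rewrite mxrank_ker subnK // rank_leq_row.
have leK := mxrankS K01.
have E := rk _ _ _ P R.
split; first by lia.
split=> [Erk u|H].
  rewrite -K1P -K0P => uK1; apply: submx_trans uK1 _.
  have := mxrank_leqif_sup K01; case=> _ <-; apply/eqP; lia.
have : (K1 <= K0)%MS by apply/rV_subP => u; rewrite K0P K1P => /H.
by move/mxrankS; lia.
Qed.

(** All but finitely many [t], with a polynomial as witness: conjunctions become products, and the
    number of exceptions is bounded by the degree. *)
Definition cofin (P : k -> Prop) := exists2 p : {poly k}, p != 0 & forall t, p.[t] != 0 -> P t.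

Lemma cofin_and P Q : cofin P -> cofin Q -> cofin (fun t => P t /\ Q t).
Proof.
move=> [p p0 hp] [q q0 hq]; exists (p * q); first by rewrite mulf_neq0.
by move=> t; rewrite hornerM mulf_eq0 negb_or => /andP[/hp ? /hq ?].
Qed.

Lemma cofin_imply (P Q : k -> Prop) : (forall t, P t -> Q t) -> cofin P -> cofin Q.
Proof. by move=> PQ [p p0 hp]; exists p => // t /hp /PQ. Qed.

Lemma cofin_all (P : nat -> k -> Prop) N :
  (forall i, (i < N)%N -> cofin (P i)) -> cofin (fun t => forall i, (i < N)%N -> P i t).
Proof.
elim: N => [|N IH] H; first by exists 1; rewrite ?oner_eq0.
have := cofin_and (IH (fun i iN => H i (ltnW iN))) (H N (leqnn _)).
apply: cofin_imply => t [h1 h2] i; rewrite ltnS leq_eqVlt => /orP[/eqP->|] //; exact: h1.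
Qed.

Lemma cofin_ex P : ~ (exists s : seq k, forall x, x \in s) -> cofin P -> exists t, P t.
Proof.
move=> kinf [p p0 hp].
have [s ss us] : exists2 s : seq k, size s = size p & uniq s.
  elim: (size p) => [|m [s <- us]]; first by exists [::].
  have [x /negP xs] : exists x, ~ x \in s.
    by apply: not_all_ex_not => all_s; apply: kinf; exists s.
  by exists (x :: s); rewrite //= xs us.
have [/allP|/allPn[t _ ht]] := boolP (all (root p) s); last by exists t; apply: hp.
move=> /allP /(max_poly_roots p0) /(_ us); by rewrite ss ltnn.
Qed.

(** Constant matrices [L] and [Q] reduce the matrix at [t0] to an identity of size its rank. The
    same product for variable [t] has a determinant that is polynomial in [t] and equals 1 at
    [t0]. *)
Lemma rank_semicontinuous m n (M : 'M[{poly k}]_(m, n)) t0 :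
  cofin (fun t => (\rank (map_mx (horner_eval t0) M) <= \rank (map_mx (horner_eval t) M))%N).
Proof.
set M0 := map_mx _ M; set r := \rank M0.
pose L := pid_mx r *m invmx (col_ebase M0) : 'M_(r, m).
pose Q := invmx (row_ebase M0) *m pid_mx r : 'M_(n, r).
have E : L *m M0 *m Q = 1%:M.
  rewrite -{1}(mulmx_ebase M0) /L /Q !mulmxA mulmxKV ?col_ebase_unit //.
  rewrite -!mulmxA (mulKVmx (row_ebase_unit _)) !mulmxA.
  by rewrite pid_mx_id ?rank_leq_row // pid_mx_id ?rank_leq_col // pid_mx_1.
pose D := \det (map_mx polyC L *m M *m map_mx polyC Q).
have evD t : D.[t] = \det (L *m map_mx (horner_eval t) M *m Q).
  have mapC a b (X : 'M[k]_(a, b)) : map_mx (horner_eval t) (map_mx polyC X) = X.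
    by apply/matrixP => i j; rewrite !mxE /horner_eval hornerC.
  by rewrite -[D.[t]]/(horner_eval t D) -det_map_mx !map_mxM /= !mapC.
exists D.
  by apply: contraTneq isT => D0; have := evD t0; rewrite D0 horner0 E det1 => /esym/eqP; rewrite oner_eq0.
move=> t; rewrite evD -unitfE -unitmxE => uD.
rewrite -[r](mxrank_unit uD); apply: leq_trans (mxrankM_maxl _ _) _.
exact: mxrankM_maxr.
Qed.

End RankLemmas.

(** * Multiplication by linear forms as matrices *)

Section Monomials.
Variables (n : nat).

Definition Mon (e : nat) : seq 'X_{1..n} :=
  [seq m <- [seq bmnm b | b <- enum {: 'X_{1..n < e.+1}}] | mdeg m == e].

Lemma mem_Mon e m : (m \in Mon e) = (mdeg m == e).
Proof.
rewrite mem_filter; case: eqP => //= E; apply/mapP.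
have lt : (mdeg m < e.+1)%N by rewrite E.
by exists (BMultinom lt) => //; rewrite mem_enum.
Qed.

Lemma Mon_uniq e : uniq (Mon e).
Proof. by rewrite filter_uniq // map_inj_uniq ?enum_uniq //; apply: val_inj. Qed.

Definition nmon e := size (Mon e).
Definition mnth e (i : 'I_(nmon e)) : 'X_{1..n} := tnth (in_tuple (Mon e)) i.

Lemma mdeg_mnth e (i : 'I_(nmon e)) : mdeg (mnth i) = e.
Proof. by apply/eqP; rewrite -mem_Mon; apply: mem_tnth. Qed.

Lemma mnth_inj e : injective (@mnth e).
Proof. move=> i j; rewrite /mnth !(tnth_nth 0%MM) /= => /eqP.
by rewrite nth_uniq ?Mon_uniq // => /eqP/val_inj. Qed.

Lemma mnthP e m : mdeg m = e -> exists i : 'I_(nmon e), m = mnth i.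
Proof.
move=> E; have /tnthP[i ->] : m \in in_tuple (Mon e) by rewrite mem_Mon E.
by exists i.
Qed.

(** The ring of entries is left open: over polynomials in [t] the matrix describes a whole family of
    forms, and evaluation at [t] gives the members. *)
Definition Lmx (R : nzRingType) (l : 'I_n -> R) e : 'M[R]_(nmon e, nmon e.+1) :=
  \matrix_(i, j) \sum_w l w *+ ((mnth i + U_(w))%MM == mnth j).

(** No coefficient has degree -1, so the matrix into degree 0 is zero; the truncated [e.-1] only
    gives it a type. *)
Definition Lpred (R : nzRingType) (l : 'I_n -> R) e : 'M[R]_(nmon e.-1, nmon e) :=
  match e with 0 => 0 | e'.+1 => Lmx l e' end.

Fixpoint Lpow (R : nzRingType) (l : 'I_n -> R) dl e : 'M[R]_(nmon e, nmon (dl + e)) :=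
  match dl with 0 => 1%:M | dl'.+1 => Lpow l dl' e *m Lmx l (dl' + e) end.

Fixpoint nrow i e := match i with 0 => 0%N | i'.+1 => (nrow i' e + nmon e.-1)%N end.

(** Rows spanning the degree [e] part generated by the first [i] parameters, in the quotient
    modelled by the row space of [C e]. The index [q i'.+1] leaves [q 0] for the Lefschetz form. *)
Fixpoint Rmx (R : nzRingType) (q : nat -> 'I_n -> R) (C : forall e, 'M[R]_(nmon e)) i e :
    'M[R]_(nrow i e, nmon e) :=
  match i with
  | 0 => 0
  | i'.+1 => col_mx (Rmx q C i' e) (Lpred (q i'.+1) e *m C e)
  end.

Section Map.
Variables (R S : comNzRingType) (ev : {rmorphism R -> S}).

Lemma map_Lmx (l : 'I_n -> R) e : map_mx ev (Lmx l e) = Lmx (ev \o l) e.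
Proof.
apply/matrixP => i j; rewrite !mxE rmorph_sum; apply: eq_bigr => w _.
by rewrite rmorphMn.
Qed.

Lemma map_Lpow (l : 'I_n -> R) dl e : map_mx ev (Lpow l dl e) = Lpow (ev \o l) dl e.
Proof.
by elim: dl => [|dl IH] /=; rewrite ?map_mx1 // map_mxM IH map_Lmx.
Qed.

Lemma map_Rmx q C i e :
  map_mx ev (Rmx q C i e) = Rmx (fun j => ev \o q j) (fun e => map_mx ev (C e)) i e.
Proof.
elim: i => [|i IH] /=; first by rewrite map_mx0.
rewrite map_col_mx IH map_mxM; congr (col_mx _ (_ *m _)).
by case: e {IH} => [|e] /=; rewrite ?map_mx0 ?map_Lmx.
Qed.

End Map.
End Monomials.

Section Rows.
Variables (k : fieldType) (n : nat).
Notation A := {mpoly k[n]}.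
Implicit Types (f g : A).

Definition lin (l : 'I_n -> k) : A := \sum_w l w *: 'X_w.

Lemma lin_homog l : lin l \is 1.-homog.
Proof. by apply: rpred_sum => w _; apply: rpredZ; apply: homogXU. Qed.

Definition mrow e f : 'rV[k]_(nmon n e) := \row_i f@_(mnth i).
Definition mpol e (u : 'rV[k]_(nmon n e)) : A := \sum_i u 0 i *: 'X_[mnth i].

Lemma mpol_homog e u : @mpol e u \is e.-homog.
Proof. by apply: rpred_sum => i _; apply: rpredZ; rewrite dhomogX /= mdeg_mnth. Qed.

Lemma mpolK e u : mrow e (mpol u) = u.
Proof.
apply/rowP => i; rewrite mxE raddf_sum (bigD1 i) //= mcoeffZ mcoeffX eqxx mulr1.
rewrite big1 ?addr0 // => j ji; rewrite mcoeffZ mcoeffX.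
by rewrite (inj_eq (@mnth_inj _ _)) (negPf ji) mulr0.
Qed.

Lemma mrow_eq0 e f : f \is e.-homog -> mrow e f = 0 -> f = 0.
Proof.
move=> hf E; apply/mpolyP => m; rewrite mcoeff0.
have [/eqP md|md] := boolP (mdeg m == e); last exact: dhomog_nemf_coeff hf md.
by have [i ->] := mnthP md; move/rowP/(_ i): E; rewrite !mxE.
Qed.

Lemma mrowK e f : f \is e.-homog -> mpol (mrow e f) = f.
Proof.
move=> hf; apply/eqP; rewrite -subr_eq0; apply/eqP; apply: (@mrow_eq0 e).
  by apply: rpredB => //; apply: mpol_homog.
by apply/rowP => i; have /rowP/(_ i) := mpolK (mrow e f); rewrite !mxE mcoeffB => ->; rewrite subrr.
Qed.

Lemma mrowD e f g : mrow e (f + g) = mrow e f + mrow e g.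
Proof. by apply/rowP => i; rewrite !mxE mcoeffD. Qed.

Lemma mrow_sum e (I : Type) (r : seq I) (P : pred I) (F : I -> A) :
  mrow e (\sum_(i <- r | P i) F i) = \sum_(i <- r | P i) mrow e (F i).
Proof.
elim/big_rec2: _ => [|i y x _ <-]; last exact: mrowD.
by apply/rowP => i; rewrite !mxE mcoeff0.
Qed.

Lemma mrow_lin l e f : f \is e.-homog -> mrow e.+1 (lin l * f) = mrow e f *m Lmx l e.
Proof.
move=> hf; rewrite -{1}(mrowK hf) /mpol mulr_sumr mrow_sum mulmx_sum_row.
apply: eq_bigr => i _; rewrite -scalerAr; apply/rowP => j.
rewrite !mxE mcoeffZ; congr (_ * _).
rewrite /lin mulr_suml raddf_sum; apply: eq_bigr => w _ /=.
by rewrite -scalerAl -mpolyXD mcoeffZ mcoeffX addmC mulr_natr.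
Qed.

Lemma mrow_lin_pred l e f : f \is e.-1.-homog ->
  mrow e (lin l * f) = mrow e.-1 f *m Lpred l e.
Proof.
case: e => [|e] hf /=; last exact: mrow_lin.
rewrite mulmx0; apply/rowP => i; rewrite !mxE.
apply: (dhomog_nemf_coeff (dhomogM (lin_homog l) hf)).
by rewrite /= mdeg_mnth.
Qed.

Lemma mrow_pow l dl e f : f \is e.-homog ->
  mrow (dl + e) (lin l ^+ dl * f) = mrow e f *m Lpow l dl e.
Proof.
move=> hf; elim: dl => [|dl IH] /=; first by rewrite expr0 mul1r mulmx1.
rewrite exprS -mulrA mrow_lin ?IH ?mulmxA //.
by apply: dhomogM => //; rewrite -[X in X.-homog]mul1n; apply: dhomogMn; apply: lin_homog.
Qed.

Section FixedFiber.
Variables (q : nat -> 'I_n -> k) (C : forall e, 'M[k]_(nmon n e)) (Z : A -> Prop).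
Hypotheses (gZ : gideal Z)
  (HZ : forall e f, f \is e.-homog -> (Z f <-> mrow e f *m C e = 0)).
Let th j := lin (q j.+1).
Let th1 j : th j \is 1.-homog. Proof. exact: lin_homog. Qed.
Let R := Rmx q C.

Lemma sub_Rmx m i e (u : 'M[k]_(m, nmon n e)) : (u <= R i e)%MS <->
  exists g : nat -> 'M[k]_(m, nmon n e.-1), u = \sum_(j < i) g j *m (Lpred (q j.+1) e *m C e).
Proof.
elim: i u => [|i IH] u /=.
  split=> [/submx0null->|[g ->]]; last by rewrite big_ord0 sub0mx.
  by exists (fun=> 0); rewrite big_ord0.
rewrite -addsmxE; split=> [/sub_addsmxP[[a b] /= ->]|[g ->]].
  have [g Eg] := (IH (a *m R i e)).1 (submxMl _ _).
  exists (fun j => if j == i then b else g j).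
  rewrite big_ord_recr /= eqxx Eg; congr (_ + _); apply: eq_bigr => j _.
  by rewrite ltn_eqF.
rewrite big_ord_recr /= addmx_sub_adds //; last by rewrite submxMl.
by apply/IH; exists g.
Qed.

Lemma Rmx_sub i e : (R i e <= C e)%MS.
Proof.
elim: i => [|i IH] /=; first by rewrite sub0mx.
by rewrite -addsmxE addsmx_sub IH submxMl.
Qed.

Lemma Rmx0 i : R i 0 = 0.
Proof. by elim: i => [|i] //=; rewrite /R /= => ->; rewrite mul0mx col_mx0. Qed.

Lemma inPar_row i e f : f \is e.-homog ->
  inPar Z th i f <-> (mrow e f *m C e <= R i e)%MS.
Proof.
move=> hf; split.
  move/(inPar_decomp gZ th1 hf) => [f1 [g [hf1 Zf1 -> hg]]].
  rewrite mrowD mulmxDl ((HZ hf1).1 Zf1) add0r; apply/sub_Rmx.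
  exists (fun j => mrow e.-1 (g j)); rewrite mrow_sum mulmx_suml.
  by apply: eq_bigr => j _; rewrite mrow_lin_pred // mulmxA.
case: e hf => [|e] hf.
  by rewrite Rmx0 => /submx0null E; apply: inPar_ideal => //; apply/(HZ hf).
move/sub_Rmx => [g Eg]; exists (fun j => mpol (g j)).
have hc : comb th i (fun j => mpol (g j)) \is e.+1.-homog.
  by apply: comb_homog => // j _; apply: mpol_homog.
apply/(HZ (rpredB hf hc)).
rewrite mrowD mulmxDl Eg; apply/eqP; rewrite -(can_eq (addrK (mrow e.+1 (comb th i (fun j => mpol (g j))) *m C e.+1))).
rewrite -addrA -mulmxDl -mrowD addNr add0r; apply/eqP.
have -> : mrow e.+1 0 = 0 by apply/rowP => j; rewrite !mxE mcoeff0.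
rewrite mul0mx addr0 mrow_sum mulmx_suml; apply: eq_bigr => j _.
by rewrite mrow_lin_pred ?mpol_homog // mpolK mulmxA.
Qed.

Lemma injAt_row i l dl e : injAt Z th i (lin l ^+ dl) e <->
  forall u : 'rV_(nmon n e), (u *m (Lpow l dl e *m C (dl + e)) <= R i (dl + e))%MS ->
    (u *m C e <= R i e)%MS.
Proof.
have hpow f : f \is e.-homog -> lin l ^+ dl * f \is (dl + e).-homog.
  move=> hf; apply: dhomogM => //.
  by rewrite -[X in X.-homog]mul1n; apply: dhomogMn; apply: lin_homog.
split=> H.
  move=> u Hu; have hu := mpol_homog u; rewrite -[u](mpolK) -(inPar_row _ hu).
  apply: H => //; apply/(inPar_row _ (hpow _ hu)).
  by rewrite mrow_pow // mpolK -mulmxA.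
move=> f hf /(inPar_row _ (hpow _ hf)); rewrite mrow_pow // -mulmxA => /H.
by move/(inPar_row _ hf).
Qed.

(** The inequality bounds ranks from above where semicontinuity bounds them from below; when the two
    bounds meet, the equality case returns injectivity. *)
Lemma injAt_rank i l dl e :
  (\rank (col_mx (R i (dl + e)) (Lpow l dl e *m C (dl + e))) + \rank (R i e)
     <= \rank (R i (dl + e)) + \rank (C e))%N /\
  (\rank (col_mx (R i (dl + e)) (Lpow l dl e *m C (dl + e))) + \rank (R i e)
     = \rank (R i (dl + e)) + \rank (C e) <-> injAt Z th i (lin l ^+ dl) e)%N.
Proof.
have [|H1 H2] := rank_quotient (P := Lpow l dl e *m C (dl + e)) (R := R i (dl + e))
  (Rmx_sub i e) _.
  move=> u; have hu := mpol_homog u; rewrite -[u]mpolK -(inPar_row _ hu) => Iu.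
  have hpow : lin l ^+ dl * mpol u \is (dl + e).-homog.
    apply: dhomogM => //.
    by rewrite -[X in X.-homog]mul1n; apply: dhomogMn; apply: lin_homog.
  rewrite mpolK; have : inPar Z th i (lin l ^+ dl * mpol u).
    exact: (gidealM (inPar_gideal i gZ th1)).
  by move/(inPar_row _ hpow); rewrite mrow_pow // mpolK -mulmxA.
by split=> //; rewrite H2 injAt_row.
Qed.

Lemma vanish_rank d D : vanish Z th d D <-> \rank (R d D) = \rank (C D).
Proof.
have [_ E] := mxrank_leqif_sup (Rmx_sub d D).
split=> [V|/eqP]; rewrite ?E.
  apply/eqP; rewrite E; apply/row_subP => i.
  have -> : row i (C D) = mrow D 'X_[mnth i] *m C D.
    rewrite rowE; congr (_ *m _); apply/rowP => j; rewrite !mxE mcoeffX eqxx /=.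
    by rewrite (inj_eq (@mnth_inj _ _)) eq_sym.
  by apply/inPar_row; [|apply: V]; rewrite dhomogX /= mdeg_mnth.
by move=> CR f hf; apply/(inPar_row _ hf); apply: submx_trans CR; apply: submxMl.
Qed.

End FixedFiber.
End Rows.

(** * Lefschetz systems in general position *)

Section LefschetzSystems.
Variables (k : fieldType) (n : nat).
Notation A := {mpoly k[n]}.
Notation param := (nat -> 'I_n -> k).

(* A point [x] of the parameter space lists the Lefschetz form [x 0] and the
   linear parameters [x 1], [x 2], ... *)
Definition tht (x : param) j : A := lin (x j.+1).

Lemma tht_homog x j : tht x j \is 1.-homog.
Proof. exact: lin_homog. Qed.

(* [d] is the number of parameters, [s] the Lefschetz range and [D] a degree in
   which the quotient vanishes.  Regularity is only required up to degree [N],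
   which makes it an open condition on [x]. *)
Definition lefpar (Z : A -> Prop) (x : param) N d s D :=
  [/\ regular Z (tht x) N d, lefschetz Z (tht x) (lin (x 0)) d s & vanish Z (tht x) d D].

Section Family.
Variables (q : nat -> 'I_n -> {poly k}) (C : forall e, 'M[{poly k}]_(nmon n e))
  (Zt : k -> A -> Prop) (t0 : k).
Let x t : param := fun j => horner_eval t \o q j.
Let Ct t e := map_mx (horner_eval t) (C e).
Hypotheses (gZ : forall t, gideal (Zt t))
  (HZ : forall t e f, f \is e.-homog -> (Zt t f <-> mrow e f *m Ct t e = 0))
  (rC : forall t e, (\rank (Ct t e) <= \rank (Ct t0 e))%N).

Let rR t i e := \rank (Rmx (x t) (Ct t) i e).
Let rS t i l dl e :=
  \rank (col_mx (Rmx (x t) (Ct t) i (dl + e)) (Lpow (x t l) dl e *m Ct t (dl + e))).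

Let rR_open i e : cofin (fun t => (rR t0 i e <= rR t i e)%N).
Proof.
have := rank_semicontinuous (Rmx q C i e) t0.
by apply: cofin_imply => t; rewrite !(map_Rmx (horner_eval _)).
Qed.

Let rS_open i l dl e : cofin (fun t => (rS t0 i l dl e <= rS t i l dl e)%N).
Proof.
have := rank_semicontinuous (col_mx (Rmx q C i (dl + e)) (Lpow (q l) dl e *m C (dl + e))) t0.
apply: cofin_imply => t; rewrite !map_col_mx !(map_Rmx (horner_eval _)) !map_mxM.
by rewrite !(map_Lpow (horner_eval _)).
Qed.

Let rSS t i e : rS t i i.+1 1 e = rR t i.+1 e.+1.
Proof. by rewrite /rS /rR /= mul1mx. Qed.

Let rR0 t i : rR t i 0 = 0%N.
Proof. by rewrite /rR Rmx0 mxrank0. Qed.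

(** For generic [t] the ranks are at least those at [t0]. By [injAt_rank] and [rC], which says that
    no fibre has a larger Hilbert function than the one at [t0], they are also at most those.
    Regularity up to degree [N] controls ranks up to degree [N.+1], hence the bounds on [s] and
    [D]. *)
Lemma family_open N d s D : (s <= N.+1)%N -> (D <= N.+1)%N ->
  lefpar (Zt t0) (x t0) N d s D -> cofin (fun t => lefpar (Zt t) (x t) N d s D).
Proof.
move=> sN DN [r0 L0 V0].
have c1 : cofin (fun t => forall i, (i < d.+1)%N -> forall e, (e < N.+2)%N ->
    (rR t0 i e <= rR t i e)%N).
  by apply: cofin_all => i _; apply: cofin_all => e _; apply: rR_open.
have c2 : cofin (fun t => forall m, (m < s)%N ->
    (rS t0 d 0 (s - 2 * m) m <= rS t d 0 (s - 2 * m) m)%N).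
  by apply: cofin_all => m _; apply: rS_open.
apply: cofin_imply (cofin_and c1 c2) => t [H1 H2] {c1 c2}.
(* Both claims advance together: the rank for [i.+1] parameters in degree [e.+1] is determined by
   ranks for [i] parameters exactly when parameter [i] is injective in degree [e]. *)
have step i : (i <= d)%N -> (forall e, (e <= N.+1)%N -> rR t i e = rR t0 i e) /\
    regular (Zt t) (tht (x t)) N i.
  elim: i => [|i IH] id.
    by split=> // e _; rewrite /rR /= !mxrank0.
  have [IR Ireg] := IH (ltnW id).
  have E e : (e <= N)%N -> rR t i.+1 e.+1 = rR t0 i.+1 e.+1 /\
      injAt (Zt t) (tht (x t)) i (tht (x t) i) e.
    move=> eN.
    have [_ Q0] := injAt_rank (x t0) (gZ t0) (@HZ t0) i (x t0 i.+1) 1 e.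
    have := (Q0.2 (r0 i e id eN)).
    have [Q1 Q2] := injAt_rank (x t) (gZ t) (@HZ t) i (x t i.+1) 1 e.
    rewrite -/(rS t i i.+1 1 e) -/(rS t0 i i.+1 1 e) in Q1 Q2 *.
    rewrite -/(rR t i e) -/(rR t0 i e) -/(rR t i (1 + e)) -/(rR t0 i (1 + e)) in Q1 Q2 *.
    rewrite !rSS in Q1 Q2 *.
    have := H1 i.+1 id e.+1 (eN : (e.+1 < N.+2)%N).
    have := IR e.+1 eN; have := IR e (leqW eN); have := rC t e.
    rewrite -/(Ct t e) -/(Ct t0 e) in Q1 Q2 *.
    rewrite !add1n in Q1 Q2 * => h1 h2 h3 h4 h5.
    by split; [lia|apply/Q2; lia].
  split=> [[|e] eN|i' e]; first by rewrite !rR0.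
    by have [] := E e eN.
  rewrite ltnS leq_eqVlt => /orP[/eqP-> eN|i'i eN]; last exact: Ireg.
  by have [] := E e eN.
have [IR Ireg] := step d (leqnn d); split=> //.
- move=> m ms.
  have [_ Q0] := injAt_rank (x t0) (gZ t0) (@HZ t0) d (x t0 0) (s - 2 * m) m.
  have := Q0.2 (L0 m ms).
  have [Q1 Q2] := injAt_rank (x t) (gZ t) (@HZ t) d (x t 0) (s - 2 * m) m.
  rewrite -/(rS t d 0 (s - 2 * m) m) -/(rS t0 d 0 (s - 2 * m) m) in Q1 Q2 *.
  rewrite -/(rR t d m) -/(rR t0 d m) in Q1 Q2 *.
  rewrite -/(rR t d _) -/(rR t0 d _) in Q1 Q2 *.
  have h1 := H2 m; have h2 := IR m; have h3 := IR (s - 2 * m + m)%N; have h4 := rC t m.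
  rewrite -/(Ct t m) -/(Ct t0 m) in Q1 Q2 *.
  move=> h5; apply/Q2; lia.
apply/(vanish_rank (x t) (gZ t) (@HZ t)).
have /(vanish_rank (x t0) (gZ t0) (@HZ t0)) := V0.
rewrite -/(rR t d D) -/(rR t0 d D) -/(Ct t D) -/(Ct t0 D) => E0.
have h1 := IR D DN; have h2 := rC t D.
have h3 : (rR t d D <= \rank (Ct t D))%N by apply: mxrankS; apply: Rmx_sub.
by lia.
Qed.

End Family.

End LefschetzSystems.

(** * Existence of Lefschetz systems and its behaviour under constructions *)

Section Good.
Variables (k : fieldType) (n : nat).
Notation A := {mpoly k[n]}.
Notation param := (nat -> 'I_n -> k).
Implicit Types (G : {set 'I_n} -> bool) (x y : param).

Lemma eq_inPar (Z : A -> Prop) th th' i f : (forall j, (j < i)%N -> th j = th' j) ->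
  inPar Z th i f -> inPar Z th' i f.
Proof.
move=> E [g Zg]; exists g; suff -> : comb th' i g = comb th i g by [].
by apply: eq_bigr => j _; rewrite E.
Qed.

Lemma eq_injAt (Z : A -> Prop) th th' i psi e : (forall j, (j < i)%N -> th j = th' j) ->
  injAt Z th i psi e -> injAt Z th' i psi e.
Proof.
move=> E inj f hf If; apply: (eq_inPar E); apply: inj => //.
by apply: eq_inPar If => j ji; rewrite E.
Qed.

Lemma eq_lefpar (Z : A -> Prop) x y N d s D : (forall j, (j <= d)%N -> x j = y j) ->
  lefpar Z x N d s D -> lefpar Z y N d s D.
Proof.
move=> E [r L V].
have Et j : (j < d)%N -> tht x j = tht y j by move=> jd; rewrite /tht E.
split.
- move=> i e id eN; rewrite -Et //; apply: eq_injAt (r i e id eN) => j ji.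
  by apply: Et; apply: ltn_trans id.
- by move=> m ms; rewrite -E //; apply: eq_injAt Et (L m ms).
by move=> f hf; apply: (eq_inPar Et); apply: V.
Qed.

Lemma lefpar_le (Z : A -> Prop) x N N' d s D : (N' <= N)%N ->
  lefpar Z x N d s D -> lefpar Z x N' d s D.
Proof. by move=> le [r L V]; split=> // i e id eN; apply: r => //; apply: leq_trans le. Qed.

Lemma sub_lefpar (Z Z' : A -> Prop) x N d s D : (forall f, Z f <-> Z' f) ->
  lefpar Z x N d s D -> lefpar Z' x N d s D.
Proof.
move=> E [r L V].
have I i f : inPar Z (tht x) i f <-> inPar Z' (tht x) i f.
  by split=> H; apply: sub_inPar H => g /E.
split.
- by move=> i e id eN f hf /I If; apply/I; exact: r i e id eN f hf If.
- by move=> m ms f hf /I If; apply/I; exact: L m ms f hf If.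
by move=> f hf; apply/I; apply: V.
Qed.

(** The system may depend on [N], because openness is available for boundedly many degrees at a
    time. *)
Definition good d s D G := forall N, exists x, lefpar (SR G) x N d s D.

Lemma eq_good d s D G G' : G =1 G' -> good d s D G -> good d s D G'.
Proof.
move=> E H N; have [x Hx] := H N; exists x; apply: sub_lefpar Hx => f.
by split; apply: sub_SR => M; rewrite E.
Qed.

Lemma homog_vars_ind (P : A -> Prop) e f : gideal P ->
  (forall q, q \is e.-homog -> P q) -> f \is e.+1.-homog -> P f.
Proof.
move=> gP H /dhomogP hf; rewrite [f]mpolyE big_seq; apply: gideal_sum => // m /hf md.
rewrite -mul_mpolyC; apply: gidealM => //.
have [w mw] : exists w, (0 < m w)%N.
  apply/existsP; apply: contraT; rewrite negb_exists => /forallP h.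
  have : mdeg m = 0%N by rewrite mdegE big1 // => i _; have := h i; rewrite lt0n negbK => /eqP.
  by rewrite md.
have -> : m = (U_(w) + (m - U_(w)))%MM.
  by apply/mnmP=> i; rewrite mnmDE mnmBE mnm1E; case: eqP => [<-|_] /=; lia.
rewrite mpolyXD; apply: gidealM => //; apply: H; rewrite dhomogX /= -eqSS -md.
rewrite -add1n -(mdeg1 w) -mdegD; apply/eqP; congr mdeg.
by apply/mnmP=> i; rewrite mnmDE mnmBE mnm1E; case: eqP => [<-|_] /=; lia.
Qed.

Lemma vanishS (Z : A -> Prop) th d D : gideal Z -> (forall j, th j \is 1.-homog) ->
  vanish Z th d D -> vanish Z th d D.+1.
Proof. by move=> gZ th1 V f; apply: homog_vars_ind => //; apply: inPar_gideal. Qed.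

Lemma goodS d s D G : down G -> good d s D G -> good d s D.+1 G.
Proof.
move=> dG H N; have [x [r L V]] := H N; exists x; split=> //.
by apply: vanishS => //; [apply: SR_gideal|apply: tht_homog].
Qed.

Definition line x y (t : k) : param := fun i w => x i w + t * (y i w - x i w).

Lemma line0 x y : line x y 0 = x.
Proof. by do 2! apply: functional_extensionality => ?; rewrite /line mul0r addr0. Qed.

Lemma line1 x y : line x y 1 = y.
Proof. by do 2! apply: functional_extensionality => ?; rewrite /line mul1r addrC subrK. Qed.

(* The substitute for Zariski openness: along every line the property holds at all
   but finitely many points as soon as it holds at one. *)
Definition lopen (P : param -> Prop) :=
  forall x y t0, P (line x y t0) -> cofin (fun t => P (line x y t)).

Lemma lopen_and P Q : lopen P -> lopen Q -> lopen (fun x => P x /\ Q x).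
Proof. by move=> oP oQ x y t0 [/oP cP /oQ cQ]; apply: cofin_and. Qed.

Lemma lefpar_lopen G N d s D : down G -> (s <= N.+1)%N -> (D <= N.+1)%N ->
  lopen (fun x => lefpar (SR G) x N d s D).
Proof.
move=> dG sN DN x y t0 H.
pose q i w : {poly k} := (x i w)%:P + 'X * (y i w - x i w)%:P.
(* The ideal is constant along the line and only the parameters move: [C e] is the projection onto
   the monomials supported on faces. *)
pose C e : 'M[{poly k}]_(nmon n e) :=
  \matrix_(i, j) ((i == j) && G (vsupp (mnth j)))%:R.
have Eq t : (fun j => horner_eval t \o q j) = line x y t.
  do 2! apply: functional_extensionality => ?.
  by rewrite /= /horner_eval /q !hornerE.
have := @family_open k n q C (fun=> SR G) t0 _ _ _ N d s D sN DN.
rewrite Eq => F; apply: cofin_imply (F _ _ _ H) => [t|t|t e f hf|t e].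
- by rewrite Eq.
- exact: SR_gideal.
- have Ec : mrow e f *m map_mx (horner_eval t) (C e) =
      \row_j (if G (vsupp (mnth j)) then f@_(mnth j) else 0).
    apply/rowP => j; rewrite !mxE (bigD1 j) //= big1 => [|i ij].
      by rewrite !mxE eqxx /horner_eval; case: (G _); rewrite !hornerE.
    by rewrite !mxE (negPf ij) /horner_eval horner0 mulr0.
  rewrite Ec; split=> [Zf|E0 m Gm].
    by apply/rowP => j; rewrite !mxE; case: ifP => // /Zf.
  have [/eqP md|md] := boolP (mdeg m == e); last exact: dhomog_nemf_coeff hf md.
  have [i mi] := mnthP md; move/rowP/(_ i): E0; rewrite !mxE -mi Gm.
  by [].
suff -> : map_mx (horner_eval t) (C e) = map_mx (horner_eval t0) (C e) by [].
apply/matrixP => i j; rewrite !mxE /horner_eval.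
by case: (_ && _); rewrite ?hornerC ?horner0.
Qed.

Hypothesis kinf : ~ exists s : seq k, forall c : k, c \in s.

Lemma lopen_meet P Q x y : lopen P -> lopen Q -> P x -> Q y -> exists z, P z /\ Q z.
Proof.
move=> oP oQ Px Qy.
have [||t [Pt Qt]] := cofin_ex kinf (cofin_and (oP x y 0 _) (oQ x y 1 _)).
- by rewrite line0.
- by rewrite line1.
by exists (line x y t).
Qed.

Lemma good_cone G G' z d s D : down G' -> (forall N, G' N -> z \notin N) ->
  (forall N, G N = G' (N :\ z)) -> good d s D G' -> good d.+1 s D G.
Proof.
move=> dG' hz hG H N; have [x Hx] := H N.
(* Entry [d.+1] is parameter number [d], since entry 0 is the Lefschetz form. *)
pose y : param := fun j => if j == d.+1 then (fun w => (w == z)%:R) else x j.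
exists y; have [|r L V] := @eq_lefpar _ x y _ _ _ _ _ Hx.
  by move=> j jd; rewrite /y ltn_eqF.
have yd : tht y d = 'X_z.
  rewrite /tht /y eqxx /lin (bigD1 z) //= eqxx scale1r big1 ?addr0 // => w /negPf->.
  by rewrite scale0r.
split.
- exact: (cone_regular dG' hz hG (tht_homog y) yd r).
- exact: (cone_lefschetz dG' hz hG yd L).
exact: (cone_vanish dG' hz hG yd V).
Qed.

Lemma good_union G G1 G2 GI d s D : down G1 -> down G2 ->
  (forall N, G N = G1 N || G2 N) -> (forall N, GI N = G1 N && G2 N) ->
  good d.+1 s D.+1 G1 -> good d.+1 s D.+1 G2 -> good d s.-1 D GI -> good d.+1 s D.+1 G.
Proof.
move=> d1 d2 hG hI g1 g2 gI N0; pose N := (N0 + s + D + 2)%N.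
have dI : down GI.
  by move=> M M' MM; rewrite !hI => /andP[/(d1 _ _ MM)-> /(d2 _ _ MM)->].
have dG : down G.
  by move=> M M' MM; rewrite !hG => /orP[/(d1 _ _ MM)->|/(d2 _ _ MM)->]; rewrite ?orbT.
have [x1 H1] := g1 N; have [x2 H2] := g2 N; have [x3 H3] := gI N.
have o1 : lopen (fun x => lefpar (SR G1) x N d.+1 s D.+1) by apply: lefpar_lopen => //; lia.
have o2 : lopen (fun x => lefpar (SR G2) x N d.+1 s D.+1) by apply: lefpar_lopen => //; lia.
have o3 : lopen (fun x => lefpar (SR GI) x N d s.-1 D) by apply: lefpar_lopen => //; lia.
have [y H12] := lopen_meet o1 o2 H1 H2.
have [{H1 H2 H3 H12}x [[[r1 L1 V1] [r2 L2 V2]] [r3 L3 V3]]] :=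
  lopen_meet (lopen_and o1 o2) o3 H12 H3.
exists x; apply: (@lefpar_le _ _ N); first by lia.
(* The monomials kept are non-faces of [G1]; those left over from an element of [SR GI] are faces of
   [G1], hence non-faces of [G2]. *)
pose sp := mfilter (fun m : 'X_{1..n} => ~~ G1 (vsupp m)) : A -> A.
have ZE (f : A) : SR G f <-> SR G1 f /\ SR G2 f.
  split=> [Zf|[Z1f Z2f] m]; first by split; apply: sub_SR Zf => M; rewrite hG => ->; rewrite ?orbT.
  by rewrite hG => /orP[/Z1f|/Z2f].
have spP f : SR GI f -> SR G1 (sp f) /\ SR G2 (f - sp f).
  move=> ZIf; split=> m Gm; first by rewrite mcoeff_mfilter Gm.
  rewrite mcoeffB mcoeff_mfilter; case: ifPn => [_|/negPn G1m]; first by rewrite subrr.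
  by rewrite ZIf ?subr0 // hI G1m.
have Z1I (f : A) : SR G1 f -> SR GI f by apply: sub_SR => M; rewrite hI => /andP[].
have Z2I (f : A) : SR G2 f -> SR GI f by apply: sub_SR => M; rewrite hI => /andP[].
have sph := @mfilter_homog k n (fun m : 'X_{1..n} => ~~ G1 (vsupp m)).
split.
- exact: (union_regular (SR_gideal k d1) (SR_gideal k d2) (SR_gideal k dI) (SR_gideal k dG)
    ZE spP Z1I Z2I (tht_homog x) r1 r2 r3).
- apply: (union_lefschetz (SR_gideal k d1) (SR_gideal k d2) (SR_gideal k dI) (SR_gideal k dG)
    ZE spP (fun e f => @sph f e) Z1I Z2I (tht_homog x) (lin_homog _) _ r1 r2 r3 L1 L2 L3).
  by lia.
apply: (union_vanish (SR_gideal k d1) (SR_gideal k d2) (SR_gideal k dI) (SR_gideal k dG)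
    ZE spP (fun e f => @sph f e) Z1I Z2I (tht_homog x) _ r3 V1 V2 V3).
by lia.
Qed.

(** The star enters shifted by one degree, so its range is two less and its vanishing degree one
    less: the exponent s + 2 - 2m in degree m is s - 2(m - 1) in degree m - 1. *)
Lemma good_vertex G (Gd Gs : {set 'I_n} -> bool) z d s D : down G ->
  (forall N, Gd N = (z \notin N) && G N) -> (forall N, Gs N = G (z |: N)) ->
  good d s.+2 D.+1 Gd -> good d s D Gs -> good d s.+2 D.+1 G.
Proof.
move=> dG hd hs gd gs N0; pose N := (N0 + s + D + 2)%N.
have [x1 H1] := gd N; have [x2 H2] := gs N.
have dd := down_del dG hd; have ds := down_star dG hs.
have o1 : lopen (fun x => lefpar (SR Gd) x N d s.+2 D.+1) by apply: lefpar_lopen => //; lia.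
have o2 : lopen (fun x => lefpar (SR Gs) x N d s D) by apply: lefpar_lopen => //; lia.
have [{H1 H2}x [[r1 L1 V1] [r2 L2 V2]]] := lopen_meet o1 o2 H1 H2.
exists x; apply: (@lefpar_le _ _ N); first by lia.
split.
- move=> i e id eN.
  apply: (vertex_injAt dG hd hs (tht_homog x) (tht_homog x i) (N := N)) => //.
  + by move=> i' e' i'i; apply: r1; apply: ltn_trans id.
  + exact: r1.
  by move=> e' E; apply: r2 => //; lia.
- move=> m ms; set dl := (s.+2 - 2 * m)%N.
  have hpsi : lin (x 0) ^+ dl \is dl.-homog.
    by rewrite -[X in X.-homog]mul1n; apply: dhomogMn; apply: lin_homog.
  apply: (vertex_injAt dG hd hs (tht_homog x) hpsi (N := N)) => //.
  + by rewrite /dl; lia.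
  + exact: L1.
  move=> e' E; have -> : dl = (s - 2 * e')%N by rewrite /dl; lia.
  by apply: L2; lia.
exact: (vertex_vanish dG hd hs (tht_homog x) V1 V2).
Qed.

End Good.

(** * Degeneration along an edge *)

Section Substitution.
Variables (k : fieldType) (n : nat).
Notation A := {mpoly k[n]}.
Implicit Types (f : A) (h : 'I_n -> A) (H : {set 'I_n}).

Definition subst h f : A := f \mPo [tuple h i | i < n].

Lemma substX h m : subst h 'X_[m] = \prod_i h i ^+ m i.
Proof. by rewrite /subst comp_mpolyX; apply: eq_bigr => i _; rewrite tnth_mktuple. Qed.

Lemma substXU h i : subst h 'X_i = h i.
Proof. by rewrite /subst comp_mpolyXU -tnth_nth tnth_mktuple. Qed.

Lemma substM h f g : subst h (f * g) = subst h f * subst h g.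
Proof. exact: rmorphM. Qed.

Lemma substD h f g : subst h (f + g) = subst h f + subst h g.
Proof. exact: raddfD. Qed.

Lemma substB h f g : subst h (f - g) = subst h f - subst h g.
Proof. exact: raddfB. Qed.

Lemma substZ h c f : subst h (c *: f) = c *: subst h f.
Proof. exact: linearZ. Qed.

Lemma subst0 h : subst h 0 = 0.
Proof. exact: raddf0. Qed.

Lemma subst_sum h (I : Type) (r : seq I) (P : pred I) F :
  subst h (\sum_(i <- r | P i) F i) = \sum_(i <- r | P i) subst h (F i).
Proof. exact: raddf_sum. Qed.

Lemma substE h f : subst h f = \sum_(m <- msupp f) f@_m *: \prod_i h i ^+ m i.
Proof.
rewrite {1}[f]mpolyE subst_sum; apply: eq_bigr => m _.
by rewrite substZ substX.
Qed.

Lemma subst_comp h h' f : subst h (subst h' f) = subst (fun i => subst h (h' i)) f.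
Proof.
rewrite !(substE _ f) subst_sum; apply: eq_bigr => m _; rewrite substZ; congr (_ *: _).
rewrite /subst rmorph_prod; apply: eq_bigr => i _; exact: rmorphXn.
Qed.

Lemma eq_subst h h' f : h =1 h' -> subst h f = subst h' f.
Proof.
by move=> E; rewrite !substE; apply: eq_bigr => m _; congr (_ *: _); apply: eq_bigr => i _; rewrite E.
Qed.

Lemma subst_id f : subst (fun i => 'X_i) f = f.
Proof. exact: comp_mpoly_id. Qed.

Lemma subst_homog h e f : (forall i, h i \is 1.-homog) -> f \is e.-homog -> subst h f \is e.-homog.
Proof.
move=> h1 /dhomogP hf; rewrite substE big_seq; apply: rpred_sum => m /hf <-; apply: rpredZ.
rewrite /= mdegE; elim/big_rec2: _ => [|i d q _ hq]; first exact: dhomog1.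
by apply: dhomogM => //; rewrite -[X in X.-homog]mul1n; apply: dhomogMn.
Qed.

Lemma subst_lin h (l : 'I_n -> k) : subst h (lin l) = \sum_w l w *: h w.
Proof. by rewrite subst_sum; apply: eq_bigr => w _; rewrite substZ substXU. Qed.

Lemma msym_subst (s : 'S_n) f : msym s f = subst (fun i => 'X_(s i)) f.
Proof.
rewrite {1}[f]mpolyE raddf_sum substE; apply: eq_bigr => m _ /=.
by rewrite msymZ; congr (_ *: _); rewrite /msym mmapX.
Qed.

(** Restriction to the simplex on [H]; it lets [phi] be compared with [SR G] one face at a time. *)
Definition kill H := subst (fun i => if i \in H then 'X_i else 0).

Lemma killE H f : kill H f = mfilter (fun m => vsupp m \subset H) f.
Proof.
rewrite /kill substE /mfilter [RHS]big_mkcond /=; apply: eq_bigr => m _.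
case: ifPn => [sH|/subsetPn[i im iH]].
  congr (_ *: _); rewrite [RHS]mpolyXE_id; apply: eq_bigr => i _.
  case: ifPn => // iH; suff -> : m i = 0%N by rewrite !expr0.
  by apply/eqP; rewrite -leqn0 leqNgt; apply: contra iH => im; apply: (subsetP sH); rewrite inE.
rewrite (bigD1 i) //= (negPf iH) expr0n; move: im; rewrite inE lt0n => /negPf->.
by rewrite mul0r scaler0.
Qed.

Lemma mcoeff_kill H f m : (kill H f)@_m = if vsupp m \subset H then f@_m else 0.
Proof. by rewrite killE mcoeff_mfilter. Qed.

End Substitution.

(** * The family that moves one end of an edge to the other *)

Section Degeneration.
Variables (k : fieldType) (n : nat) (a b : 'I_n) (G : {set 'I_n} -> bool).
Notation A := {mpoly k[n]}.
Hypotheses (ab : a != b) (dG : down G)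
  (link : forall N : {set 'I_n}, a \notin N -> b \notin N -> G (a |: N) -> G (b |: N) -> G (a |: (b |: N))).

Implicit Types (H : {set 'I_n}) (f : A) (t : k).

Let ba : b != a. Proof. by rewrite eq_sym. Qed.

(* The limit of [G] when [b] moves to [a]: the contraction of [ab] (with [a] as the
   contracted vertex) and the double cone over the link of [ab]. *)
Definition degen (N : {set 'I_n}) := if b \in N then G (a |: N) else G N || (a \in N) && G (b |: N :\ a).

Lemma down_degen : down degen.
Proof.
move=> M N MN; rewrite /degen; case: (boolP (b \in N)) => bN.
  move=> GN; case: ifP => _; first by apply: dG GN; rewrite setUS.
  by rewrite (dG _ GN) // (subset_trans MN) // subsetUr.
rewrite (negPf (contra (subsetP MN b) bN)) => /orP[GN|/andP[aN GN]]; first by rewrite (dG MN GN).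
case: (boolP (a \in M)) => aM; rewrite /=.
  suff -> : G (b |: M :\ a) by rewrite orbT.
  by apply: dG GN; rewrite setUS // setSD.
rewrite orbF; apply: dG GN; apply/subsetP => i iM; rewrite !inE.
by rewrite (subsetP MN) // andbT (_ : i != a) ?orbT //; apply: contraNneq aM => <-.
Qed.

(** A linear form [l] gets the coordinate [l a + t * l b] at [b]: the position of [b] runs to that
    of [a] as [t] tends to 0. For [t != 0] this is invertible, so the fibre is a copy of the face
    ring of [G]. *)
Definition phi (t : k) : A -> A := subst (fun i => if i == a then 'X_a + 'X_b
  else if i == b then t *: 'X_b else 'X_i).
Definition phiV (t : k) : A -> A := subst (fun i => if i == a then 'X_a - t^-1 *: 'X_b
  else if i == b then t^-1 *: 'X_b else 'X_i).

Lemma phiK t f : t != 0 -> phiV t (phi t f) = f.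
Proof.
move=> t0; rewrite /phi /phiV subst_comp -[RHS]subst_id; apply: eq_subst => i.
case: eqP => [->|ia]; first by rewrite substD !substXU eqxx (negPf ba) eqxx subrK.
case: eqP => [->|ib]; first by rewrite substZ substXU (negPf ba) eqxx scalerA mulfV // scale1r.
by rewrite substXU; case: eqP => //; case: eqP.
Qed.

Lemma phiVK t f : t != 0 -> phi t (phiV t f) = f.
Proof.
move=> t0; rewrite /phi /phiV subst_comp -[RHS]subst_id; apply: eq_subst => i.
case: eqP => [->|ia].
  by rewrite substB substZ !substXU eqxx (negPf ba) eqxx scalerA mulVf // scale1r addrK.
case: eqP => [->|ib]; first by rewrite substZ substXU (negPf ba) eqxx scalerA mulVf // scale1r.
by rewrite substXU; case: eqP => //; case: eqP.
Qed.

Lemma phi_homog t e f : f \is e.-homog -> phi t f \is e.-homog.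
Proof.
apply: subst_homog => i; case: eqP => _; first by apply: rpredD; apply: homogXU.
by case: eqP => _; [apply: rpredZ|]; apply: homogXU.
Qed.

Lemma phiV_homog t e f : f \is e.-homog -> phiV t f \is e.-homog.
Proof.
apply: subst_homog => i; case: eqP => _.
  by apply: rpredB; [|apply: rpredZ]; apply: homogXU.
by case: eqP => _; [apply: rpredZ|]; apply: homogXU.
Qed.

(** The effect of [phi t] on faces through [b] that avoid [a], after [b] is renamed [a] (see
    [kill_phi_b]). *)
Definition psi (t : k) : A -> A := subst (fun i => if i == b then t *: 'X_a else 'X_i).

Definition merge_vars (m : 'X_{1..n}) : 'X_{1..n} :=
  ([multinom (if i == b then 0%N else m i) | i < n] + U_(a) *+ m b)%MM.

Lemma psiX t m : psi t 'X_[m] = t ^+ m b *: 'X_[merge_vars m].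
Proof.
rewrite /psi substX /merge_vars mpolyXD -mpolyXn (mpolyXE_id k [multinom _ | i < n]).
rewrite (bigD1 b) //= eqxx exprZn -scalerAl mulrC; congr (_ *: (_ * _)).
rewrite [RHS](bigD1 b) //= mnmE eqxx expr0 mul1r; apply: eq_bigr => i /negPf ib.
by rewrite ib mnmE ib.
Qed.

(** Within [degen]: the faces of the contraction that arise only by putting [a] in the place of
    [b]. *)
Definition bonly m := (b \notin vsupp m) && ~~ G (vsupp m).

(* Coordinates of [f] in the fibre at [t], the quotient by the preimage of [SR G] under
   [phi t], with respect to the monomials supported on [degen]; they are polynomial
   in [t], and at [t = 0] they are the coefficients of [f]. *)
Definition dcoef t f m :=
  if degen (vsupp m) then (if bonly m then (psi t f)@_m else f@_m) else 0.

Lemma kill_phi_nb t H f : b \notin H -> kill H (phi t f) = kill H f.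
Proof.
move=> bH; rewrite /kill /phi subst_comp; apply: eq_subst => i.
case: eqP => [->|ia]; first by rewrite substD !substXU (negPf bH) addr0.
case: eqP => [->|ib]; first by rewrite substZ substXU (negPf bH) scaler0.
by rewrite substXU.
Qed.

Lemma kill_phi_ab t H f : a \in H -> b \in H -> kill H (phi t f) = phi t (kill H f).
Proof.
move=> aH bH; rewrite /kill /phi !subst_comp; apply: eq_subst => i.
case: eqP => [->|ia]; first by rewrite substD !substXU bH aH substXU eqxx.
case: eqP => [->|ib]; first by rewrite substZ substXU bH substXU (negPf ba) eqxx.
rewrite substXU; case: ifP => _; last by rewrite subst0.
by rewrite substXU; case: eqP => //; case: eqP.
Qed.

Lemma kill_phi_b t H f : a \notin H -> b \in H ->
  kill H (phi t f) = msym (tperm a b) (kill (a |: H :\ b) (psi t f)).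
Proof.
move=> aH bH; rewrite msym_subst /kill /phi /psi !subst_comp; apply: eq_subst => i.
have [->|ia] := eqVneq i a.
  rewrite substD !substXU bH (negPf aH) add0r (negPf ab) !substXU !inE eqxx /=.
  by rewrite substXU tpermL.
have [_|ib] := eqVneq i b.
  by rewrite !substZ !substXU bH !inE eqxx /= substXU tpermL.
rewrite !substXU !inE (negPf ia) ib /=; case: ifP => _; last by rewrite subst0.
by rewrite substXU tpermD // eq_sym.
Qed.

Lemma mcoeff_kill_phi_b t H f m : a \notin H -> b \in H -> vsupp m = a |: H :\ b ->
  (psi t f)@_m = (kill H (phi t f))@_[multinom m (tperm a b i) | i < n].
Proof.
move=> aH bH Em; rewrite kill_phi_b // mcoeff_sym (mcoeff_kill _ (psi t f)).
have -> : [multinom [multinom m (tperm a b i0) | i0 < n] (tperm a b i) | i < n] = m.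
  by apply/mnmP => i; rewrite !mnmE tpermK.
by rewrite Em subxx.
Qed.

Lemma SR_kill H f : SR G f -> G H -> kill H f = 0.
Proof.
move=> Zf GH; apply/mpolyP => m; rewrite mcoeff0 mcoeff_kill; case: ifP => // sH.
by apply: Zf; apply: dG GH.
Qed.

(** There are three kinds of faces: without [b], where [phi t] changes nothing; those that remain
    faces when [a] is added, where it restricts to an invertible substitution; and the remaining
    faces through [b], where it is [psi t] up to renaming. *)
Lemma dcoefP t f : t != 0 -> (forall m, dcoef t f m = 0) <-> SR G (phi t f).
Proof.
move=> t0; split=> [Df M GM|Zf m].
  have kab H : a \in H -> b \in H -> G H -> vsupp M \subset H -> (phi t f)@_M = 0.
    move=> aH bH GH sM; have -> : (phi t f)@_M = (kill H (phi t f))@_M by rewrite mcoeff_kill sM.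
    rewrite kill_phi_ab //; suff -> : kill H f = 0 by rewrite /phi subst0 mcoeff0.
    apply/mpolyP => m; rewrite mcoeff0 mcoeff_kill; case: ifP => // mH.
    have := Df m; rewrite /dcoef /bonly /degen (dG mH GH) andbF /= ifT //.
    by case: ifP => // _; apply: dG GH; rewrite subUset sub1set aH.
  have [bM|bM] := boolP (b \in vsupp M); last first.
    have -> : (phi t f)@_M = (kill (vsupp M) (phi t f))@_M by rewrite mcoeff_kill subxx.
    rewrite kill_phi_nb // mcoeff_kill subxx.
    by have := Df M; rewrite /dcoef /bonly /degen (negPf bM) GM.
  have [GaM|GaM] := boolP (G (a |: vsupp M)).
    by apply: (kab (a |: vsupp M)); rewrite ?setU11 ?subsetUr ?setU1r.
  have aM : a \notin vsupp M.
    by apply: contra GaM => aM; rewrite (setUidPr _) // sub1set.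
  pose m : 'X_{1..n} := [multinom M (tperm a b i) | i < n].
  have Em : vsupp m = a |: vsupp M :\ b.
    apply/setP => i; rewrite !inE mnmE; case: tpermP => [->|->|/eqP ia /eqP ib].
    - by rewrite eqxx; rewrite inE in bM.
    - by rewrite eqxx (negPf ba) /=; apply/negbTE; rewrite inE in aM.
    by rewrite (negPf ia) (negPf ib).
  have EMm : [multinom m (tperm a b i) | i < n] = M.
    by apply/mnmP => i; rewrite !mnmE tpermK.
  have -> : (phi t f)@_M = (kill (vsupp M) (phi t f))@_M by rewrite mcoeff_kill subxx.
  rewrite -[X in _@_X]EMm -mcoeff_kill_phi_b //.
  have := Df m; rewrite /dcoef /bonly Em.
  have bm : b \notin a |: vsupp M :\ b by rewrite !inE eqxx (negPf ba).
  have am : a \notin vsupp M :\ b by rewrite in_setD1 negb_and aM orbT.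
  rewrite bm /degen (negPf bm) setU11 /=.
  have -> : b |: (a |: vsupp M :\ b) :\ a = vsupp M.
    by rewrite setU1K // setD1K.
  (* Here the link condition enters: if the renamed support were a face too, then [a] could be added
     to the support of [M], which was excluded. *)
  rewrite GM orbT ifT //; apply: contra GaM => GaM.
  have := @link (vsupp M :\ b) am; rewrite setD11 => /(_ isT GaM).
  by rewrite setD1K // => /(_ GM).
rewrite /dcoef; case: ifP => // Dm; move: Dm; rewrite /degen /bonly.
have [bm|bm] := boolP (b \in vsupp m); rewrite /= => Dm.
  have := SR_kill Zf Dm; rewrite kill_phi_ab ?setU11 ?setU1r //.
  move/(congr1 (phiV t)); rewrite phiK // /phiV subst0 => E0.
  by have := mcoeff_kill (a |: vsupp m) f m; rewrite E0 mcoeff0 subsetUr.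
have [Gm|Gm] := boolP (G (vsupp m)); rewrite /=.
  have := SR_kill Zf Gm; rewrite kill_phi_nb // => E0.
  by have := mcoeff_kill (vsupp m) f m; rewrite E0 mcoeff0 subxx.
move: Dm; rewrite (negPf Gm) /= => /andP[am GH].
rewrite (@mcoeff_kill_phi_b t (b |: vsupp m :\ a)) ?(SR_kill Zf GH) ?mcoeff0 //.
- by rewrite !inE eqxx (negPf ab).
- by rewrite setU11.
by rewrite setU1K ?setD1K // in_setD1 negb_and bm orbT.
Qed.

Lemma psi0 f m : b \notin vsupp m -> (psi 0 f)@_m = f@_m.
Proof.
move=> bm; suff : kill (~: [set b]) (psi 0 f) = kill (~: [set b]) f.
  have sm : vsupp m \subset ~: [set b].
    by apply/subsetP => i im; rewrite !inE; apply: contraNneq bm => <-.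
  by move/(congr1 (mcoeff m)); rewrite (mcoeff_kill _ (psi 0 f)) (mcoeff_kill _ f) sm.
rewrite /kill /psi subst_comp; apply: eq_subst => i.
case: eqP => [->|ib]; first by rewrite scale0r subst0 !inE eqxx.
by rewrite substXU.
Qed.

Lemma dcoef0 f m : dcoef 0 f m = if degen (vsupp m) then f@_m else 0.
Proof. by rewrite /dcoef; case: ifP => // _; case: ifP => // /andP[bm _]; apply: psi0. Qed.

Let Zt t f := forall m, dcoef t f m = 0.

(** For [t != 0] this is the preimage of [SR G] under [phi t]; at [t = 0], where [phi] is not
    invertible, it is [SR degen]. *)
Let gZt t : gideal (Zt t).
Proof.
have [->|t0] := eqVneq t 0.
  have E f : Zt 0 f <-> SR degen f.
    by split=> H m; [move=> Dm; have := H m|]; rewrite dcoef0 ?Dm //; case: ifP => // /H.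
  have gD := SR_gideal k down_degen; split.
  - by apply/E; apply: gideal0.
  - by move=> f g /E Zf /E Zg; apply/E; apply: (gidealD gD).
  - by move=> f g /E Zf; apply/E; apply: (gidealM gD).
  by move=> d f /E Zf; apply/E; apply: (gideal_pi gD).
have gG := SR_gideal k dG; split.
- by apply/dcoefP => //; rewrite /phi subst0; apply: gideal0.
- by move=> f g /(dcoefP _ t0) Zf /(dcoefP _ t0) Zg; apply/dcoefP => //; rewrite /phi substD; apply: (gidealD gG).
- by move=> f g /(dcoefP _ t0) Zf; apply/dcoefP => //; rewrite /phi substM; apply: (gidealM gG).
move=> d f /(dcoefP _ t0) Zf; apply/dcoefP => //.
suff -> : phi t (pihomog mdeg d f) = pihomog mdeg d (phi t f) by apply: (gideal_pi gG).
rewrite [pihomog mdeg d f]pihomogE [in RHS](mpolyE f) /phi !subst_sum raddf_sum.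
rewrite [LHS]big_mkcond; apply: eq_bigr => m _; rewrite substZ [RHS]linearZ /=.
have hm : phi t 'X_[m] \is (mdeg m).-homog by apply: phi_homog; rewrite dhomogX.
case: ifPn => [/eqP <-|md]; first by rewrite (pihomog_dE hm).
by rewrite (pihomog_ne0 md hm) scaler0.
Qed.

Definition dmx e : 'M[{poly k}]_(nmon n e) := \matrix_(i, j)
  if degen (vsupp (mnth j)) then
    (if bonly (mnth j) then 'X^(mnth i b) *+ (merge_vars (mnth i) == mnth j)
     else (mnth i == mnth j)%:R)
  else 0.

Lemma dmxE t e i j : map_mx (horner_eval t) (dmx e) i j = dcoef t 'X_[mnth i] (mnth j).
Proof.
rewrite !mxE /horner_eval /dcoef; case: ifP => _; last by rewrite horner0.
case: ifP => _; last by rewrite mcoeffX; case: (_ == _); rewrite ?hornerC ?horner0.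
rewrite psiX mcoeffZ mcoeffX hornerMn hornerXn.
by case: (_ == _); rewrite ?mulr1 ?mulr0.
Qed.

Lemma dcoef_sum t (I : Type) (r : seq I) (c : I -> k) (F : I -> A) m :
  dcoef t (\sum_(i <- r) c i *: F i) m = \sum_(i <- r) c i * dcoef t (F i) m.
Proof.
rewrite /dcoef; case: ifP => _; last by rewrite big1 // => i _; rewrite mulr0.
case: ifP => _.
  by rewrite /psi subst_sum raddf_sum; apply: eq_bigr => i _ /=; rewrite substZ mcoeffZ.
by rewrite raddf_sum; apply: eq_bigr => i _ /=; rewrite mcoeffZ.
Qed.

Lemma mrow_dmx t e f j : f \is e.-homog ->
  (mrow e f *m map_mx (horner_eval t) (dmx e)) 0 j = dcoef t f (mnth j).
Proof.
move=> hf; rewrite -{2}(mrowK hf) /mpol dcoef_sum mxE.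
by apply: eq_bigr => i _; rewrite dmxE.
Qed.

Lemma lefpar_degen x N d s D : (s <= N.+1)%N -> (D <= N.+1)%N ->
  lefpar (SR degen) x N d s D -> cofin (fun t => lefpar (Zt t) x N d s D).
Proof.
move=> sN DN H; pose q i w : {poly k} := (x i w)%:P.
have Eq t : (fun j => horner_eval t \o q j) = x.
  by do 2! apply: functional_extensionality => ?; rewrite /= /horner_eval hornerC.
have := @family_open k n q dmx Zt 0 gZt _ _ N d s D sN DN.
rewrite Eq => F; apply: cofin_imply (F _ _ _) => [t|t e f hf|t e|]; first by rewrite Eq.
- split=> [Zf|E0 m]; first by apply/rowP => j; rewrite mrow_dmx // mxE Zf.
  have [/eqP md|md] := boolP (mdeg m == e).
    by have [j ->] := mnthP md; rewrite -mrow_dmx // E0 mxE.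
  rewrite /dcoef; case: ifP => // _; case: ifP => _; last exact: dhomog_nemf_coeff hf md.
  apply: (dhomog_nemf_coeff _ md); apply: subst_homog hf => i.
  by case: eqP => _; [apply: rpredZ|]; apply: homogXU.
(* At 0 the matrix is the projection onto the monomials of [degen], and it fixes the columns of the
   matrix at [t]; so no fibre has a larger Hilbert function than the special one. *)
- suff -> : map_mx (horner_eval t) (dmx e) =
      map_mx (horner_eval t) (dmx e) *m map_mx (horner_eval 0) (dmx e).
    exact: mxrankM_maxr.
  apply/matrixP => i j; rewrite [RHS]mxE (bigD1 j) //= big1 => [|l lj].
    have Xj : ('X_[mnth j] : A)@_(mnth j) = 1 by rewrite mcoeffX eqxx.
    rewrite addr0 !dmxE dcoef0 Xj /dcoef.
    by case: ifP => _; rewrite ?mulr1 ?mulr0.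
  by rewrite !dmxE dcoef0 mcoeffX (inj_eq (@mnth_inj _ _)) (negPf lj) if_same mulr0.
apply: sub_lefpar H => f; split=> H m; rewrite ?dcoef0.
  by case: ifP => // /H.
by move=> Dm; have := H m; rewrite dcoef0 Dm.
Qed.

Lemma lefpar_phi t x N d s D : t != 0 -> lefpar (Zt t) x N d s D ->
  lefpar (SR G) (fun i w => if w == b then x i a + t * x i b else x i w) N d s D.
Proof.
move=> t0; set y := (fun i => _) => [] [r L V].
have phil j : phi t (lin (x j)) = lin (y j).
  rewrite /phi subst_lin /lin (bigD1 a) //= eqxx (bigD1 b) //= eqxx (negPf ba).
  rewrite [RHS](bigD1 a) //= [X in _ = _ + X](bigD1 b) //= /y eqxx (negPf ab).
  have -> : \sum_(i < n | (i != a) && (i != b))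
      x j i *: (if i == a then 'X_a + 'X_b else if i == b then t *: 'X_b else 'X_i) =
    \sum_(i < n | (i != a) && (i != b)) (if i == b then x j a + t * x j b else x j i) *: 'X_i :> A.
    by apply: eq_bigr => i /andP[/negPf-> /negPf->].
  by rewrite !addrA; congr (_ + _); rewrite scalerDr scalerDl scalerA addrA [t * _]mulrC.
have I i f : inPar (Zt t) (tht x) i f <-> inPar (SR G) (tht y) i (phi t f).
  have pc g : phi t (comb (tht x) i g) = comb (tht y) i (fun j => phi t (g j)).
    by rewrite /comb /phi subst_sum; apply: eq_bigr => j _; rewrite substM -/(phi t _) phil.
  split=> [[g /(dcoefP _ t0)]|[g Zg]].
    rewrite /phi substB -!/(phi t _) pc => Zg; by exists (fun j => phi t (g j)).
  exists (fun j => phiV t (g j)); apply/dcoefP => //.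
  rewrite /phi substB -!/(phi t _) pc (_ : comb _ _ _ = comb (tht y) i g) //.
  by apply: eq_comb => j _; rewrite phiVK.
have inj i psi e : injAt (Zt t) (tht x) i psi e -> injAt (SR G) (tht y) i (phi t psi) e.
  move=> J f hf; rewrite -[f](phiVK _ t0) /phi -substM -!/(phi t _) => /I If.
  by apply/I; apply: J => //; apply: phiV_homog.
split.
- by move=> i e id eN; rewrite {2}/tht -phil; apply: inj; apply: r.
- move=> m ms; rewrite -phil.
  have -> : phi t (lin (x 0)) ^+ (s - 2 * m) = phi t (lin (x 0) ^+ (s - 2 * m)).
    by rewrite /phi /subst rmorphXn.
  by apply: inj; apply: L.
by move=> f hf; rewrite -[f](phiVK _ t0); apply/I; apply: V; apply: phiV_homog.
Qed.

Hypothesis kinf : ~ exists s : seq k, forall c : k, c \in s.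

Lemma good_degen d s D : good k d s D degen -> good k d s D G.
Proof.
move=> g N0; pose N := (N0 + s + D)%N; have [x H] := g N.
have cX : cofin (fun t : k => t != 0).
  by exists 'X; rewrite ?polyX_eq0 // => t; rewrite hornerX.
have [||t [t0 Ht]] := cofin_ex kinf (cofin_and cX (lefpar_degen _ _ H)); try by lia.
exists (fun i w => if w == b then x i a + t * x i b else x i w).
by apply: (@lefpar_le _ _ _ _ N); [lia|apply: lefpar_phi].
Qed.

(** In [degen] the deletion of [b] is the contraction [C], and the star of [b] is the cone with
    apexes [a] and [b] over the link [L]; the two apexes supply the two extra parameters. *)
Lemma good_contraction (C L : {set 'I_n} -> bool) d s D :
  (forall N : {set 'I_n}, C N = (b \notin N) && (G N || (a \in N) && G (b |: N :\ a))) ->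
  (forall N : {set 'I_n}, L N = [&& a \notin N, b \notin N & G (a |: (b |: N))]) ->
  good k d.+2 s.+2 D.+1 C -> good k d s D L -> good k d.+2 s.+2 D.+1 G.
Proof.
move=> hC hL gC gL; apply: good_degen.
have dL : down L.
  move=> M N MN; rewrite !hL => /and3P[aN bN GN].
  by rewrite !(contra (subsetP MN _)) //=; apply: dG GN; rewrite !setUS.
pose L1 N := L (N :\ a).
have dL1 : down L1 by move=> M N MN; apply: dL; apply: setSD.
have gL1 : good k d.+1 s D L1.
  by apply: (good_cone (z := a)) gL => // N; rewrite hL => /and3P[].
have gL2 : good k d.+2 s D (fun N => L1 (N :\ b)).
  by apply: (good_cone (z := b)) gL1 => // N; rewrite /L1 hL !inE => /and3P[_]; rewrite ba.
apply: (good_vertex kinf (z := b) down_degen _ _ gC gL2).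
  by move=> N; rewrite hC /degen; case: (b \in N).
move=> N; rewrite /degen /L1 hL !inE !eqxx ba /=; congr G.
by apply/setP => i; rewrite !inE; case: (i == a); case: (i == b).
Qed.

End Degeneration.

(** * Joins of boundaries of simplices *)

Section Boundary.
Variables (k : fieldType) (n : nat).
Notation A := {mpoly k[n]}.
Implicit Types (f : A).

Lemma subst_congr (P : A -> Prop) h f : gideal P -> (forall w, P ('X_w - h w)) ->
  P (f - subst h f).
Proof.
move=> gP H; rewrite substE {1}[f]mpolyE -sumrB; apply: gideal_sum => // m _.
rewrite -scalerBr -mul_mpolyC; apply: gidealM => //; rewrite mpolyXE_id.
elim/big_rec2: _ => [|i x y _ Pxy]; first by rewrite subrr; apply: gideal0.
have Pp j : P ('X_i ^+ j - h i ^+ j).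
  elim: j => [|j IH]; first by rewrite !expr0 subrr; apply: gideal0.
  rewrite !exprS (_ : _ - _ = 'X_i * ('X_i ^+ j - h i ^+ j) + h i ^+ j * ('X_i - h i)); last by ring.
  by apply: gidealD => //; apply: gidealM.
rewrite (_ : _ - _ = 'X_i ^+ m i * (x - y) + y * ('X_i ^+ m i - h i ^+ m i)); last by ring.
by apply: gidealD => //; apply: gidealM.
Qed.

Variables (T : {set 'I_n}) (d : nat).
Hypothesis cT : #|T| = d.+1.

Definition boundary (N : {set 'I_n}) := (N \subset T) && ~~ (T \subset N).
Definition simplex (N : {set 'I_n}) := N \subset T.

Lemma down_boundary : down boundary.
Proof.
move=> M N MN /andP[NT TN]; rewrite /boundary (subset_trans MN) //=.
by apply: contra TN => /subset_trans ->.
Qed.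

Lemma down_simplex : down simplex.
Proof. by move=> M N MN NT; apply: subset_trans MN NT. Qed.

Let e := enum T.
Let se : size e = d.+1. Proof. by rewrite -cardE. Qed.
Let w0 : 'I_n := tnth (in_tuple e) (cast_ord (esym se) ord0).
Let w j := nth w0 e j.

Let w0E : w 0 = w0.
Proof. by symmetry; apply: (tnth_nth w0 (in_tuple e) (cast_ord (esym se) ord0)). Qed.

Let wT j : (j <= d)%N -> w j \in T.
Proof. by move=> jd; rewrite -mem_enum mem_nth // se. Qed.

Let index_w j : (j <= d)%N -> index (w j) e = j.
Proof. by move=> jd; rewrite index_uniq ?se // enum_uniq. Qed.

(** The Lefschetz form is the variable of [w0] and the parameters identify all variables of [T] with
    it. The quotient is k[t]/(t^(d+1)), on which powers of t are injective in the required degrees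
    in every characteristic. *)
Let x (j : nat) (v : 'I_n) : k :=
  if j is j'.+1 then (v == w j'.+1)%:R - (v == w0)%:R else (v == w0)%:R.

Let lin_delta u : lin (fun v => (v == u)%:R) = 'X_u :> A.
Proof.
rewrite /lin (bigD1 u) //= eqxx scale1r big1 ?addr0 // => v /negPf->.
by rewrite scale0r.
Qed.

Let om_x : lin (x 0) = 'X_w0 :> A. Proof. exact: lin_delta. Qed.

Let tht_x j : tht x j = 'X_(w j.+1) - 'X_w0 :> A.
Proof.
rewrite -!lin_delta /tht /lin -sumrB; apply: eq_bigr => v _.
by rewrite -scalerBl.
Qed.

(* [pr i] is the quotient map by the first [i] parameters of this special system; its
   image is an integral domain. *)
Let pr i : A -> A := subst (fun v => if v \in T then
  (if (index v e <= i)%N then 'X_w0 else 'X_v) else 0).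

Let prM i f g : pr i (f * g) = pr i f * pr i g. Proof. exact: substM. Qed.
Let prB i f g : pr i (f - g) = pr i f - pr i g. Proof. exact: substB. Qed.
Let pr0 i : pr i 0 = 0. Proof. exact: subst0. Qed.

Let prw i j : (j <= d)%N -> pr i 'X_(w j) = if (j <= i)%N then 'X_w0 else 'X_(w j).
Proof. by move=> jd; rewrite /pr substXU wT // index_w. Qed.

Let prw0 i : pr i 'X_w0 = 'X_w0.
Proof. by rewrite -{1}w0E prw. Qed.

Let gS := SR_gideal k down_simplex.
Let gB := SR_gideal k down_boundary.
Let gI i := inPar_gideal i gS (tht_homog x).

Let pr_congr i f : (i <= d)%N -> inPar (SR simplex) (tht x) i (f - pr i f).
Proof.
move=> id; apply: subst_congr => // v.
case: (boolP (v \in T)) => vT; last first.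
  rewrite subr0; apply: inPar_ideal => // m; rewrite mcoeffX.
  by case: eqP => // <-; rewrite /simplex vsuppU sub1set (negPf vT).
case: ifP => vi; last by rewrite subrr; apply: gideal0.
have vw : v = w (index v e) by rewrite /w nth_index // mem_enum.
case: (index v e) vi vw => [|j] ji ->; first by rewrite w0E subrr; apply: gideal0.
exists (fun l => (l == j)%:R); rewrite -tht_x /comb (bigD1 (Ordinal ji)) //= eqxx mulr1.
rewrite big1 => [|l lj]; first by rewrite addr0 subrr; apply: gideal0 gS.
by rewrite -[(l : nat) == j]/(l == Ordinal ji) (negPf lj) mulr0.
Qed.

Let pr_SR i f : SR simplex f -> pr i f = 0.
Proof.
move=> Zf; have := SR_kill down_simplex Zf (subxx T : simplex T) => K0.
suff -> : pr i f = pr i (kill T f) by rewrite K0 /pr subst0.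
rewrite /pr /kill subst_comp; apply: eq_subst => v.
by case: ifP => vT; rewrite ?subst0 // substXU vT.
Qed.

Let pr_tht i j : (i <= d)%N -> (j < i)%N -> pr i (tht x j) = 0.
Proof.
by move=> id ji; rewrite tht_x prB prw0 prw ?ji ?subrr //; lia.
Qed.

Let pr_comb i g : (i <= d)%N -> pr i (comb (tht x) i g) = 0.
Proof.
move=> id; rewrite /comb /pr subst_sum big1 // => j _.
by rewrite -/(pr i _) prM pr_tht ?mul0r.
Qed.

Let prP i f : (i <= d)%N -> inPar (SR simplex) (tht x) i f <-> pr i f = 0.
Proof.
move=> id; split=> [[g /(pr_SR i)]|p0].
  by rewrite prB pr_comb // subr0.
by have := pr_congr f id; rewrite p0 subr0.
Qed.

Let mT : 'X_{1..n} := [multinom (i \in T : nat) | i < n].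
Let P : A := 'X_[mT].

Let vsupp_mT : vsupp mT = T.
Proof. by apply/setP => v; rewrite !inE mnmE lt0b. Qed.

Let P_SR : SR boundary P.
Proof.
move=> m; rewrite /P mcoeffX; case: eqP => // <-.
by rewrite vsupp_mT /boundary subxx.
Qed.

Let SR_boundary f : SR boundary f -> exists h, SR simplex (f - P * h).
Proof.
move=> Zf; exists (\sum_(m <- msupp f | vsupp m == T) f@_m *: 'X_[m - mT]).
have -> : P * (\sum_(m <- msupp f | vsupp m == T) f@_m *: 'X_[m - mT]) =
    mfilter (fun m => vsupp m == T) f.
  rewrite /mfilter mulr_sumr; apply: eq_bigr => m /eqP mE; rewrite -scalerAr -mpolyXD.
  congr (_ *: 'X_[_]); apply/mnmP => v; rewrite mnmDE mnmBE mnmE -mE inE.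
  by case: (m v) => [|c] //=; lia.
move=> m sm; rewrite mcoeffB mcoeff_mfilter; case: ifPn => [_|mE]; first by rewrite subrr.
rewrite subr0; apply: Zf; rewrite /boundary -/(simplex _) sm /=; apply: contra mE => Tm.
by rewrite eqEsubset Tm andbT.
Qed.

Let prBP i f : (i <= d)%N -> inPar (SR boundary) (tht x) i f <-> exists h, pr i f = pr i P * pr i h.
Proof.
move=> id; split=> [[g /SR_boundary[h Zh]]|[h Eh]].
  exists h; apply/eqP; rewrite -subr_eq0 -prM -prB; apply/eqP.
  apply/(prP _ id); exists g; move: Zh; congr (SR _ _); ring.
have /(prP _ id)[g Zg] : pr i (f - P * h) = 0 by rewrite prB prM Eh subrr.
exists g; rewrite (_ : _ - _ = (f - P * h - comb (tht x) i g) + h * P); last by ring.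
apply: (gidealD gB); last exact: (gidealM gB).
by apply: sub_SR Zg => N /andP[].
Qed.

Let pr_X i m : vsupp m \subset T -> exists m', pr i 'X_[m] = 'X_[m'].
Proof.
move=> sm; rewrite /pr substX; elim/big_rec: _ => [|v y _ [m' ->]]; first by exists 0%MM; rewrite mpolyX0.
case: (boolP (v \in T)) => vT.
  by case: ifP => _; rewrite mpolyXn -mpolyXD; eexists.
suff -> : m v = 0%N by exists m'; rewrite expr0 mul1r.
by apply/eqP; rewrite -leqn0 leqNgt; apply: contra vT => mv; apply: (subsetP sm); rewrite inE.
Qed.

Let prP_neq0 i : pr i P != 0.
Proof.
have [|m' ->] := @pr_X i mT; first by rewrite vsupp_mT.
by apply/eqP => /(congr1 (mcoeff m')); rewrite mcoeffX eqxx mcoeff0 => /eqP; rewrite oner_eq0.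
Qed.

Let tht_neq0 i : (i < d)%N -> tht x i != 0.
Proof.
move=> id; rewrite tht_x subr_eq0; apply/eqP => /(congr1 (mcoeff U_(w0))).
rewrite !mcoeffXU eqxx; case: eqP => [E|_ /esym/eqP]; last by rewrite oner_eq0.
by have := index_w id; rewrite E -w0E index_w.
Qed.

Let regular_boundary N : regular (SR boundary) (tht x) N d.
Proof.
move=> i c id _ f _ /(prBP _ (ltnW id))[h].
have fx : pr i (tht x i) = tht x i.
  by rewrite tht_x prB prw0 prw // ltnn.
rewrite prM fx => E.
have prpr g : pr i.+1 (pr i g) = pr i.+1 g.
  rewrite /pr subst_comp; apply: eq_subst => v; case: (boolP (v \in T)) => vT; last by rewrite subst0.
  case: ifP => vi; last by rewrite substXU vT.
  by rewrite -/(pr i.+1 _) prw0 (leqW vi).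
(* Going from [pr i] to [pr i.+1] kills [tht x i] but not the nonzero monomial [pr i P]. In a domain
   [h] must die too, so it is a multiple of [tht x i] modulo the previous parameters. *)
have h0 : pr i.+1 h = 0.
  have := congr1 (pr i.+1) E; rewrite !prM !prpr pr_tht // mul0r => /esym/eqP.
  by rewrite mulf_eq0 (negPf (prP_neq0 _)) => /eqP.
have /(prP _ id)[g Zg] := h0.
apply/(prBP _ (ltnW id)); exists (g i).
apply: (mulfI (tht_neq0 id)); rewrite E mulrCA; congr (_ * _).
have := pr_SR i Zg; rewrite combS opprD addrA !prB prM fx pr_comb ?(ltnW id) // subr0 => /eqP.
by rewrite subr_eq0 => /eqP.
Qed.

Let pr_d_X m : vsupp m \subset T -> pr d 'X_[m] = 'X_w0 ^+ mdeg m.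
Proof.
move=> sm; rewrite /pr substX mdegE; elim/big_rec2: _ => [|v j y _ ->]; first by rewrite expr0.
rewrite exprD; case: (boolP (v \in T)) => vT.
  by rewrite ifT // -ltnS -se index_mem mem_enum.
suff -> : m v = 0%N by rewrite !expr0.
by apply/eqP; rewrite -leqn0 leqNgt; apply: contra vT => mv; apply: (subsetP sm); rewrite inE.
Qed.

Let mdeg_mT : mdeg mT = d.+1.
Proof.
rewrite mdegE -cT -sum1_card [RHS]big_mkcond /=; apply: eq_bigr => v _; rewrite mnmE.
by case: (v \in T).
Qed.

Lemma good_boundary : good k d d d.+1 boundary.
Proof.
move=> N; exists x; have dd := leqnn d; split; first exact: regular_boundary.
  move=> m md f hf /(prBP _ dd)[h].
  rewrite om_x prM pr_d_X ?vsupp_mT // mdeg_mT.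
  have -> : pr d ('X_w0 ^+ (d - 2 * m)) = 'X_w0 ^+ (d - 2 * m).
    by rewrite -[in RHS](prw0 d); apply: rmorphXn.
  have hX j : ('X_w0 : A) ^+ j \is j.-homog.
    by rewrite -[X in X.-homog]mul1n; apply: dhomogMn; apply: homogXU.
  have hp : pr d f \is m.-homog.
    by apply: subst_homog hf => v; case: ifP => _; [case: ifP => _; apply: homogXU|apply: dhomog0].
  (* The degree is d - m, below d + 1, so a multiple of the image of [P] has no component there. *)
  move/(congr1 (pihomog mdeg (d - 2 * m + m))).
  rewrite (pihomog_mul _ _ (hX _)) (pihomog_dE hp) (pihomog_mul_lt _ (hX d.+1)); last by lia.
  move/eqP; rewrite mulf_eq0 expf_eq0 => /orP[/andP[_ /eqP X0]|/eqP f0].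
    have := congr1 (mcoeff U_(w0)) X0; rewrite mcoeffXU eqxx mcoeff0 => /eqP.
    by rewrite oner_eq0.
  by apply/(prBP _ dd); exists 0; rewrite f0 pr0 mulr0.
move=> f /dhomogP hf; have gBI := inPar_gideal d gB (tht_homog x).
rewrite [f]mpolyE big_seq; apply: (gideal_sum _ gBI) => m /hf md.
rewrite -mul_mpolyC; apply: (gidealM gBI).
case: (boolP (vsupp m \subset T)) => sm; last first.
  apply: inPar_ideal => // m'; rewrite mcoeffX; case: eqP => // <- /andP[].
  by rewrite (negPf sm).
by apply/(prBP _ dd); exists 1; rewrite -prM mulr1 !pr_d_X ?vsupp_mT // md mdeg_mT.
Qed.

End Boundary.

Section Joins.
Variables (k : fieldType) (n : nat).
Hypothesis kinf : ~ exists s : seq k, forall c : k, c \in s.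
Implicit Types (N t : {set 'I_n}) (ts : seq {set 'I_n}).

Definition joinb ts N := (N \subset \bigcup_(t <- ts) t) && all (fun t => ~~ (t \subset N)) ts.

Definition dimJ ts := (\sum_(t <- ts) #|t|.-1)%N.

Definition disj ts := pairwise (fun t u : {set 'I_n} => [disjoint t & u]) ts.

Lemma down_joinb ts : down (joinb ts).
Proof.
move=> M N MN /andP[NT /allP h]; rewrite /joinb (subset_trans MN) //=.
by apply/allP => t /h; apply: contra => tM; apply: subset_trans MN.
Qed.

(** The boundary of a point has only the empty face, so as a join factor it is neutral. *)
Lemma joinb_set1 a ts : a \notin \bigcup_(t <- ts) t -> joinb ([set a] :: ts) =1 joinb ts.
Proof.
move=> aT N; rewrite /joinb /= big_cons sub1set.
case: (boolP (a \in N)) => aN; rewrite ?andbF /=.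
  by symmetry; apply/negP => /andP[/subsetP/(_ a aN)]; rewrite (negPf aT).
congr (_ && _); apply/idP/idP => [/subsetP s|s]; last by rewrite (subset_trans s) ?subsetUr.
by apply/subsetP => i iN; have := s i iN; rewrite !inE; case: eqP iN aN => //= -> ->.
Qed.

Lemma disjoint_bigcup t ts : all (fun u : {set 'I_n} => [disjoint t & u]) ts ->
  [disjoint t & \bigcup_(u <- ts) u].
Proof.
elim: ts => [|u ts IH] /=; first by rewrite big_nil -setI_eq0 setI0.
by case/andP=> tu /IH tts; rewrite big_cons -setI_eq0 setIUr setU_eq0 !setI_eq0 tu.
Qed.

Lemma good_nil : good k 0 0 1 (joinb [::] : {set 'I_n} -> bool).
Proof.
move=> N; exists (fun _ _ => 0); split=> // f hf.
apply: inPar_ideal; first exact: (SR_gideal k (@down_joinb _)).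
move=> m; rewrite /joinb big_nil subset0 andbT => /eqP m0.
apply: (dhomog_nemf_coeff hf); rewrite /= mdegE big1 // => i _.
by apply/eqP; rewrite -leqn0 leqNgt; have /setP/(_ i) := m0; rewrite !inE => ->.
Qed.

Let arithC x y z : (1 < x -> 1 < y -> (x + y).-1.-1 + z = x.-1 + (y.-1 + z))%N.
Proof. lia. Qed.

Let arithL x y z : (0 < x -> 0 < y -> x.+1.-1 + (y.+1.-1 + z) = (x.-1 + (y.-1 + z)).+2)%N.
Proof. lia. Qed.

Let arithleC x y z l : (1 < x -> x + (y + z) < l.+1 -> (x + y).-1 + z < l)%N.
Proof. lia. Qed.

Let arithleL x y z l : (x.+1 + (y.+1 + z) < l.+1 -> x + (y + z) < l)%N.
Proof. lia. Qed.

(** Contracting an edge from [a] in [t1] to [b] in [t2] merges the two factors into the boundary of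
    the simplex on [t1 :|: (t2 :\ b)]; the link of the edge has the factors [t1 :\ a] and [t2 :\ b]
    instead. Both have fewer vertices. One-point factors are dropped first, so that no factor of the
    link is empty. *)
Lemma good_joinb ts : all (fun t => t != set0) ts -> disj ts ->
  good k (dimJ ts) (dimJ ts) (dimJ ts).+1 (joinb ts).
Proof.
have [l le] := ubnP (\sum_(t <- ts) #|t|)%N.
elim: l => // l IH in ts le *.
case: ts => [|t1 ts] in le *; first by rewrite /dimJ big_nil => _ _; apply: good_nil.
rewrite /= => /andP[t1n tsn] /andP[d1 dts].
have dt1 := disjoint_bigcup d1.
have drop1 t' ts' a : t' = [set a] -> (\sum_(t <- t' :: ts') #|t| < l.+1)%N ->
    all (fun t => t != set0) ts' -> disj ts' -> all (fun u : {set 'I_n} => [disjoint t' & u]) ts' ->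
    good k (dimJ (t' :: ts')) (dimJ (t' :: ts')) (dimJ (t' :: ts')).+1 (joinb (t' :: ts')).
  move=> -> le' n' d' dd.
  have -> : dimJ ([set a] :: ts') = dimJ ts' by rewrite /dimJ big_cons cards1.
  apply: (eq_good (fsym (joinb_set1 _))).
    by have := disjoint_bigcup dd; rewrite disjoints1.
  by apply: IH => //; rewrite big_cons cards1 in le'.
have [/cards1P[a E1]|c1] := boolP (#|t1| == 1%N); first exact: drop1 E1 le tsn dts d1.
have [a aT1] := set0Pn _ t1n.
have c1' : (1 < #|t1|)%N by rewrite ltn_neqAle eq_sym c1 card_gt0.
case: ts => [|t2 ts] in le tsn d1 dts dt1 *.
  have E : dimJ [:: t1] = #|t1|.-1 by rewrite /dimJ big_seq1.
  have c : #|t1| = (dimJ [:: t1]).+1 by rewrite E prednK // ltnW.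
  by apply: eq_good (good_boundary k c) => N; rewrite /joinb /boundary big_seq1 /= andbT.
move: tsn d1 dts => /= /andP[t2n tsn] /andP[d12 d1] /andP[d2 dts].
have [/cards1P[b E2]|c2] := boolP (#|t2| == 1%N).
  have sw : joinb (t2 :: t1 :: ts) =1 joinb (t1 :: t2 :: ts).
    move=> N; rewrite /joinb /= !big_cons setUCA; congr (_ && _); rewrite !andbA.
    by congr (_ && _); apply: andbC.
  have -> : dimJ (t1 :: t2 :: ts) = dimJ (t2 :: t1 :: ts) by rewrite /dimJ !big_cons addnCA.
  apply: (eq_good sw); apply: (drop1 _ _ b E2) => //=.
  - by move: le; rewrite !big_cons addnCA.
  - by rewrite t1n.
  - by rewrite d1.
  by rewrite disjoint_sym d12.
have [b bT2] := set0Pn _ t2n.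
have c2' : (1 < #|t2|)%N by rewrite ltn_neqAle eq_sym c2 card_gt0.
have aT2 : a \notin t2 by apply: contraTN d12 => a2; apply/pred0Pn; exists a; rewrite /= aT1.
have bT1 : b \notin t1 by apply: contraTN d12 => b1; apply/pred0Pn; exists b; rewrite /= b1.
have ab : a != b by apply: contraNneq bT1 => <-.
have aTs : a \notin \bigcup_(t <- ts) t.
  by have := disjoint_bigcup d1; move/pred0P/(_ a); rewrite /= aT1 /= => ->.
have bTs : b \notin \bigcup_(t <- ts) t.
  by have := disjoint_bigcup d2; move/pred0P/(_ b); rewrite /= bT2 /= => ->.
have inTs t i : t \in ts -> i \in t -> i \in \bigcup_(t <- ts) t.
  by move=> tts it; rewrite (big_rem t) //= inE it.
pose tC := (t1 :|: (t2 :\ b)) :: ts; pose tL := (t1 :\ a) :: (t2 :\ b) :: ts.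
have cU : #|t1 :|: (t2 :\ b)| = (#|t1| + #|t2|).-1.
  rewrite cardsU (_ : t1 :&: (t2 :\ b) = set0).
    by rewrite cards0 subn0 [in RHS](cardsD1 b t2) bT2 add1n addnS.
  apply/setP => i; rewrite !inE; apply/negP => /and3P[i1 _ i2].
  by move/pred0P/(_ i): d12; rewrite /= i1 i2.
have cA : #|t1| = #|t1 :\ a|.+1 by rewrite (cardsD1 a) aT1.
have cB : #|t2| = #|t2 :\ b|.+1 by rewrite (cardsD1 b) bT2.
have EC : dimJ tC = dimJ (t1 :: t2 :: ts) by rewrite /dimJ /tC !big_cons cU; apply: arithC.
have EL : dimJ (t1 :: t2 :: ts) = (dimJ tL).+2 by rewrite /dimJ /tL !big_cons cA cB; apply: arithL; rewrite -ltnS -?cA -?cB.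
have disjS (t u u' : {set 'I_n}) : u' \subset u -> [disjoint t & u] -> [disjoint t & u'].
  by move=> s; rewrite ![[disjoint t & _]]disjoint_sym; apply: disjointWl.
have allS (t t' : {set 'I_n}) : t' \subset t -> all (fun u : {set 'I_n} => [disjoint t & u]) ts ->
    all (fun u : {set 'I_n} => [disjoint t' & u]) ts.
  by move=> s /allP h; apply/allP => u /h; apply: disjointWl.
have gC : good k (dimJ tC) (dimJ tC) (dimJ tC).+1 (joinb tC).
  apply: IH.
  - by move: le; rewrite /tC !big_cons cU; apply: arithleC.
  - by rewrite /= tsn andbT; apply/set0Pn; exists a; rewrite inE aT1.
  rewrite /disj /= -/(disj ts) dts andbT; apply/allP => u uts.
  rewrite -setI_eq0 setIUl setU_eq0 !setI_eq0 (allP d1) //=; apply: disjointWl (allP d2 u uts); exact: subD1set.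
have gL : good k (dimJ tL) (dimJ tL) (dimJ tL).+1 (joinb tL).
  apply: IH.
  - by move: le; rewrite /tL !big_cons cA cB; apply: arithleL.
  - by rewrite /= tsn -!card_gt0 andbT -!(ltnS 1) -cA -cB c1' c2'.
  rewrite /disj /= -/(disj ts) dts andbT (allS _ _ (subD1set t1 a) d1) (allS _ _ (subD1set t2 b) d2) !andbT.
  exact: disjS (subD1set t2 b) (disjointWl (subD1set t1 a) d12).
rewrite EC EL in gC; rewrite EL.
have gL2 := goodS (@down_joinb tL) gL.
have restE (N M : {set 'I_n}) : (forall i, i != a -> i != b -> (i \in N) = (i \in M)) ->
    all (fun t => ~~ (t \subset N)) ts = all (fun t => ~~ (t \subset M)) ts.
  move=> E; apply: eq_in_all => t tts; congr (~~ _).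
  have ne i : i \in t -> i != a /\ i != b.
    by move=> it; split; [apply: contraNneq aTs|apply: contraNneq bTs] => <-; apply: inTs it.
  by apply/subsetP/subsetP => s i it; have [ia ib] := ne i it; have := s i it; rewrite E.
have t1b (i : 'I_n) : i \in t1 -> i != b by apply: contraTneq => ->.
have t2a (i : 'I_n) : i \in t2 -> i != a by apply: contraTneq => ->.
have sub_ab (N M U : {set 'I_n}) : a \in U -> b \in U ->
    (forall i, i != a -> i != b -> (i \in N) = (i \in M)) -> N \subset U -> M \subset U.
  move=> aU bU E /subsetP s; apply/subsetP => i iM.
  have [->//|ia] := eqVneq i a; have [->//|ib] := eqVneq i b.
  by apply: s; rewrite E.
have aU : a \in \bigcup_(t <- t1 :: t2 :: ts) t by rewrite big_cons inE aT1.
have bU : b \in \bigcup_(t <- t1 :: t2 :: ts) t by rewrite !big_cons !inE bT2 orbT.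
have UC : \bigcup_(t <- tC) t = (\bigcup_(t <- t1 :: t2 :: ts) t) :\ b.
  rewrite /tC !big_cons; apply/setP => i; rewrite !inE.
  by case: eqP => [->|_] //=; rewrite ?(negPf bT1) ?(negPf bTs) ?orbA.
have UL : \bigcup_(t <- tL) t = (\bigcup_(t <- t1 :: t2 :: ts) t) :\ a :\ b.
  rewrite /tL !big_cons; apply/setP => i; rewrite !inE.
  have [->|ib] /= := eqVneq i b; first by rewrite (negPf bT1) (negPf bTs) !andbF.
  by have [->|ia] //= := eqVneq i a; rewrite (negPf aT2) (negPf aTs).
apply: (good_contraction ab (@down_joinb _) _ kinf _ _ gC gL2).
- move=> N aN bN /andP[sa /= /and3P[h1 h2 h3]] /andP[sb /= /and3P[g1 g2 g3]].
  apply/andP; split; first by rewrite subUset sub1set aU.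
  rewrite /= (restE _ (a |: N)) ?h3 ?andbT => [|i /negPf ia /negPf ib]; last by rewrite !inE ia ib.
  apply/andP; split; [apply: contra h1|apply: contra g2] => /subsetP s; apply/subsetP => i it.
    by have := s i it; rewrite !inE (negPf (t1b _ it)).
  by have := s i it; rewrite !inE (negPf (t2a _ it)).
- move=> N; rewrite /joinb UC subsetD1 /=; case: (boolP (b \in N)) => bN; first by rewrite andbF.
  have t2N : t2 \subset N = false by apply/negP => /subsetP/(_ b bT2); rewrite (negPf bN).
  rewrite andbT t2N subUset /=.
  have Eab : forall i, i != a -> i != b -> (i \in N) = (i \in b |: N :\ a).
    by move=> i ia /negPf ib; rewrite !inE ia ib.
  rewrite -(restE N _ Eab).
  have -> : (t1 \subset b |: N :\ a) = false.
    by apply/negP => /subsetP/(_ a aT1); rewrite !inE eqxx (negPf ab).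
  have -> : (b |: N :\ a \subset \bigcup_(t <- t1 :: t2 :: ts) t) = (N \subset \bigcup_(t <- t1 :: t2 :: ts) t).
    by apply/idP/idP; apply: sub_ab => // i ia ib; rewrite Eab.
  have t2E : a \in N -> (t2 \subset b |: N :\ a) = (t2 :\ b \subset N).
    move=> aN; apply/subsetP/subsetP => s i.
      by rewrite !inE => /andP[/negPf ib it]; have := s i it; rewrite !inE ib => /andP[].
    move=> it; have [->|ib] := eqVneq i b; first by rewrite !inE eqxx.
    by rewrite !inE (negPf ib) (t2a _ it) /=; apply: s; rewrite !inE ib.
  case: (boolP (a \in N)) => aN /=.
    by rewrite t2E //; case: (_ \subset _); case: (_ \subset _); case: (_ \subset _); case: (all _ _).
  have -> : t1 \subset N = false by apply/negP => /subsetP/(_ a aT1); rewrite (negPf aN).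
  by rewrite /= orbF.
move=> N; rewrite /joinb UL !subsetD1 /=.
case: (boolP (a \in N)) => aN; first by rewrite !andbF.
case: (boolP (b \in N)) => bN; rewrite ?andbF //= !andbT.
have Eab : forall i, i != a -> i != b -> (i \in N) = (i \in a |: (b |: N)).
  by move=> i /negPf ia /negPf ib; rewrite !inE ia ib.
rewrite -(restE N _ Eab); congr (_ && (_ && (_ && _))).
- by apply/idP/idP; apply: sub_ab => // i ia ib; rewrite Eab.
- congr (~~ _); apply/subsetP/subsetP => s i.
    by move=> it; have [->|ia] := eqVneq i a; rewrite ?setU11 // !inE (s i) ?orbT // !inE ia.
  rewrite !inE => /andP[/negPf ia it].
  by have := s i it; rewrite !inE ia (negPf (t1b _ it)).
congr (~~ _); apply/subsetP/subsetP => s i.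
  move=> it; have [->|ib] := eqVneq i b; rewrite !inE ?eqxx ?orbT // (s i) ?orbT // !inE ib.
  exact: it.
rewrite !inE => /andP[/negPf ib it].
by have := s i it; rewrite !inE ib (negPf (t2a _ it)).
Qed.

End Joins.

(** * Nested set complexes *)

Section Nested.
Local Open Scope nat_scope.
Variables (k : fieldType) (n : nat) (V : finType) (v : 'I_n -> {set V}).
Hypothesis kinf : ~ exists s : seq k, forall c : k, c \in s.
Hypothesis v_inj : injective v.
Implicit Types (N S t : {set 'I_n}) (ts : seq {set 'I_n}) (H F : {set V}) (B : {set {set V}}).

Definition vU S : {set V} := \bigcup_(w in S) v w.
Definition tU ts : {set 'I_n} := \bigcup_(t <- ts) t.

Lemma vU_sup S w : w \in S -> v w \subset vU S.
Proof. by move=> wS; apply: (bigcup_sup w). Qed.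

Lemma vU_sub S H : (forall w, w \in S -> v w \subset H) -> vU S \subset H.
Proof. by move=> h; apply/bigcupsP. Qed.

Lemma vUP S p : p \in vU S -> exists2 w, w \in S & p \in v w.
Proof. by move/bigcupP => [w]; exists w. Qed.

Lemma tU_sup ts t : t \in ts -> t \subset tU ts.
Proof. by move=> tts; rewrite /tU (big_rem t) //= subsetUl. Qed.

(* The join of the boundaries of the simplices in [ts] with the nested set complex
   of the building set [B], where the vertex [w] stands for the set [v w]. *)
Definition nest ts B N :=
  [&& [forall w in N, (w \in tU ts) || (v w \in B)],
      all (fun t => ~~ (t \subset N)) ts &
      [forall S : {set 'I_n}, (S \subset N :\: tU ts) ==> (vU S \in B) ==>
         [exists w in S, v w == vU S]]].

Lemma nestP ts B N : reflect
  [/\ forall w, w \in N -> w \notin tU ts -> v w \in B,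
      forall t, t \in ts -> ~~ (t \subset N) &
      forall S, S \subset N -> (forall w, w \in S -> w \notin tU ts) -> vU S \in B ->
        exists2 w, w \in S & v w = vU S]
  (nest ts B N).
Proof.
apply: (iffP and3P) => [[/forall_inP h1 /allP h2 /forallP h3]|[h1 h2 h3]].
  split=> // [w wN /negPf wT|S SN ST SB]; first by have := h1 w wN; rewrite wT.
  have := h3 S; rewrite SB subsetD SN /=.
  have -> : [disjoint S & tU ts].
    by apply/pred0P => w /=; apply/negP => /andP[/ST]; move=> /negPf->.
  by move/exists_inP => [w wS /eqP]; exists w.
split.
- by apply/forall_inP => w wN; case: (boolP (w \in tU ts)) => //= wT; apply: h1.
- exact/allP.
apply/forallP => S; apply/implyP; rewrite subsetD => /andP[SN /pred0P ST].
apply/implyP => SB; have [|w wS E] := h3 S SN _ SB.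
  by move=> w' w'S; have := ST w'; rewrite /= w'S /= => ->.
by apply/exists_inP; exists w => //; apply/eqP.
Qed.

Lemma down_nest ts B : down (nest ts B).
Proof.
move=> M N MN /nestP[h1 h2 h3]; apply/nestP; split.
- by move=> w wM; apply: h1; apply: (subsetP MN).
- by move=> t /h2; apply: contra => tM; apply: subset_trans MN.
by move=> S SM; apply: h3; apply: subset_trans MN.
Qed.

(* A building set on the interval above [G0]: all atoms, and an up-set of other elements.
   Its nested set complex is an iterated stellar subdivision of the simplex. *)
Record building (G0 F : {set V}) (B : {set {set V}}) : Prop := Building {
  building_in : forall H, H \in B -> G0 \proper H /\ H \subset F;
  building_pt : forall p, p \in F -> p \notin G0 -> p |: G0 \in B;
  building_up : forall H H', H \in B -> 1 < #|H :\: G0| -> H \subset H' -> H' \subset F -> H' \in B;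
  building_top : F \in B }.

Lemma card_setU1D (G0 : {set V}) q : #|(q |: G0) :\: G0| <= 1.
Proof.
rewrite -(cards1 q); apply: subset_leq_card; apply/subsetP => x.
by rewrite !inE; case: (x \in G0); rewrite ?orbF.
Qed.

Lemma building_pt1 G0 F B H q : building G0 F B ->
  H \in B -> #|H :\: G0| <= 1 -> q \in H -> q \notin G0 -> H = q |: G0.
Proof.
move=> bB HB c qH qG; have [/proper_sub G0H _] := building_in bB HB.
have q' : q \in H :\: G0 by rewrite inE qH qG.
apply/eqP; rewrite eqEsubset subUset sub1set qH G0H !andbT; apply/subsetP => x xH.
rewrite !inE; case: (boolP (x \in G0)) => xG; rewrite ?orbT //= orbF.
have x' : x \in H :\: G0 by rewrite inE xH xG.
by move/card_le1_eqP: c => /(_ q x q' x') /= ->.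
Qed.

(** * Removing a minimal non-atom from the building set by an edge contraction *)

Section Step.
Variables (ts : seq {set 'I_n}) (G0 F : {set V}) (B : {set {set V}}).
Hypotheses (bB : building G0 F B) (hT : forall w, w \in tU ts -> v w \subset G0).

Let hB := building_in bB.
Let hpt := building_pt bB.
Let hup := building_up bB.

Let ptP H q : H \in B -> #|H :\: G0| <= 1 -> q \in H -> q \notin G0 -> H = q |: G0.
Proof. exact: (building_pt1 bB). Qed.

Let nonT w : w \in tU ts -> v w \notin B.
Proof. by move/hT => s; apply/negP => /hB[/proper_subn/negP]. Qed.

Variables (G : {set V}) (u : V) (a b : 'I_n).
Hypotheses (GB : G \in B) (cG : 1 < #|G :\: G0|)
  (minG : forall H, H \in B -> H \subset G -> H != G -> #|H :\: G0| <= 1)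
  (uG : u \in G) (uG0 : u \notin G0) (va : v a = u |: G0) (vb : v b = G).

Let G0G : G0 \subset G. Proof. by have [/proper_sub] := hB GB. Qed.
Let GF : G \subset F. Proof. by have [] := hB GB. Qed.
Let vaB : v a \in B. Proof. by rewrite va hpt // (subsetP GF). Qed.
Let vbB : v b \in B. Proof. by rewrite vb. Qed.
Let aT : a \notin tU ts. Proof. by apply/negP => /nonT; rewrite vaB. Qed.
Let bT : b \notin tU ts. Proof. by apply/negP => /nonT; rewrite vbB. Qed.
Let vaG : v a \subset G. Proof. by rewrite va subUset sub1set uG. Qed.
Let vaNG : v a != G.
Proof. by apply/eqP => E; have := card_setU1D G0 u; rewrite -va E leqNgt cG. Qed.
Lemma nest_ab : a != b.
Proof. by apply: contraNneq vaNG => ->; rewrite vb. Qed.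
Let ta t : t \in ts -> a \notin t.
Proof. by move=> tts; apply: contra aT; apply: (subsetP (tU_sup tts)). Qed.
Let tb t : t \in ts -> b \notin t.
Proof. by move=> tts; apply: contra bT; apply: (subsetP (tU_sup tts)). Qed.

Let pt_u H : H \in B -> H \subset G -> H != G -> u \in H -> H = v a.
Proof. by move=> HB HG HnG uH; rewrite va; apply: ptP => //; apply: minG. Qed.

(** By minimality only atoms lie strictly below [G], so without [b] the point [u] is covered by its
    own atom. *)
Let cover_G S : b \notin S -> (forall w, w \in S -> v w \in B) -> vU S = G -> a \in S.
Proof.
move=> bS SB SG; have [|w wS uw] := @vUP S u; first by rewrite SG.
have wG : v w \subset G by rewrite -SG vU_sup.
have wnG : v w != G by apply: contraNneq bS => E; rewrite (v_inj (etrans vb (esym E))).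
by rewrite -(v_inj (pt_u (SB w wS) wG wnG uw)).
Qed.

(** As [v a] is contained in [v b], dropping [a] from a set that contains [b] does not change the
    union. *)
Lemma nest_link N : a \notin N -> b \notin N -> nest ts B (a |: N) -> nest ts B (b |: N) ->
  nest ts B (a |: (b |: N)).
Proof.
move=> aN bN /nestP[h1 h2 h3] /nestP[g1 g2 g3]; apply/nestP; split.
- by move=> w; rewrite in_setU1 => /orP[/eqP-> _|]; [|apply: g1].
- move=> t tts; apply: contra (g2 t tts) => /subsetP s; apply/subsetP => w wt.
  have := s w wt; rewrite in_setU1; case: eqP => // wa.
  by have := ta tts; rewrite -wa wt.
move=> S SM ST SB; have [aS|aS] := boolP (a \in S); last first.
  apply: g3 => //; apply/subsetP => w wS; have := subsetP SM w wS.
  by rewrite in_setU1; case: eqP => // wa; rewrite -wa wS in aS.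
have [bS|bS] := boolP (b \in S); last first.
  apply: h3 => //; apply/subsetP => w wS; have := subsetP SM w wS; rewrite !in_setU1.
  by case: (w =P b) => // wb; rewrite -wb wS in bS.
have E : vU (S :\ a) = vU S.
  apply/eqP; rewrite eqEsubset; apply/andP; split.
    by apply: vU_sub => w; rewrite in_setD1 => /andP[_]; apply: vU_sup.
  apply: vU_sub => w wS; have [->|wa] := eqVneq w a; last by apply: vU_sup; rewrite in_setD1 wa.
  rewrite (subset_trans vaG) // -vb; apply: vU_sup.
  by rewrite in_setD1 bS eq_sym nest_ab.
have [|||w] := g3 (S :\ a).
- apply/subsetP => w; rewrite in_setD1 => /andP[/negPf wa wS].
  by have := subsetP SM w wS; rewrite in_setU1 wa.
- by move=> w; rewrite in_setD1 => /andP[_]; apply: ST.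
- by rewrite E.
by rewrite E in_setD1 => /andP[_ wS]; exists w.
Qed.

(** A set nested without [G] fails for [B] only if some part of it has union [G]. This part contains
    [a], and replacing [a] by [b] repairs the failure. *)
Lemma nest_contract N : nest ts (B :\ G) N =
  (b \notin N) && (nest ts B N || (a \in N) && nest ts B (b |: N :\ a)).
Proof.
have vG w : v w = G -> w = b by move=> E; apply: v_inj; rewrite E vb.
apply/idP/idP.
  move=> /nestP[h1 h2 h3].
  have bN : b \notin N by apply/negP => /h1 /(_ bT); rewrite vb !inE eqxx.
  rewrite bN /=.
  have hB1 w : w \in N -> w \notin tU ts -> v w \in B.
    by move=> wN wT; have := h1 w wN wT; rewrite !inE => /andP[].
  have [/existsP[S0 /and3P[S0N /forall_inP S0T /eqP S0G]]|noS] := boolP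
    [exists S0 : {set 'I_n}, [&& S0 \subset N, [forall w in S0, w \notin tU ts] & vU S0 == G]];
    last first.
    apply/orP; left; apply/nestP; split=> // S SN ST SB.
    apply: h3 => //; rewrite in_setD1 SB andbT; apply: contraNneq noS => SG.
    apply/existsP; exists S; rewrite SN SG eqxx andbT /=.
    by apply/forall_inP.
  have S0B w : w \in S0 -> v w \in B by move=> wS; apply: hB1; [apply: (subsetP S0N)|apply: S0T].
  have bS0 : b \notin S0 by apply: contra bN; apply: (subsetP S0N).
  have aS0 := cover_G bS0 S0B S0G; have aN := subsetP S0N a aS0.
  rewrite aN; apply/orP; right; apply/nestP; split.
  - by move=> w; rewrite in_setU1 in_setD1 => /orP[/eqP->|/andP[_]] //; apply: hB1.
  - move=> t tts; apply: contra (h2 t tts) => /subsetP s; apply/subsetP => w wt.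
    have := s w wt; rewrite in_setU1 in_setD1 => /orP[/eqP wb|/andP[]//].
    by have := tb tts; rewrite -wb wt.
  move=> S SM ST SB; have [bS|bS] := boolP (b \in S); last first.
    have SN : S \subset N.
      apply/subsetP => w wS; have := subsetP SM w wS; rewrite in_setU1 in_setD1.
      by case/orP=> [/eqP wb|/andP[]//]; rewrite -wb wS in bS.
    apply: h3 => //; rewrite in_setD1 SB andbT; apply/negP => /eqP SG.
    have aS : a \in S.
      by apply: cover_G => // w wS; apply: hB1; [apply: (subsetP SN)|apply: ST].
    by have := subsetP SM a aS; rewrite in_setU1 in_setD1 eqxx (negPf nest_ab).
  have GS : G \subset vU S by rewrite -vb; apply: vU_sup.
  have [->|SnG] := eqVneq (vU S) G; first by exists b.
  (* To apply nestedness without [G], the vertex [b] is traded for the part [S0], which has the same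
     union. *)
  pose S' := (S :\ b) :|: S0.
  have S'E : vU S' = vU S.
    apply/eqP; rewrite eqEsubset; apply/andP; split; apply: vU_sub => w.
      rewrite in_setU in_setD1 => /orP[/andP[_]|wS0]; first exact: vU_sup.
      by apply: subset_trans GS; rewrite -S0G; apply: vU_sup.
    move=> wS; have [->|wb] := eqVneq w b.
      rewrite vb -S0G; apply: vU_sub => w' w'S; apply: vU_sup.
      by rewrite in_setU w'S orbT.
    by apply: vU_sup; rewrite in_setU in_setD1 wb wS.
  have [|||w] := h3 S'.
  - apply/subsetP => w; rewrite in_setU in_setD1 => /orP[/andP[/negPf wb wS]|]; last exact: (subsetP S0N).
    by have := subsetP SM w wS; rewrite in_setU1 wb in_setD1 => /andP[].
  - by move=> w; rewrite in_setU in_setD1 => /orP[/andP[_]|]; [apply: ST|apply: S0T].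
  - by rewrite S'E in_setD1 SnG.
  rewrite S'E in_setU in_setD1 => /orP[/andP[_ wS] E|wS0 E]; first by exists w.
  case/negP: SnG; rewrite eqEsubset GS andbT -E -S0G; exact: vU_sup.
case/andP=> bN /orP[/nestP[h1 h2 h3]|/andP[aN /nestP[h1 h2 h3]]]; apply/nestP; split=> //.
- move=> w wN wT; rewrite in_setD1 h1 // andbT; apply: contraNneq bN => /vG <-.
  exact: wN.
- by move=> S SN ST; rewrite in_setD1 => /andP[_]; apply: h3.
- move=> w wN wT; rewrite in_setD1; have -> : v w != G by apply: contraNneq bN => /vG <-.
  have [->//|wa] := eqVneq w a; apply: h1 => //.
  by rewrite in_setU1 in_setD1 wa wN orbT.
- move=> t tts; apply: contra (h2 t tts) => /subsetP s; apply/subsetP => w wt.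
  rewrite in_setU1 in_setD1 s // andbT; case: (eqVneq w a) => [wa|]; rewrite ?orbT //.
  by have := ta tts; rewrite -wa wt.
move=> S SN ST; rewrite in_setD1 => /andP[SnG SB].
have [aS|aS] := boolP (a \in S); last first.
  apply: h3 => //; apply/subsetP => w wS; rewrite in_setU1 in_setD1 (subsetP SN) // andbT.
  by rewrite (_ : w != a) ?orbT //; apply: contraNneq aS => <-.
have SF : vU S \subset F by have [] := hB SB.
pose S2 := b |: S :\ a.
have S2E : vU S2 = vU S :|: G.
  apply/eqP; rewrite eqEsubset; apply/andP; split.
    apply: vU_sub => w; rewrite in_setU1 in_setD1 => /orP[/eqP->|/andP[_ wS]].
      by rewrite vb subsetUr.
    by apply: subset_trans (subsetUl _ _); apply: vU_sup.
  have GS2 : G \subset vU S2 by rewrite -vb; apply: vU_sup; rewrite in_setU1 eqxx.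
  rewrite subUset GS2 andbT; apply: vU_sub => w wS; have [->|wa] := eqVneq w a.
    exact: subset_trans vaG GS2.
  by apply: vU_sup; rewrite in_setU1 in_setD1 wa wS orbT.
have [|||w] := h3 S2.
- apply/subsetP => w; rewrite !in_setU1 !in_setD1 => /orP[->//|/andP[-> wS]].
  by rewrite (subsetP SN) // orbT.
- by move=> w; rewrite in_setU1 in_setD1 => /orP[/eqP->//|/andP[_]]; apply: ST.
- by rewrite S2E; apply: (hup GB) => //; rewrite ?subsetUr // subUset SF GF.
rewrite S2E in_setU1 in_setD1 => /orP[/eqP->|/andP[_ wS] E].
  rewrite vb => E; exists a => //; symmetry; apply: pt_u => //; first by rewrite E subsetUl.
  by apply: (subsetP (vU_sup aS)); rewrite va in_setU1 eqxx.
exists w => //; apply/eqP; rewrite eqEsubset vU_sup //= E subsetUl.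
by [].
Qed.

Definition otherpts := [set w | [exists p, [&& p \in G, p \notin G0, p != u & v w == p |: G0]]].
(** This is all that [B] contains above [G], because [B] is closed upwards beyond its atoms. *)
Definition above := [set H : {set V} | (G \proper H) && (H \subset F)].

Let tau := otherpts.
Let BG := above.

Let BGB H : H \in BG -> H \in B.
Proof. by rewrite inE => /andP[/proper_sub GH HF]; apply: hup GB cG GH HF. Qed.

Let tauP w : w \in tau -> exists p, [/\ p \in G, p \notin G0, p != u & v w = p |: G0].
Proof. by rewrite inE => /existsP[p /and4P[? ? ? /eqP ?]]; exists p. Qed.

Let tau_sub w : w \in tau -> v w \subset G.
Proof. by move/tauP=> [p [pG _ _ ->]]; rewrite subUset sub1set pG. Qed.

Let tauB w : w \in tau -> v w \in B.
Proof. by move/tauP=> [p [pG pG0 _ ->]]; apply: hpt => //; apply: (subsetP GF). Qed.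

Let a_tau : a \notin tau.
Proof.
apply/negP => /tauP[p [_ pG0 pu]]; rewrite va => /setP/(_ p).
by rewrite !in_setU1 eqxx (negPf pu) (negPf pG0).
Qed.

Let tau_nG w : w \in tau -> v w != G.
Proof.
move/tauP=> [p [_ _ _ ->]]; apply/eqP => E; have := card_setU1D G0 p.
by rewrite E leqNgt cG.
Qed.

Let b_tau : b \notin tau.
Proof. by apply/negP => /tau_nG; rewrite vb eqxx. Qed.

Let tU_tau w : (w \in tU (tau :: ts)) = (w \in tau) || (w \in tU ts).
Proof. by rewrite /tU big_cons in_setU. Qed.

(** The union of any member of [B] with [G] is in [B], so a vertex compatible with [b] and not in
    [ts] lies below [G], hence is an atom, or above [G]. The atoms other than [a] cannot all occur,
    since with [a] they would have union [G]; this gives the boundary factor [otherpts]. *)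
Lemma nest_edge_link (full : forall p, p \in F -> p \notin G0 -> exists w, v w = p |: G0) N :
  nest (otherpts :: ts) above N = [&& a \notin N, b \notin N & nest ts B (a |: (b |: N))].
Proof.
rewrite -/tau -/BG; have vG w : v w = G -> w = b by move=> E; apply: v_inj; rewrite E vb.
have nGa : ~~ (G \proper v a) by apply/negP => /proper_subn; rewrite vaG.
apply/idP/idP.
  move=> /nestP[h1 h2 h3].
  have aN : a \notin N.
    apply/negP => /h1; rewrite tU_tau (negPf a_tau) (negPf aT) => /(_ isT).
    by rewrite inE (negPf nGa).
  have bN : b \notin N.
    apply/negP => /h1; rewrite tU_tau (negPf b_tau) (negPf bT) => /(_ isT).
    by rewrite inE vb properxx.
  have N1 w : w \in N -> w \notin tU ts -> (w \in tau) \/ (v w \in BG).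
    move=> wN wT; case: (boolP (w \in tau)) => wt; [by left|right].
    by apply: h1 => //; rewrite tU_tau (negPf wt).
  rewrite aN bN /=; apply/nestP; split.
  - move=> w; rewrite !in_setU1 => /or3P[/eqP->|/eqP->|wN wT] //.
    by case: (N1 w wN wT) => [/tauB|/BGB].
  - move=> t tts; have := h2 t; rewrite in_cons tts orbT => /(_ isT).
    apply: contra => /subsetP s; apply/subsetP => w wt; have := s w wt.
    rewrite !in_setU1 => /or3P[/eqP wa|/eqP wb|//].
      by have := ta tts; rewrite -wa wt.
    by have := tb tts; rewrite -wb wt.
  move=> S SM ST SB; pose SG := [set w in S | G \proper v w].
  have SF : vU S \subset F by have [] := hB SB.
  have Scase w : w \in S -> [\/ w = a, w = b, w \in N /\ w \in tau | w \in N /\ G \proper v w].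
    move=> wS; have := subsetP SM w wS; rewrite !in_setU1 => /or3P[/eqP->|/eqP->|wN].
    - by constructor 1.
    - by constructor 2.
    case: (N1 w wN (ST w wS)) => [wt|]; first by constructor 3.
    by rewrite inE => /andP[]; constructor 4.
  have SGN w : w \in S -> ~~ (G \proper v w) -> v w \subset G.
    move=> wS wG; case: (Scase w wS) => [->|->|[_ /tau_sub]|[_ h]] //; first by rewrite vb.
    by rewrite h in wG.
  (* As soon as one member lies above [G], the members inside [G] add nothing to the union. *)
  have [SG0|[w0]] := set_0Vmem SG; last first.
    rewrite inE => /andP[w0S w0G].
    have SGE : vU SG = vU S.
      apply/eqP; rewrite eqEsubset; apply/andP; split; apply: vU_sub => w.
        by rewrite inE => /andP[wS _]; apply: vU_sup.
      have [wG wS|wG wS] := boolP (G \proper v w); first by apply: vU_sup; rewrite inE wS.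
      apply: subset_trans (SGN w wS wG) _; apply: subset_trans (proper_sub w0G) _.
      by apply: vU_sup; rewrite inE w0S.
    have [|||w] := h3 SG.
    - apply/subsetP => w; rewrite inE => /andP[wS wG].
      case: (Scase w wS) => [wa|wb|[]//|[]//]; first by rewrite wa (negPf nGa) in wG.
      by rewrite wb vb properxx in wG.
    - move=> w; rewrite inE tU_tau => /andP[wS wG]; rewrite (negPf (ST w wS)) orbF.
      by apply/negP => /tau_sub; rewrite (negPf (proper_subn wG)).
    - by rewrite SGE inE SF andbT (proper_sub_trans w0G) // vU_sup.
    by rewrite SGE inE => /andP[wS _]; exists w.
  have allG w : w \in S -> v w \subset G.
    move=> wS; apply: SGN => //; apply/negP => wG.
    by have := in_set0 w; rewrite -SG0 inE wS wG.
  have SsubG : vU S \subset G by apply: vU_sub.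
  have [bS|bS] := boolP (b \in S).
    exists b => //; rewrite vb; apply/eqP; rewrite eqEsubset SsubG andbT -vb.
    exact: vU_sup.
  have Spt w : w \in S -> w = a \/ (w \in N /\ w \in tau).
    move=> wS; case: (Scase w wS) => [->|wb|[]|[_ h]]; [by left| |by right|].
      by rewrite -wb wS in bS.
    by have := allG w wS; rewrite (negPf (proper_subn h)).
  have [SG'|SnG] := eqVneq (vU S) G.
    have := h2 tau (mem_head _ _) => /negP[]; apply/subsetP => w wt.
    have [p [pG pG0 pu vw]] := tauP wt.
    have [|w' w'S pw'] := @vUP S p; first by rewrite SG'.
    case: (Spt w' w'S) => [w'a|[w'N w't]].
      by move: pw'; rewrite w'a va in_setU1 (negPf pu) (negPf pG0).
    have [q [_ _ _ vw']] := tauP w't; move: pw'.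
    rewrite vw' in_setU1 (negPf pG0) orbF => /eqP pq.
    by rewrite (_ : w = w') //; apply: v_inj; rewrite vw vw' pq.
  have cS := minG SB SsubG SnG.
  have [/properP[_ [q qS qG0]] _] := hB SB.
  have [w wS qw] := vUP qS; exists w => //.
  have wB : v w \in B by case: (Spt w wS) => [->|[_ /tauB]].
  rewrite (ptP SB cS qS qG0); apply: ptP => //.
  by apply: leq_trans cS; apply: subset_leq_card; apply: setSD; apply: vU_sup.
case/and3P=> aN bN /nestP[h1 h2 h3].
have inM w : w \in N -> w \in a |: (b |: N) by move=> wN; rewrite !in_setU1 wN !orbT.
have N1 w : w \in N -> w \notin tU ts -> (w \in tau) \/ (v w \in BG).
  move=> wN wT; have wB := h1 w (inM w wN) wT.
  have wF : v w \subset F by have [] := hB wB.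
  have E2 : vU [set w; b] = v w :|: G by rewrite /vU bigcup_setU !big_set1 vb.
  have wb : w != b by apply: contraNneq bN => <-.
  have wnG : v w != G by apply: contraNneq wb => /vG ->.
  have [|||w'] := h3 [set w; b].
  - by apply/subsetP => x; rewrite !inE => /orP[/eqP->|/eqP->]; rewrite ?wN ?eqxx ?orbT.
  - by move=> x; rewrite !inE => /orP[/eqP->|/eqP->].
  - by rewrite E2; apply: hup GB cG _ _; rewrite ?subsetUr // subUset wF GF.
  rewrite E2 !inE => /orP[/eqP->|/eqP->] E; last first.
    left; have wG : v w \subset G by rewrite -vb E subsetUl.
    have [/properP[_ [q qw qG0]] _] := hB wB.
    have vw := ptP wB (minG wB wG wnG) qw qG0.
    apply/existsP; exists q; rewrite (subsetP wG) // qG0 -vw eqxx andbT /=.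
    apply: contraNneq aN => qu; rewrite (_ : a = w) //; apply: v_inj.
    by rewrite va vw qu.
  by right; rewrite wF andbT properEneq eq_sym wnG /= E subsetUr.
apply/nestP; split.
- move=> w wN; rewrite tU_tau negb_or => /andP[wt wT].
  by case: (N1 w wN wT) => //; rewrite (negPf wt).
- move=> t; rewrite in_cons => /orP[/eqP->|tts]; last first.
    by apply: contra (h2 t tts) => /subsetP s; apply/subsetP => w /s /inM.
  apply/negP => /subsetP tN.
  have EG : vU (a |: tau) = G.
    apply/eqP; rewrite eqEsubset; apply/andP; split.
      by apply: vU_sub => w; rewrite in_setU1 => /orP[/eqP->//|/tau_sub].
    apply/subsetP => p pG; have aU := vU_sup (setU11 a tau).
    have [pG0|pG0] := boolP (p \in G0).
      by apply: (subsetP aU); rewrite va in_setU1 pG0 orbT.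
    have [->|pu] := eqVneq p u; first by apply: (subsetP aU); rewrite va in_setU1 eqxx.
    have [w vw] := full p (subsetP GF p pG) pG0.
    have wt : w \in tau by rewrite inE; apply/existsP; exists p; rewrite pG pG0 pu vw eqxx.
    by apply: (subsetP (vU_sup (setU1r a wt))); rewrite vw in_setU1 eqxx.
  have [|||w] := h3 (a |: tau).
  - apply/subsetP => w; rewrite in_setU1 => /orP[/eqP->|/tN/inM//].
    by rewrite in_setU1 eqxx.
  - move=> w; rewrite in_setU1 => /orP[/eqP->//|wt]; apply/negP => /nonT.
    by rewrite tauB.
  - by rewrite EG.
  rewrite EG in_setU1 => /orP[/eqP->|/tau_nG/eqP//] E.
  by have := vaNG; rewrite E eqxx.
move=> S SN ST SB; apply: h3; last exact: BGB.
  by apply/subsetP => w wS; apply: inM; apply: (subsetP SN).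
by move=> w /ST; rewrite tU_tau negb_or => /andP[].
Qed.

End Step.

Definition full (G0 F : {set V}) := forall H, G0 \proper H -> H \subset F -> exists w, v w = H.

Lemma full_pt G0 F p : full G0 F -> G0 \subset F -> p \in F -> p \notin G0 ->
  exists w, v w = p |: G0.
Proof.
move=> fu G0F pF pG0; apply: fu; last by rewrite subUset sub1set pF.
by rewrite properE subsetUr /=; apply: contra pG0 => /subsetP; apply; rewrite setU11.
Qed.

(** * Building sets consisting of atoms and the top *)

Section BaseCase.
Variables (ts : seq {set 'I_n}) (G0 F : {set V}) (B : {set {set V}}) (z : 'I_n).
Hypotheses (bB : building G0 F B) (fu : full G0 F) (vz : v z = F)
  (hT : forall w, w \in tU ts -> v w \subset G0)
  (base : forall H, H \in B -> 1 < #|H :\: G0| -> H = F).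

Let pts := [set w | (v w \in B) && (#|v w :\: G0| <= 1)].

Let G0F : G0 \proper F. Proof. by have [] := building_in bB (building_top bB). Qed.

Let ptsP w : w \in pts -> exists p, [/\ p \in F, p \notin G0 & v w = p |: G0].
Proof.
rewrite inE => /andP[wB wc]; have [/properP[_ [q qw qG]] wF] := building_in bB wB.
by exists q; rewrite (subsetP wF) // (building_pt1 bB wB wc qw qG).
Qed.

Let ptsI w p : p \in F -> p \notin G0 -> v w = p |: G0 -> w \in pts.
Proof. by move=> pF pG vw; rewrite inE vw (building_pt bB) //= card_setU1D. Qed.

Lemma card_pts : #|pts| = #|F :\: G0|.
Proof.
rewrite -(card_imset _ v_inj).
have -> : v @: pts = [set p |: G0 | p in F :\: G0].
  apply/setP => H; apply/imsetP/imsetP => [[w wp ->]|[p]].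
    by have [p [pF pG vw]] := ptsP wp; exists p => //; rewrite inE pF pG.
  rewrite inE => /andP[pG pF] ->; have [w vw] := full_pt fu (proper_sub G0F) pF pG.
  by exists w => //; apply: ptsI vw.
apply: card_in_imset => p q; rewrite !inE => /andP[pG _] _ /setP/(_ p).
by rewrite !inE eqxx (negPf pG) !orbF => /esym/eqP.
Qed.

Let zT : z \notin tU ts.
Proof. by apply/negP => /hT; rewrite vz; apply/negP; apply: proper_subn. Qed.

Let tz t : t \in ts -> z \notin t.
Proof. by move=> tts; apply: contra zT; apply: (subsetP (tU_sup tts)). Qed.

Let vF w : v w = F -> w = z. Proof. by move=> E; apply: v_inj; rewrite E vz. Qed.

(** Apart from the top, a nested set must only omit an atom: all atoms together have union [F]. The
    top is compatible with everything, so [z] is a cone apex. If [F] is itself an atom, then [pts]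
    is the one-point set of [z] and the boundary factor is neutral. *)
Lemma nest_base N : nest ts B N = joinb (pts :: ts) (N :\ z).
Proof.
have tUE w : (w \in \bigcup_(t <- pts :: ts) t) = (w \in pts) || (w \in tU ts).
  by rewrite big_cons in_setU.
apply/nestP/andP => [[h1 h2 h3]|[/subsetP h1 /= /andP[h2 /allP h3]]].
  split; first (apply/subsetP => w; rewrite in_setD1 tUE => /andP[wz wN]).
    have [_|wT] := boolP (w \in tU ts); first by rewrite orbT.
    have wB := h1 w wN wT; rewrite inE wB /= leqNgt orbF; apply: contra wz => wc.
    by apply/eqP; apply: vF; apply: base.
  apply/andP; split; last first.
    by apply/allP => t tts; apply: contra (h2 t tts) => s; apply: subset_trans s (subD1set _ _).
  apply/negP => /subsetP pN.
  have EF : vU pts = F.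
    apply/eqP; rewrite eqEsubset; apply/andP; split.
      by apply: vU_sub => w; rewrite inE => /andP[wB _]; have [] := building_in bB wB.
    apply/subsetP => p pF.
    suff [w wp pw] : exists2 w, w \in pts & p \in v w by apply: (subsetP (vU_sup wp)).
    have [pG|pG] := boolP (p \in G0).
      have /properP[_ [q qF qG]] := G0F; have [w vw] := full_pt fu (proper_sub G0F) qF qG.
      by exists w; rewrite ?vw ?in_setU1 ?pG ?orbT //; apply: ptsI vw.
    have [w vw] := full_pt fu (proper_sub G0F) pF pG.
    by exists w; rewrite ?vw ?setU11 //; apply: ptsI vw.
  have [|||w wp] := h3 pts.
  - by apply/subsetP => w /pN; rewrite in_setD1 => /andP[].
  - move=> w wp; apply/negP => /hT; have [p [_ pG ->]] := ptsP wp.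
    by rewrite subUset sub1set (negPf pG).
  - by rewrite EF (building_top bB).
  rewrite EF => /vF wz; have := pN w wp; by rewrite in_setD1 wz eqxx.
have h1' w : w \in N -> w != z -> w \notin tU ts -> w \in pts.
  by move=> wN wz /negPf wT; have := h1 w; rewrite in_setD1 wz wN tUE wT orbF; apply.
split.
- move=> w wN wT; have [->|wz] := eqVneq w z; first by rewrite vz (building_top bB).
  by have := h1' w wN wz wT; rewrite inE => /andP[].
- move=> t tts; apply: contra (h3 t tts) => s; rewrite subsetD1 s /=.
  exact: tz.
move=> S SN ST SB; have [sF'] := building_in bB SB; move=> sF.
have [zS|zS] := boolP (z \in S).
  by exists z => //; apply/eqP; rewrite eqEsubset vU_sup //= vz sF.
have Sp w : w \in S -> w \in pts.
  move=> wS; apply: h1'; [exact: (subsetP SN)|by apply: contraNneq zS => <-|exact: ST].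
have [Yc|Yc] := ltnP 1 #|vU S :\: G0|.
  have SF := base SB Yc; case/negP: h2; apply/subsetP => w wp.
  have [p [pF pG vw]] := ptsP wp; have [|w' w'S pw'] := @vUP S p; first by rewrite SF.
  have [q [_ _ vw']] := ptsP (Sp w' w'S); move: pw'.
  rewrite vw' in_setU1 (negPf pG) orbF => /eqP pq.
  have -> : w = w' by apply: v_inj; rewrite vw vw' pq.
  by rewrite in_setD1 (subsetP SN) // andbT; apply: contraNneq zS => <-.
have [/properP[_ [q qS qG]] _] := building_in bB SB.
have [w wS qw] := vUP qS; exists w => //; rewrite (building_pt1 bB SB Yc qS qG).
have := Sp w wS; rewrite inE => /andP[wB wc].
exact: (building_pt1 bB wB wc qw qG).
Qed.

Lemma good_nest_base : all (fun t => t != set0) ts -> disj ts ->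
  good k (dimJ ts + #|F :\: G0|) (dimJ ts + #|F :\: G0|).-1 (dimJ ts + #|F :\: G0|).+1
    (nest ts B).
Proof.
move=> tsn tsd.
have cp : 0 < #|F :\: G0|.
  by have /properP[_ [q qF qG]] := G0F; apply/card_gt0P; exists q; rewrite inE qF qG.
have E : dimJ ts + #|F :\: G0| = (dimJ (pts :: ts)).+1.
  by rewrite /dimJ big_cons card_pts -addSn prednK // addnC.
have gJ : good k (dimJ (pts :: ts)) (dimJ (pts :: ts)) (dimJ (pts :: ts)).+1 (joinb (pts :: ts)).
  apply: good_joinb => //=; first by rewrite -card_gt0 card_pts cp.
  rewrite /disj /= -/(disj ts) tsd andbT; apply/allP => t tts.
  apply/pred0P => w /=; apply/negP => /andP[/ptsP[p [_ pG vw]] wt].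
  by have := hT (subsetP (tU_sup tts) w wt); rewrite vw subUset sub1set (negPf pG).
rewrite E /=; apply: (goodS (@down_nest _ _)).
apply: (good_cone (@down_joinb _ _) _ nest_base gJ) => N.
case/andP => /subsetP sN /= /andP[pN _]; apply/negP => zN.
have := sN z zN; rewrite big_cons in_setU -/(tU ts) (negPf zT) orbF => zp.
case/negP: pN; apply/subsetP => w wp; suff -> : w = z by [].
have [p [pF pG vw]] := ptsP wp; have [q [qF qG vq]] := ptsP zp.
have : p \in q |: G0 by rewrite -vq vz.
by rewrite in_setU1 (negPf pG) orbF => /eqP pq; apply: v_inj; rewrite vw vq pq.
Qed.

End BaseCase.

Let arithd j f c g : f = c + g -> 1 < c -> j + f = (c.-1.-1 + j + g).+2.
Proof. lia. Qed.

Let ariths j c g : 0 < g -> (c + j + g).+2.-1 = (c + j + g).-1.+2.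
Proof. lia. Qed.

(** Outer induction on the height of the interval, for the links, and inner induction on the size of
    [B], for the contractions. Links acquire a new boundary factor, which is why [ts] is general. *)
Lemma good_nest ts G0 F B : building G0 F B -> full G0 F ->
  (forall w, w \in tU ts -> v w \subset G0) -> all (fun t => t != set0) ts -> disj ts ->
  good k (dimJ ts + #|F :\: G0|) (dimJ ts + #|F :\: G0|).-1 (dimJ ts + #|F :\: G0|).+1
    (nest ts B).
Proof.
have [m le] := ubnP #|F :\: G0|; elim: m => // m IHm in ts G0 B le *.
have [l leB] := ubnP #|B|; elim: l => // l IHl in B leB *.
move=> bB fu hT tsn tsd.
have G0F : G0 \proper F by have [] := building_in bB (building_top bB).
pose nonpt := [pred H : {set V} | [&& H \in B, 1 < #|H :\: G0| & H != F]].
have [/existsP[H0 PH0]|none] := boolP [exists H, nonpt H]; last first.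
  have [z vz] := fu F G0F (subxx F).
  apply: (good_nest_base bB fu vz) => // H HB Hc; apply/eqP; apply: contraNT none => HF.
  by apply/existsP; exists H; rewrite /= HB Hc HF.
have [G /and3P[GB cG GnF] Gmin] := arg_minnP (fun H : {set V} => #|H|) PH0.
have [pG0G GF] := building_in bB GB.
have minG H : H \in B -> H \subset G -> H != G -> #|H :\: G0| <= 1.
  move=> HB HG HnG; rewrite leqNgt; apply: contra HnG => Hc; rewrite eqEcard HG /=.
  apply: Gmin; rewrite /= HB Hc /=; apply: contraNneq GnF => HF.
  by rewrite eqEsubset GF -HF HG.
have [u] : exists u, u \in G :\: G0 by apply/card_gt0P; apply: ltnW.
rewrite inE => /andP[uG0 uG].
have [a va] := full_pt fu (proper_sub G0F) (subsetP GF u uG) uG0.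
have [b vb] := fu G pG0G GF.
pose tau := otherpts G0 G u; pose BG := above F G.
have pGF : G \proper F by rewrite properEneq GnF.
have bC : building G0 F (B :\ G).
  split.
  - by move=> H; rewrite in_setD1 => /andP[_]; apply: building_in.
  - move=> p pF pG; rewrite in_setD1 (building_pt bB) // andbT; apply/eqP => E.
    by have := card_setU1D G0 p; rewrite E leqNgt cG.
  - move=> H H'; rewrite !in_setD1 => /andP[HnG HB] Hc HH' H'F.
    rewrite (building_up bB HB) // andbT; apply/eqP => E; rewrite E in HH'.
    by have := minG H HB HH' HnG; rewrite leqNgt Hc.
  by rewrite in_setD1 eq_sym GnF (building_top bB).
have gC : good k (dimJ ts + #|F :\: G0|) (dimJ ts + #|F :\: G0|).-1
    (dimJ ts + #|F :\: G0|).+1 (nest ts (B :\ G)).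
  by apply: IHl => //; move: leB; rewrite (cardsD1 G) GB.
have fuG : full G F.
  move=> H GH HF; apply: fu => //; exact: proper_trans GH.
have bG : building G F BG.
  split.
  - by move=> H; rewrite inE => /andP[].
  - move=> p pF pG; have pp : G \proper p |: G.
      by rewrite properE subsetUr /=; apply: contra pG => /subsetP; apply; rewrite setU11.
    by rewrite inE pp subUset sub1set pF GF.
  - move=> H H'; rewrite !inE => /andP[GH _] _ HH' ->; rewrite andbT.
    exact: proper_sub_trans HH'.
  by rewrite inE pGF subxx.
have tauE w : w \in tau -> exists p, [/\ p \in G, p \notin G0, p != u & v w = p |: G0].
  by rewrite inE => /existsP[p /and4P[? ? ? /eqP ?]]; exists p.
have ctau : #|tau| = #|G :\: G0|.-1.
  rewrite (cardsD1 u (G :\: G0)) inE uG0 uG /= -(card_imset _ v_inj).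
  have -> : v @: tau = [set p |: G0 | p in (G :\: G0) :\ u].
    apply/setP => H; apply/imsetP/imsetP => [[w wp ->]|[p]].
      by have [p [pG pG0 pu vw]] := tauE _ wp; exists p => //; rewrite !inE pG pG0 pu.
    rewrite !inE => /and3P[pu pG0 pG] ->.
    have [w vw] := full_pt fu (proper_sub G0F) (subsetP GF p pG) pG0.
    by exists w => //; rewrite inE; apply/existsP; exists p; rewrite pG pG0 pu vw eqxx.
  apply: card_in_imset => p q; rewrite !inE => /and3P[_ pG _] _ /setP/(_ p).
  by rewrite !inE eqxx (negPf pG) !orbF => /esym/eqP.
have cF : #|F :\: G0| = #|G :\: G0| + #|F :\: G|.
  rewrite -cardsUI (_ : _ :&: _ = set0) ?cards0 ?addn0.
    congr #|pred_of_set _|; apply/setP => x; rewrite !inE.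
    have := subsetP GF x; have := subsetP (proper_sub pG0G) x.
    by case: (x \in G); case: (x \in G0); case: (x \in F) => //= h1 h2; rewrite ?(h1 isT) ?(h2 isT).
  by apply/setP => x; rewrite !inE; case: (x \in G); rewrite ?andbF.
have cFG : 0 < #|F :\: G|.
  by have /properP[_ [q qF qG]] := pGF; apply/card_gt0P; exists q; rewrite inE qF qG.
have gL : good k (dimJ (tau :: ts) + #|F :\: G|) (dimJ (tau :: ts) + #|F :\: G|).-1
    (dimJ (tau :: ts) + #|F :\: G|).+1 (nest (tau :: ts) BG).
  apply: IHm => //=.
  - rewrite ltnS in le; apply: leq_trans le; rewrite cF -[X in X < _]add0n ltn_add2r.
    exact: ltnW.
  - move=> w; rewrite /tU big_cons in_setU => /orP[/tauE[p [pG _ _ ->]]|/hT wG].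
      by rewrite subUset sub1set pG proper_sub.
    exact: subset_trans (proper_sub pG0G).
  - by rewrite tsn andbT -card_gt0 ctau -ltnS prednK // ltnW.
  rewrite /disj /= -/(disj ts) tsd andbT; apply/allP => t tts.
  apply/pred0P => w /=; apply/negP => /andP[/tauE[p [_ pG _ vw]] wt].
  by have := hT w (subsetP (tU_sup tts) w wt); rewrite vw subUset sub1set (negPf pG).
have gL2 := goodS (@down_nest _ _) gL.
have Ed : dimJ ts + #|F :\: G0| = (dimJ (tau :: ts) + #|F :\: G|).+2.
  by rewrite /dimJ big_cons ctau; apply: arithd.
(* The predecessor is not truncated because [F :\: G] is nonempty. *)
have Es : (dimJ (tau :: ts) + #|F :\: G|).+2.-1 = (dimJ (tau :: ts) + #|F :\: G|).-1.+2.
  by rewrite /dimJ big_cons; apply: ariths.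
rewrite Ed Es in gC *.
apply: (good_contraction (nest_ab cG va vb) (@down_nest _ _) _ kinf _ _ gC gL2).
- exact: (nest_link bB hT GB cG uG uG0 va vb).
- exact: (nest_contract bB hT GB cG minG uG uG0 va vb).
apply: (nest_edge_link bB hT GB cG minG uG uG0 va vb).
by move=> p pF pG0; apply: (full_pt fu (proper_sub G0F)).
Qed.

End Nested.

(** * Subdivisions of shellable complexes *)

Section Subdivision.
Local Open Scope nat_scope.
Variables (k : fieldType) (n : nat) (V : finType) (v : 'I_n -> {set V}).
Hypothesis kinf : ~ exists s : seq k, forall c : k, c \in s.
Hypotheses (v_inj : injective v) (v_neq0 : forall w, v w != set0).
Implicit Types (N : {set 'I_n}) (F G H R : {set V}) (D : {set {set V}}).

(** All subcomplexes share the variables ['I_n], so that their ideals lie in one ring and can be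
    glued. *)
Definition sdc D N := [forall w in N, v w \in D] &&
  [forall a in N, forall b in N, (v a \subset v b) || (v b \subset v a)].

Lemma sdcP D N : reflect ((forall w, w \in N -> v w \in D) /\
    (forall a b, a \in N -> b \in N -> (v a \subset v b) || (v b \subset v a))) (sdc D N).
Proof.
apply: (iffP andP) => [[/forall_inP h1 /forall_inP h2]|[h1 h2]].
  by split=> // a b aN bN; have /forall_inP/(_ b bN) := h2 a aN.
split; apply/forall_inP => // a aN; apply/forall_inP => b bN; exact: h2.
Qed.

Lemma down_sdc D : down (sdc D).
Proof.
move=> M N /subsetP MN /sdcP[h1 h2]; apply/sdcP; split=> [w /MN/h1 //|a b /MN aN /MN bN].
exact: h2.
Qed.

Lemma eq_sdc D D' : D = D' -> sdc D =1 sdc D'.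
Proof. by move=> ->. Qed.

Lemma chain_max N w0 : w0 \in N ->
  (forall a b, a \in N -> b \in N -> (v a \subset v b) || (v b \subset v a)) ->
  exists2 w, w \in N & forall a, a \in N -> v a \subset v w.
Proof.
move=> w0N ch; have [w wN wmax] := arg_maxnP (fun w => #|v w|) w0N.
exists w => // a aN; case/orP: (ch a w aN wN) => // wa.
by have /eqP -> : v a == v w by rewrite eq_sym eqEcard wa; apply: wmax.
Qed.

(** A nonempty chain has a largest face, and it lies in whichever piece contains that face. *)
Lemma sdcU D D1 D2 : (forall F, (F \in D) = (F \in D1) || (F \in D2)) ->
  (forall F H, F \in D1 -> H \subset F -> H \in D1) ->
  (forall F H, F \in D2 -> H \subset F -> H \in D2) ->
  forall N, sdc D N = sdc D1 N || sdc D2 N.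
Proof.
move=> DE d1 d2 N; apply/idP/orP => [/sdcP[h1 h2]|[]/sdcP[h1 h2]]; last 2 first.
- by apply/sdcP; split=> // w wN; rewrite DE h1.
- by apply/sdcP; split=> // w wN; rewrite DE h1 ?orbT.
have [N0|[w0 w0N]] := set_0Vmem N.
  by left; apply/sdcP; split=> [w|a b]; rewrite N0 inE.
have [w wN wmax] := chain_max w0N h2.
have := h1 w wN; rewrite DE => /orP[wD|wD]; [left|right]; apply/sdcP; split=> // a aN.
  exact: d1 wD (wmax a aN).
exact: d2 wD (wmax a aN).
Qed.

Lemma sdcI D D1 D2 : (forall F, (F \in D) = (F \in D1) && (F \in D2)) ->
  forall N, sdc D N = sdc D1 N && sdc D2 N.
Proof.
move=> DE N; apply/sdcP/andP => [[h1 h2]|[/sdcP[h1 h2] /sdcP[g1 _]]].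
  by split; apply/sdcP; split=> // w /h1; rewrite DE => /andP[].
by split=> // w wN; rewrite DE h1 ?g1.
Qed.

Definition vfull F := forall H : {set V}, H != set0 -> H \subset F -> exists w, v w = H.

(** For the building set of all nonempty subsets the nested sets are the chains: the union of two
    members must be one of them. *)
Lemma good_sd_simplex F : vfull F -> good k #|F| #|F|.-1 #|F|.+1 (sdc (powerset F)).
Proof.
move=> fu; have [->|F0] := eqVneq F set0.
  rewrite cards0; apply: eq_good (good_nil k n) => N; rewrite /joinb big_nil subset0 andbT.
  apply/eqP/sdcP => [->|[h1 _]]; first by split=> [w|a b]; rewrite inE.
  apply/setP => w; rewrite inE; apply/negP => /h1; rewrite inE subset0.
  by apply/negP; apply: v_neq0.
pose B := [set H : {set V} | (H != set0) && (H \subset F)].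
have p0 (H : {set V}) : (set0 \proper H) = (H != set0) by rewrite properEneq sub0set andbT eq_sym.
have bB : building set0 F B.
  split.
  - by move=> H; rewrite inE p0 => /andP[].
  - move=> p pF _; rewrite inE setU0 sub1set pF andbT; apply/set0Pn; exists p; exact: set11.
  - move=> H H'; rewrite !inE => /andP[/set0Pn[x xH] _] _ HH' ->; rewrite andbT.
    by apply/set0Pn; exists x; apply: (subsetP HH').
  by rewrite inE F0 subxx.
have fu' : full v set0 F by move=> H; rewrite p0; apply: fu.
have := good_nest kinf v_inj (ts := [::]) bB fu'.
rewrite /dimJ big_nil add0n setD0 => /(_ _ isT isT) g; apply: eq_good (g _) => [N|w]; last first.
  by rewrite /tU big_nil inE.
apply/nestP/sdcP => [[h1 _ h3]|[h1 h2]].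
  have T0 (w : 'I_n) : w \notin tU [::] by rewrite /tU big_nil inE.
  split=> [w wN|a b aN bN].
    by have := h1 w wN (T0 w); rewrite !inE => /andP[].
  have E : vU v [set a; b] = v a :|: v b by rewrite /vU bigcup_setU !big_set1.
  have [|||w] := h3 [set a; b].
  - by rewrite subUset !sub1set aN bN.
  - by move=> w _; apply: T0.
  - rewrite E inE -subset0 subUset subset0 (negPf (v_neq0 a)) /= subUset.
    have := h1 a aN (T0 a); have := h1 b bN (T0 b); rewrite !inE.
    by move=> /andP[_ ->] /andP[_ ->].
  by rewrite E !inE => /orP[/eqP->|/eqP->] ->; rewrite ?subsetUl ?subsetUr ?orbT.
split=> // [w wN _|S SN _].
  by have := h1 w wN; rewrite !inE v_neq0.
rewrite inE => /andP[/set0Pn[x /vUP[w0 w0S _]] _].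
have [|w wS wmax] := @chain_max S w0 w0S.
  by move=> a b aS bS; apply: h2; apply: (subsetP SN).
exists w => //; apply/eqP; rewrite eqEsubset vU_sup //=.
exact: vU_sub.
Qed.

(* The union of the facets [F :\ r] of the simplex [F], for [r] in [R]. *)
Definition halfbd F R := [set G : {set V} | (G \subset F) && ~~ (R \subset G)].

(** Peel off the facet [F :\ r]: it meets the remaining ones in the complex of the same kind for
    [F :\ r] and [R :\ r]. A single facet is a simplex. *)
Lemma good_sd_halfbd F R f : vfull F -> #|F| = f.+1 -> R \subset F -> R != set0 ->
  good k f f.-1 f.+1 (sdc (halfbd F R)).
Proof.
have [l le] := ubnP #|R|; elim: l => // l IH in F R f le *.
move=> fu cF RF /set0Pn[r rR]; have rF := subsetP RF r rR.
have cFr : #|F :\ r| = f by move: cF; rewrite (cardsD1 r) rF => -[].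
have fur : vfull (F :\ r).
  by move=> H H0 HF; apply: fu => //; apply: subset_trans HF (subD1set _ _).
have gs := good_sd_simplex fur; rewrite cFr in gs.
have inFr (G : {set V}) : (G \subset F :\ r) = (G \subset F) && (r \notin G) by rewrite subsetD1.
have [R0|R'n] := eqVneq (R :\ r) set0.
  apply: eq_good gs; apply: eq_sdc; apply/setP => G; rewrite !inE inFr.
  by rewrite -(setD1K rR) R0 setU0 sub1set.
have RG (G : {set V}) : (R \subset G) = (r \in G) && (R :\ r \subset G).
  by rewrite -{1}(setD1K rR) subUset sub1set.
have rR' : R :\ r \subset F :\ r by apply: setSD.
case: f => [|f] in cF cFr gs *.
  by move: R'n; rewrite -subset0; move/eqP: cFr; rewrite cards_eq0 => /eqP <-; rewrite rR'.
have cR : #|R :\ r| < l by move: le; rewrite (cardsD1 r) rR.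
have g1 := IH F (R :\ r) f.+1 cR fu cF (subset_trans rR' (subD1set _ _)) R'n.
have g3 := IH (F :\ r) (R :\ r) f cR fur cFr rR' R'n.
apply: (good_union kinf (@down_sdc _) (@down_sdc _) _ _ g1 gs g3).
- apply: sdcU.
  + move=> G; rewrite !inE inFr RG; case: (G \subset F) => //=.
    by case: (r \in G); rewrite /= ?orbF ?orbT.
  + move=> G H; rewrite !inE => /andP[GF RnG] HG; rewrite (subset_trans HG) //=.
    by apply: contra RnG => /subset_trans; apply.
  by move=> G H; rewrite !inE => GF HG; apply: subset_trans HG GF.
apply: sdcI => G; rewrite !inE inFr; case: (G \subset F) => //=.
by rewrite andbC.
Qed.

Lemma card_facet D d F : dim_is D d -> Defs.pure D -> facet D F -> #|F| = d.
Proof.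
move=> [[F0 F0D c0] le] pu fF; rewrite -c0; apply: pu => //; split=> // G GD F0G.
by apply/eqP; rewrite eq_sym eqEcard F0G c0 le.
Qed.

Lemma facet_above D F : F \in D -> exists2 G, facet D G & F \subset G.
Proof.
move=> FD; pose P := [pred G : {set V} | (G \in D) && (F \subset G)].
have PF : P F by rewrite /= FD subxx.
have [G /andP[GD FG] Gmax] := arg_maxnP (fun G : {set V} => #|G|) PF.
exists G => //; split=> // H HD GH; apply/eqP; rewrite eq_sym eqEcard GH.
by apply: Gmax; rewrite /= HD (subset_trans FG).
Qed.

Lemma good_sd_shellable D d : simplicial_complex D -> dim_is D d -> shellable D ->
  (forall F, F \in D -> vfull F) -> good k d d.-1 d.+1 (sdc D).
Proof.
move=> [D0 Dd] dD [pu [[F E]|[s [us sF sh]]]] fu.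
  have FD : F \in D by rewrite E inE.
  have cF : #|F| = d.
    apply: (card_facet dD pu); split=> // G; rewrite E inE => GF FG.
    by apply/eqP; rewrite eqEsubset GF FG.
  by rewrite E -cF; apply: good_sd_simplex; apply: fu.
pose De i := [set G : {set V} | [exists j : 'I_(size s), (j < i) && (G \subset nth set0 s j)]].
have fac i : i < size s -> facet D (nth set0 s i) by move=> is_; apply/sF; apply: mem_nth.
have DeP i G : i <= size s -> (G \in De i) <-> exists2 j, j < i & G \subset nth set0 s j.
  move=> le; rewrite inE; split=> [/existsP[j /andP[ji Gj]]|[j ji Gj]]; first by exists j.
  by apply/existsP; exists (Ordinal (leq_trans ji le)); rewrite ji.
have Ded i F H : F \in De i -> H \subset F -> H \in De i.
  rewrite !inE => /existsP[j /andP[ji Fj]] HF; apply/existsP; exists j.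
  by rewrite ji (subset_trans HF).
have step i : 0 < i <= size s -> good k d d.-1 d.+1 (sdc (De i)).
  elim: i => // i IH /= iS.
  have [FD _] := fac i iS; have cF := card_facet dD pu (fac i iS).
  have gF := good_sd_simplex (fu _ FD); rewrite cF in gF.
  have DeS G : (G \in De i.+1) = (G \in De i) || (G \in powerset (nth set0 s i)).
    rewrite [G \in powerset _]inE; apply/idP/orP.
      case/(DeP _ _ iS) => j; rewrite ltnS leq_eqVlt => /orP[/eqP->|ji] Gj; first by right.
      by left; apply/DeP; [exact: ltnW|exists j].
    by case=> [/(DeP _ _ (ltnW iS))[j ji Gj]|Gi]; apply/(DeP _ _ iS); [exists j => //; apply: ltnW|exists i].
  case: (posnP i) => [i0|i_gt0].
    apply: eq_good gF; apply: eq_sdc; apply/setP => G; rewrite DeS.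
    by rewrite i0 [G \in De 0]inE (_ : [exists _, _] = false) //; apply/existsP => -[].
  have [|S [Sn SA SG]] := sh i; first by rewrite i_gt0.
  (* The generators of the intersection each omit one vertex of [Fi]; these vertices form [R], so
     the intersection is [halfbd Fi R]. *)
  pose Fi := nth set0 s i; pose R := [set x in Fi | Fi :\ x \in S].
  have facetS A : A \in S -> exists2 x, x \in R & A = Fi :\ x.
    move=> AS; have [AF cA] := SA A AS.
    have /cards1P[x Ex] : #|Fi :\: A| == 1.
      by rewrite cardsD (setIidPr AF) -cA subSn // subnn.
    have xFi : x \in Fi by have := set11 x; rewrite -Ex inE => /andP[].
    have EA : A = Fi :\ x by rewrite -Ex setDDr setDv set0U; apply/esym/setIidPr.
    by exists x => //; rewrite inE xFi -EA AS.
  have Rn : R != set0.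
    by have [A /facetS[x xR _]] := set0Pn _ Sn; apply/set0Pn; exists x.
  have RF : R \subset Fi by apply/subsetP => x; rewrite inE => /andP[].
  have [x xR] := set0Pn _ Rn; have xF := subsetP RF x xR.
  case: d => [|f] in dD cF gF IH *.
    by move: xF; rewrite /Fi (cards0_eq cF) inE.
  have gI := good_sd_halfbd (fu _ FD) cF RF Rn.
  have gD : good k f.+1 f.+1.-1 f.+2 (sdc (De i)) by apply: IH; rewrite i_gt0 ltnW.
  apply: (good_union kinf (@down_sdc _) (@down_sdc _) _ _ gD gF gI).
  - apply: sdcU => //; first exact: Ded.
    by move=> G H; rewrite !inE => GF HG; apply: subset_trans HG GF.
  apply: sdcI => G; rewrite [G \in powerset _]inE; apply/idP/andP.
    rewrite inE => /andP[GF /subsetPn[y]]; rewrite inE => /andP[yF yS] yG.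
    split=> //; have [|_ [j ji Gj]] := (SG G).2.
      by exists (Fi :\ y) => //; rewrite subsetD1 GF.
    by apply/DeP; [exact: ltnW|exists j].
  case=> /(DeP _ _ (ltnW iS)) Gj GF; rewrite inE GF /=.
  have [A /facetS[y yR ->]] := (SG G).1 (conj GF Gj).
  rewrite subsetD1 => /andP[_ yG]; apply/subsetPn; exists y => //.
have [F0 fF0 _] := facet_above D0.
have s0 : 0 < size s by have := (sF F0).2 fF0; case: (s).
have := step (size s); rewrite s0 leqnn => /(_ isT); apply: eq_good; apply: eq_sdc.
apply/setP => G; apply/idP/idP.
  by case/(DeP _ _ (leqnn _)) => j /fac[FD _] /(Dd _ _ FD).
move=> GD; have [H /sF Hs GH] := facet_above GD.
apply/(DeP _ _ (leqnn _)); exists (index H s); first by rewrite index_mem.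
by rewrite nth_index.
Qed.

End Subdivision.

(** * Translation to coefficient functions *)

Section Translation.
Variables (k : fieldType) (W : finType).
Notation n := #|W|.
Notation A := {mpoly k[n]}.

Definition mnm_of (mu : mon W) : 'X_{1..n} := [multinom mu (enum_val i) | i < n].
Definition mon_of (m : 'X_{1..n}) : mon W := [ffun w => m (enum_rank w)].

Lemma mnm_ofK mu : mon_of (mnm_of mu) = mu.
Proof. by apply/ffunP => w; rewrite ffunE mnmE enum_rankK. Qed.

Lemma mon_ofK m : mnm_of (mon_of m) = m.
Proof. by apply/mnmP => i; rewrite mnmE ffunE enum_valK. Qed.

Lemma deg_mon_of m : deg (mon_of m) = mdeg m.
Proof.
rewrite /deg mdegE (reindex_onto enum_val enum_rank) => [|w _]; last exact: enum_rankK.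
by apply: eq_big => [i|i _]; rewrite ?enum_valK ?eqxx // ffunE enum_valK.
Qed.

Definition fn_of (p : A) : poly_fn k W := fun mu => p@_(mnm_of mu).
Definition mp_of e (f : poly_fn k W) : A :=
  \sum_(m : 'X_{1..n < e.+1} | mdeg m == e) f (mon_of m) *: 'X_[m].

Lemma mp_of_homog e f : mp_of e f \is e.-homog.
Proof. by apply: rpred_sum => m md; apply: rpredZ; rewrite dhomogX. Qed.

Lemma mcoeff_mp_of e f m : Defs.homog f e -> (mp_of e f)@_m = f (mon_of m).
Proof.
move=> hf; have [/eqP md|md] := boolP (mdeg m == e); last first.
  rewrite (dhomog_nemf_coeff (mp_of_homog e f) md); symmetry; apply/eqP.
  by apply: contraNT md => /hf <-; rewrite deg_mon_of.
have lt : (mdeg m < e.+1)%N by rewrite md.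
rewrite raddf_sum (bigD1 (BMultinom lt)) /=; last exact/eqP.
rewrite mcoeffZ mcoeffX eqxx mulr1 big1 ?addr0 // => m' /andP[_ mm].
rewrite mcoeffZ mcoeffX (_ : (bmnm m' == m) = false) ?mulr0 //.
by apply/negbTE; apply: contra mm => /eqP E; apply/eqP; apply: val_inj.
Qed.

Lemma mp_ofK e f : Defs.homog f e -> fn_of (mp_of e f) = f.
Proof.
by move=> hf; apply: functional_extensionality => mu; rewrite /fn_of mcoeff_mp_of // mnm_ofK.
Qed.

Lemma fn_of_homog e p : p \is e.-homog -> Defs.homog (fn_of p) e.
Proof.
move=> hp mu; apply: contra_neq_eq => md; apply: (dhomog_nemf_coeff hp).
by rewrite /= -deg_mon_of mnm_ofK.
Qed.

Lemma fn_ofK e p : p \is e.-homog -> mp_of e (fn_of p) = p.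
Proof.
move=> hp; apply/mpolyP => m; rewrite mcoeff_mp_of; last exact: fn_of_homog.
by rewrite /fn_of mon_ofK.
Qed.

Lemma fn_of_lin (l : 'I_n -> k) p :
  fn_of (lin l * p) = mulLin (fun w => l (enum_rank w)) (fn_of p).
Proof.
apply: functional_extensionality => mu; rewrite /fn_of /mulLin /lin mulr_suml raddf_sum.
rewrite [RHS]big_mkcond [RHS](reindex_onto enum_val enum_rank) => [|w _]; last exact: enum_rankK.
apply: eq_big => [i|i _]; first by rewrite enum_valK eqxx.
rewrite /= -scalerAl mcoeffZ mcoeffXM mnmE enum_valK; case: ifP => _; last by rewrite mulr0.
congr (_ * _@_ _); apply/mnmP => j; rewrite mnmBE !mnmE ffunE.
by rewrite (inj_eq enum_val_inj) eq_sym.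
Qed.

Lemma fn_of_pow (l : 'I_n -> k) e p :
  fn_of (lin l ^+ e * p) = iter e (mulLin (fun w => l (enum_rank w))) (fn_of p).
Proof. by elim: e => [|e IH] /=; rewrite ?expr0 ?mul1r // exprS -mulrA fn_of_lin IH. Qed.

Variables (G : {set {set W}}) (G' : {set 'I_n} -> bool).
Hypotheses (dG' : down G') (GG : forall m, G' (vsupp m) = (Defs.msupp (mon_of m) \in G)).
Variables (d : nat) (x : nat -> 'I_n -> k).

Definition par_of (j : 'I_d) w := x j.+1 (enum_rank w).

Lemma inPar_inJ e p : p \is e.-homog -> inPar (SR G') (tht x) d p -> inJ G par_of e (fn_of p).
Proof.
move=> hp Ip; have gZ := SR_gideal k dG'.
have [p1 [g [hp1 Zp1 Ep hg]]] : exists p1 g, [/\ p1 \is e.-homog, SR G' p1,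
    p = p1 + comb (tht x) d g & forall j mu, fn_of (g j) mu != 0 -> (deg mu).+1 = e].
  (* In degree 0, [inJ] forces the coefficients to be zero, whereas [inPar_decomp] speaks of the
     truncated degree [e.-1]. *)
  case: e hp => [|e] hp.
    exists p, (fun=> 0); split=> //.
    - exact: inPar_homog0 gZ (tht_homog x) hp Ip.
    - by rewrite /comb big1 ?addr0 // => j _; rewrite mulr0.
    by move=> j mu; rewrite /fn_of mcoeff0 eqxx.
  have [p1 [g [hp1 Zp1 Ep hg]]] := inPar_decomp gZ (tht_homog x) hp Ip.
  by exists p1, g; split=> // j mu /(fn_of_homog (hg j)) ->.
exists (fn_of p1), (fun j => fn_of (g j)); split=> //.
- move=> mu h; split; first exact: fn_of_homog hp1 mu h.
  apply: contraNN h => muG; rewrite /fn_of Zp1 // GG mnm_ofK //.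
- by move=> j; apply: hg.
move=> mu; rewrite {1}/fn_of Ep mcoeffD; congr (_ + _).
rewrite /comb raddf_sum; apply: eq_bigr => j _.
by have := congr1 (fun f => f mu) (fn_of_lin (x j.+1) (g j)).
Qed.

Lemma inJ_inPar e f : Defs.homog f e -> inJ G par_of e f -> inPar (SR G') (tht x) d (mp_of e f).
Proof.
move=> hf [h [g [hh hg E]]].
have hgj j : Defs.homog (g j) e.-1 by move=> m /hg <-.
exists (fun j => if insub j is Some j' then mp_of e.-1 (g j') else 0) => m Gm.
rewrite mcoeffB mcoeff_mp_of // E.
have -> : h (mon_of m) = 0.
  by apply/eqP; apply/negP => /negP/hh[_]; rewrite -GG Gm.
rewrite add0r /comb raddf_sum; apply/eqP; rewrite subr_eq0; apply/eqP.
apply: eq_bigr => j _; rewrite valK /=.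
have := congr1 (fun f => f (mon_of m)) (fn_of_lin (x j.+1) (mp_of e.-1 (g j))).
by rewrite mp_ofK // /fn_of mon_ofK.
Qed.

Lemma lefpar_translate N s : lefpar (SR G') x N d s d.+1 ->
  lsop G par_of /\ lefschetz_elt G par_of (fun w => x 0 (enum_rank w)) s.
Proof.
move=> [_ L V]; split.
  (* Vanishing in degree [d.+1] propagates to all higher degrees. *)
  exists d.+1 => i id f hf; rewrite -(mp_ofK hf); apply: inPar_inJ; first exact: mp_of_homog.
  have: vanish (SR G') (tht x) d i; last by apply; apply: mp_of_homog.
  rewrite -(subnK id); elim: (i - d.+1)%N => [|j IH]; first by rewrite add0n.
  by apply: vanishS => //; [apply: SR_gideal|apply: tht_homog].
move=> i is_ f hf; rewrite -{1}(mp_ofK hf) -fn_of_pow => J.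
have hp := mp_of_homog i f.
rewrite -(mp_ofK hf); apply: inPar_inJ => //; apply: (L i is_) => //.
have hq : lin (x 0) ^+ (s - 2 * i) * mp_of i f \is (s - i).-homog.
  have -> : (s - i = (s - 2 * i) + i)%N by lia.
  apply: dhomogM => //; rewrite -[X in X.-homog]mul1n; apply: dhomogMn; apply: lin_homog.
by rewrite -(fn_ofK hq); apply: inJ_inPar => //; apply: fn_of_homog.
Qed.

End Translation.

Section SubdivisionDim.
Local Open Scope nat_scope.
Variables (V : finType) (D : {set {set V}}) (d : nat).
Hypotheses (cD : simplicial_complex D) (dD : dim_is D d).

(** Cardinality is injective on a chain, with values from 1 to [d]; the initial segments of a
    listing of a largest face form a chain with [d] members. *)
Lemma sd_dim : dim_is (sd D) d.
Proof.
have [D0 Dd] := cD; have [[F FD cF] le] := dD; split; last first.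
  move=> C; rewrite inE => /forall_inP ch.
  rewrite cardE -(size_map (fun w : sd_vert D => #|val w|)) -(size_iota 1 d); apply: uniq_leq_size.
    rewrite map_inj_in_uniq ?enum_uniq // => a b; rewrite !mem_enum /= => aC bC cab.
    have /forall_inP/(_ b bC)/orP[s|s] := ch a aC; apply: val_inj; apply/eqP.
      by rewrite eqEcard s cab leqnn.
    by rewrite eq_sym eqEcard s cab leqnn.
  move=> _ /mapP[w _ ->]; rewrite mem_iota add1n ltnS card_gt0.
  by have /andP[wD ->] := valP w; rewrite le.
pose pre (i : nat) := [set y in take i (enum F)].
have pre_sub i : pre i \subset F.
  by apply/subsetP => y; rewrite inE => /mem_take; rewrite mem_enum.
have card_pre (i : 'I_d) : #|pre i.+1| = i.+1.
  rewrite cardsE (card_uniqP _) ?take_uniq ?enum_uniq // size_takel //.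
  by rewrite -cardE cF.
have preP (i : 'I_d) : (pre i.+1 \in D) && (pre i.+1 != set0).
  by rewrite (Dd _ _ FD (pre_sub _)) -card_gt0 card_pre.
pose w (i : 'I_d) : sd_vert D := exist _ (pre i.+1) (preP i).
exists [set w i | i : 'I_d]; last first.
  rewrite card_imset ?card_ord // => i j /(congr1 (fun a : sd_vert D => #|val a|)).
  by rewrite /= !card_pre => -[/val_inj].
have mono i j : i <= j -> pre i \subset pre j.
  move=> ij; apply/subsetP => y; rewrite !inE => yi.
  by rewrite -(subnKC ij) takeD mem_cat yi.
rewrite inE; apply/forall_inP => _ /imsetP[i _ ->]; apply/forall_inP => _ /imsetP[j _ ->] /=.
by case/orP: (leq_total i j) => ij; apply/orP; [left|right]; apply: mono.
Qed.

End SubdivisionDim.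

Theorem theorem1p1 (k : fieldType) (V : finType) (D : {set {set V}}) (d : nat) :
  infinite_field k -> simplicial_complex D -> dim_is D d -> shellable D ->
  almost_strong_lefschetz k (sd D).
Proof.
move=> kinf cD dD shD; exists d; split; first exact: sd_dim.
exists d; split; first exact: sd_dim.
pose v (i : 'I_#|sd_vert D|) : {set V} := val (enum_val i).
have v_inj : injective v by move=> i j /val_inj/enum_val_inj.
have v_neq0 w : v w != set0 by have /andP[] := valP (enum_val w).
have fu F : F \in D -> vfull v F.
  move=> FD H H0 HF; have HP : (H \in D) && (H != set0) by rewrite (cD.2 _ _ FD HF) H0.
  exists (enum_rank (exist _ H HP : sd_vert D)).
  by rewrite /v enum_rankK.
have [x Hx] := good_sd_shellable kinf v_inj v_neq0 cD dD shD fu 0.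
have GG m : sdc v D (vsupp m) = (Defs.msupp (mon_of m) \in sd D).
  rewrite [RHS]inE; apply/sdcP/forall_inP => [[_ h] a am|h].
    apply/forall_inP => b bm; have := h (enum_rank a) (enum_rank b).
    by rewrite !inE in am bm *; rewrite !ffunE in am bm; rewrite /v !enum_rankK => /(_ am bm).
  split=> [w _|a b]; first by have /andP[] := valP (enum_val w).
  rewrite !inE => am bm; have := h (enum_val a); rewrite inE ffunE enum_valK => /(_ am).
  by move/forall_inP/(_ (enum_val b)); rewrite inE ffunE enum_valK => /(_ bm).
have [ls le] := lefpar_translate (@down_sdc _ _ v D) GG Hx.
by exists (@par_of k _ d x), (fun w => x 0%N (enum_rank w)).
Qed.
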